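(* For the two-hop multicast system, assume $n$ is large, $n>k_1$ and $n>k_2$, and let $k_1=\alpha_1 n$ and $k_2=\alpha_2 n$. Under the assumption of exponential interarrivals to the middle nodes with mean $E[R_2]$, and with shifted exponential service times (link delays) $X$ with parameters $(\lambda,c)$ in the first hop and $\tilde X$ with parameters $(\tilde\lambda,\tilde c)$ in the second hop, the average age for the earliest $k_1,k_2$ scheme can be approximated as $$\begin{aligned}\Delta'_{(k_1,k_2)}\approx{}& \frac{1}{\lambda} + \frac{1}{\tilde{\lambda}} + \frac{\tilde{c}}{\alpha_2} + \frac{\tilde{c}}{2} -\frac{1}{2\tilde{\lambda}}\log(1-\alpha_2) + \frac{2-\alpha_2+2\alpha_1\alpha_2}{2\alpha_1\alpha_2}c \\ & + \frac{\tilde{\lambda}K_1^2}{2\alpha_1\lambda[\lambda\alpha_1K_2+\tilde{\lambda}K_1]} + \frac{3\alpha_2-2\alpha_1\alpha_2-2}{2\alpha_1\alpha_2\lambda}\log(1-\alpha_1),\end{aligned}$$ where $K_1 = \lambda c-\log(1-\alpha_1)$ and $K_2 = \tilde{\lambda}\tilde{c}-\log(1-\alpha_2)$.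
   Context: A shifted exponential $(\lambda,c)$ random variable is $c+E$ with $E$ exponential of rate $\lambda$ and $c$ a positive constant. $X_{i:n}$ denotes the $i$-th smallest of $n$ i.i.d. copies of $X$. Two-hop system: a source has $n$ middle nodes as children, and each middle node has $n$ end nodes as children. Link delays are i.i.d. copies of $X$ in hop 1 and i.i.d. copies of $\tilde X$ in hop 2. The source generates time-stamped updates at will: it sends an update to its $n$ middle nodes and, as soon as the earliest $k_1$ of them have received it, it terminates the other $n-k_1$ transmissions and immediately generates the next update. A middle node that receives an update while idle immediately sends it to its $n$ end nodes, until the earliest $k_2$ of them have received it; then it terminates the other transmissions and waits idle for the next update arrival. Updates reaching a busy middle node are discarded. The interarrival time of updates at a middle node is written as $R_2=\sum_{i=1}^{M_1}(X_{k_1:n})_i$, where $M_1$ is geometric with parameter $k_1/n$ (the number of source update cycles between successive updates received by that middle node), so $E[R_2]=\frac{n}{k_1}E[X_{k_1:n}]$. $\Delta'_{(k_1,k_2)}$ denotes the average age of an end node when the interarrival times to the middle nodes are instead assumed exponential with the same mean $E[R_2]$; the total time a successfully delivered update spends in the system is the sum of its link delays in the two hops. The age at an end node at time $t$ is $\Delta(t)=t-u(t)$, where $u(t)$ is the time-stamp (generation time at the source) of the most recent update at that node, and the average age is $\lim_{\tau\to\infty}\frac1\tau\int_0^\tau\Delta(t)\,dt$. The sign $\approx$ is the informal large-$n$ approximation, in which harmonic numbers $H_m=\sum_{j=1}^m 1/j$ are replaced by $\log m+\gamma$ ($\gamma$ is Euler's constant) and the vanishing variance term of the order statistic is dropped.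 *)

(* Defs.v *)
From HB Require Import structures.
From mathcomp Require Import all_boot all_order all_algebra.
From mathcomp Require Import all_classical all_reals all_analysis.

Set Implicit Arguments.
Unset Strict Implicit.
Unset Printing Implicit Defensive.

Import Order.TTheory GRing.Theory Num.Theory.
Import numFieldNormedType.Exports.

Local Open Scope classical_set_scope.
Local Open Scope ring_scope.

Section Order_statistics.
Context {R : realType} {n : nat}.
Implicit Types (k : nat) (x : 'I_n -> R).

(* [x_{k:n}], the [k]-th smallest value, counting from [k = 1] *)
Definition ostat k x : R := nth 0 (sort <=%R (codom x)) k.-1.

Definition among_earliest k x (i : 'I_n) : bool := x i <= ostat k x.

End Order_statistics.

(* The least [m >= l] satisfying [G]; the junk value [0] is taken when there is
   none, which below happens only on null events. *)
Definition first_from (G : pred nat) (l : nat) : nat :=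
  if pselect (exists m, (l <= m)%N && G m) is left h then ex_minn h else 0%N.

(* the [j]-th (from [j = 0]) index satisfying [G] *)
Fixpoint occurrence (G : pred nat) (j : nat) : nat :=
  if j is j'.+1 then first_from G (occurrence G j').+1 else first_from G 0.

(* A sample path seen from one middle node [a] and one of its end nodes [b].
   - [x m i] is the link delay from the source to middle node [i] in the [m]-th
     source cycle;
   - [y v i] is the link delay from middle node [a] to its [i]-th end node in
     its [v]-th transmission;
   - [r j] is the time between the arrivals at [a] of its received updates
     number [j - 1] and [j] (between time [0] and arrival [0] if [j = 0]).
   All counters start from [0], and [a] is idle at time [0]. *)
Section Sample_path.
Context {R : realType} {n : nat}.
Variables (k1 k2 : nat) (a b : 'I_n).
Variables (x y : nat -> 'I_n -> R) (r : nat -> R).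

Definition received : pred nat := fun m => among_earliest k1 (x m) a.

(* [M_1]: by independence of the cycles, the cycles after a reception up to and
   including the next reception have the law of the cycles [0], ..., [M_1 - 1]
   up to and including the first reception *)
Definition cycles_to_reception : nat := (occurrence received 0).+1.

(* [R_2 = sum_(i = 1)^(M_1) (X_{k1:n})_i] *)
Definition reception_time : R :=
  \sum_(m < cycles_to_reception) ostat k1 (x m).

Definition hop1_delay (j : nat) : R := x (occurrence received j) a.

Definition arrival_time (j : nat) : R := \sum_(i < j.+1) r i.

(* The update number [j] arrives at [a] with a time-stamp equal to its arrival
   time minus its first link delay. *)
Definition timestamp (j : nat) : R := arrival_time j - hop1_delay j.

(* [accepted v] is the number of the update relayed in the [v]-th transmission:
   the first one to arrive after transmission [v - 1], which lasts until the
   [k2]-th end node is reached; the arrivals in between are discarded. *)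
Fixpoint accepted (v : nat) : nat :=
  if v is v'.+1 then
    first_from
      (fun j => arrival_time (accepted v') + ostat k2 (y v') <= arrival_time j)
      (accepted v').+1
  else 0%N.

Definition delivered (v : nat) : bool := among_earliest k2 (y v) b.

Definition delivery_time (v : nat) : R := arrival_time (accepted v) + y v b.

(* transmission [v] made the most recent delivery to [b] at or before [t] *)
Definition latest_delivery (t : R) : set nat :=
  [set v | [/\ delivered v, delivery_time v <= t &
    forall w, (v < w)%N -> delivered w -> t < delivery_time w]].

(* [u(t)]; it is [0] as long as nothing has been delivered. The most recent
   update at [b] is the last one received: since the arrivals at [a] are not
   driven by the source cycles, time-stamps may not increase with [v]. *)
Definition current_stamp (t : R) : R :=
  xget 0 [set timestamp (accepted v) | v in latest_delivery t].

Definition age (t : R) : R := t - current_stamp t.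

Definition time_average_age (tau : R) : R :=
  tau^-1 * \int[lebesgue_measure]_(t in `[0, tau]) age t.

End Sample_path.

Section Probability.
Context {R : realType} {d : measure_display} {T : measurableType d}.
Variable P : probability T R.

Definition mutually_independent (I : eqType) (F : I -> T -> R) : Prop :=
  forall (s : seq I) (B : I -> set R), uniq s -> (forall i, measurable (B i)) ->
    P (\bigcap_(i in [set` s]) (F i @^-1` B i)) =
    (\prod_(i <- s) P (F i @^-1` B i))%E.

(* [X = c + E] with [E] exponential of rate [lam] *)
Definition shifted_exponential (lam c : R) (X : T -> R) : Prop :=
  forall B : set R, measurable B ->
    P (X @^-1` B) = exponential_prob lam ((fun e => c + e) @^-1` B).

Definition exponential_rv (rate : R) (X : T -> R) : Prop :=
  forall B : set R, measurable B -> P (X @^-1` B) = exponential_prob rate B.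

(* The two-hop system in which the interarrival times [Z] at middle node [a] are
   i.i.d. exponential, with the mean of [R_2], and independent of the link
   delays. *)
Record two_hop_exp (lam c lam' c' : R) (n k1 : nat) (a : 'I_n)
    (X Y : nat -> 'I_n -> {RV P >-> R}) (Z : nat -> {RV P >-> R}) : Prop := {
  hop1_law : forall m i, shifted_exponential lam c (X m i) ;
  hop2_law : forall v i, shifted_exponential lam' c' (Y v i) ;
  interarrival_law : forall j,
    exponential_rv
      (fine 'E_P[fun w => reception_time k1 a (fun m i => X m i w)])^-1 (Z j) ;
  all_independent :
    mutually_independent
      (fun q : (nat * 'I_n) + (nat * 'I_n) + nat =>
         match q with
         | inl (inl (m, i)) => X m i : T -> R
         | inl (inr (v, i)) => Y v i : T -> R
         | inr j => Z j : T -> R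
         end) }.

End Probability.

(* [D] is the average age of an end node: the almost sure limit of the
   time-averaged age, in every realization of the system and for every end node
   [b] of every middle node [a]. *)
Definition average_age_exp (R : realType) (lam c lam' c' : R) (n k1 k2 : nat)
    (D : R) : Prop :=
  forall (d : measure_display) (T : measurableType d) (P : probability T R)
    (a b : 'I_n) (X Y : nat -> 'I_n -> {RV P >-> R}) (Z : nat -> {RV P >-> R}),
  two_hop_exp lam c lam' c' k1 a X Y Z ->
  {ae P, forall w,
    time_average_age k1 k2 a b (fun m i => X m i w) (fun v i => Y v i w)
      (fun j => Z j w) tau @[tau --> +oo] --> D}.

(* Main.v *)
Require Import Defs.
From HB Require Import structures.
From mathcomp Require Import all_boot all_order all_algebra.
From mathcomp Require Import all_classical all_reals all_analysis.
From mathcomp Require Import measurable_realfun.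
From mathcomp Require Import perm.
From mathcomp Require Import zify ring lra.
Import Order.TTheory GRing.Theory Num.Theory.
Import numFieldNormedType.Exports.
Local Open Scope classical_set_scope.
Local Open Scope ring_scope.
Set Implicit Arguments.
Unset Strict Implicit.
Unset Printing Implicit Defensive.

(* Cut the time axis at the arrivals of the updates that the middle node relays.
   The average age is the mean area under the age over one such cycle divided by
   the mean length of a cycle. By memorylessness, the idle times of the middle node
   are again i.i.d. exponential and independent of the hop-2 delays; and since the
   update to be relayed is selected without looking at the hop-1 delays, the first
   link delays of the relayed updates are i.i.d. with the law of a link delay
   conditioned on reception. So the cycles are driven by i.i.d. blocks, the age at
   the start of a cycle is independent of the block of this cycle, and it has
   bounded second moments because each delivery erases it. A strong law for
   uncorrelated variables then gives the average age in closed form, as a rational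
   function of the sums of [1 / (n - j)] and [1 / (n - j) ^ 2] over [j < k], which
   tend to [- ln (1 - alpha)] and [0] when [k / n] tends to [alpha]. *)

(** * Independence of generated sigma-algebras *)

Section Generated.
Context {R : realType} {T : pointedType}.
Variables (I : eqType) (F : I -> T -> R).

(** The obstacle is that relayed updates carry random indices: which arrival is accepted depends on
    the earlier interarrival times and hop-2 delays, and which source cycle it comes from depends on
    the earlier receptions. Independence is therefore never read off directly. Each event is
    partitioned by the value of the random index, and on one piece the path is replaced by a copy
    frozen at that index, which turns the past into an event of explicitly listed coordinates. The
    probability of a product event of the relay then factors by induction on the number of
    transmissions. The law of the age at the start of a cycle is never computed; only its long-run
    average is needed, and this comes from a telescoping recursion because delivery is independent
    of the present age. The tails of exponential order statistics are polynomials in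
    [exp (- lam * t)], so integrating powers of [t] against them is algebra on polynomials. Means
    that concern one fixed node follow from symmetric functions of the sample by exchangeability. *)

Definition coord_preimages (J : set I) : set (set T) :=
  [set A | exists i, J i /\ exists B : set R, measurable B /\ A = F i @^-1` B].

(** A copy of [T] whose measurable sets are those determined by the coordinates in [J]. Ascribing
    the domain [subalg J] to a function records which coordinates it may depend on, and
    measurability lemmas apply unchanged. *)
Definition subalg (J : set I) : Type := g_sigma_algebraType (coord_preimages J).

HB.instance Definition _ (J : set I) := Measurable.on (subalg J).

Lemma measurable_coord (J : set I) i : J i ->
  measurable_fun setT (F i : subalg J -> R).
Proof.
move=> Ji _ B mB; rewrite setTI; apply: sub_sigma_algebra.
by exists i; split => //; exists B.
Qed.

Lemma subset_subalg (J J' : set I) (A : set T) : J `<=` J' ->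
  @measurable _ (subalg J) A -> @measurable _ (subalg J') A.
Proof.
move=> JJ'; apply: (smallest_sub (smallest_sigma_algebra _ _)) => B [i [Ji hB]].
by apply: sub_sigma_algebra; exists i; split => //; exact: JJ'.
Qed.

Lemma measurable_fun_subset_subalg (J J' : set I) d' (T' : measurableType d')
    (f : T -> T') : J `<=` J' ->
  measurable_fun setT (f : subalg J -> T') ->
  measurable_fun setT (f : subalg J' -> T').
Proof.
move=> JJ' mf _ B mB; rewrite setTI; apply: (subset_subalg JJ').
by have := mf measurableT B mB; rewrite setTI.
Qed.

End Generated.

Section Independence.
Context {R : realType} {d : measure_display} {T : measurableType d}.
Variables (I : eqType) (F : I -> T -> R).
Local Notation subalg := (subalg F).

Hypothesis mF : forall i, measurable_fun setT (F i).

Lemma subalg_measurable (J : set I) (A : set T) :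
  @measurable _ (subalg J) A -> measurable A.
Proof.
apply: (smallest_sub (@sigma_algebra_measurable _ T)) => _ [i [_ [B [mB ->]]]].
by have := mF i measurableT mB; rewrite setTI.
Qed.

Lemma measurable_fun_subalg (J : set I) d' (T' : measurableType d')
    (f : T -> T') :
  measurable_fun setT (f : subalg J -> T') -> measurable_fun setT f.
Proof.
move=> mf _ B mB; rewrite setTI; apply: (@subalg_measurable J).
by have := mf measurableT B mB; rewrite setTI.
Qed.

Variable P : probability T R.
Hypothesis indF : mutually_independent P F.

(** A pi-system that generates the sigma-algebra of [subalg J] and whose probabilities are given
    directly by the independence hypothesis. *)
Definition cylinders (J : set I) : set (set T) :=
  [set A | exists (s : seq I) (B : I -> set R),
     [/\ uniq s, [set` s] `<=` J, forall i, measurable (B i) &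
       A = \bigcap_(i in [set` s]) (F i @^-1` B i)]].

Lemma cylinders_setI (J : set I) : setI_closed (cylinders J).
Proof.
move=> _ _ [s [B [us sJ mB ->]]] [s' [B' [us' s'J mB' ->]]].
(* A coordinate listed on one side only receives [setT] from the other side. *)
exists (undup (s ++ s')), (fun i =>
  (if i \in s then B i else setT) `&` (if i \in s' then B' i else setT)).
split.
- exact: undup_uniq.
- by move=> i /=; rewrite mem_undup mem_cat => /orP[/sJ|/s'J].
- by move=> i; apply: measurableI; case: ifPn.
- apply/seteqP; split => w /=.
    move=> [h h'] i; rewrite /= mem_undup mem_cat => _; split.
      by case: ifPn => // ?; exact: h.
    by case: ifPn => // ?; exact: h'.
  move=> h; split => i /= si.
    have [] := h i; first by rewrite /= mem_undup mem_cat si.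
    by rewrite si.
  have [] := h i; first by rewrite /= mem_undup mem_cat si orbT.
  by rewrite si.
Qed.

Lemma cylinders_generate (J : set I) (A : set T) :
  @measurable _ (subalg J) A -> <<s cylinders J >> A.
Proof.
apply: (smallest_sub (smallest_sigma_algebra _ _)) => _ [i [Ji [B [mB ->]]]].
apply: sub_sigma_algebra; exists [:: i], (fun=> B); split => //.
- by move=> j /=; rewrite inE => /eqP ->.
- apply/seteqP; split => w /=; first by move=> Bw j /=; rewrite inE => /eqP ->.
  by apply; rewrite /= inE.
Qed.

Lemma cylinders_measurable (J : set I) : cylinders J `<=` measurable.
Proof.
move=> _ [s [B [_ _ mB ->]]].
apply: fin_bigcap_measurable; first exact: finite_seq.
move=> i _.
by have := mF i measurableT (mB i); rewrite setTI.
Qed.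

Lemma cylindersT (J : set I) : cylinders J setT.
Proof.
exists [::], (fun=> setT); split => //.
by apply/seteqP; split => // w _ i.
Qed.

Lemma indep_cylinders (J J' : set I) (A A' : set T) : (forall i, J i -> ~ J' i) ->
  cylinders J A -> cylinders J' A' -> P (A `&` A') = (P A * P A')%E.
Proof.
move=> JJ' [s [B [us sJ mB ->]]] [s' [B' [us' s'J mB' ->]]].
have ss' i : i \in s -> i \in s' -> False.
  by move=> /sJ Ji /s'J; exact: JJ'.
have uss' : uniq (s ++ s').
  rewrite cat_uniq us us' andbT /=; apply/hasPn => i is'.
  by apply/negP => /ss' /(_ is').
pose C i := if i \in s then B i else B' i.
have -> : \bigcap_(i in [set` s]) (F i @^-1` B i) `&`
    \bigcap_(i in [set` s']) (F i @^-1` B' i) =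
    \bigcap_(i in [set` s ++ s']) (F i @^-1` C i).
  apply/seteqP; split => w /=.
    move=> [h h'] i; rewrite /= mem_cat /C; case: ifPn => //= is_ is'.
      exact: h.
    exact: h'.
  move=> h; split => i /= si.
    by have := h i; rewrite /= mem_cat si /C si; apply.
  have := h i; rewrite /= mem_cat si orbT /C; case: ifPn; last by move=> _; apply.
  by move=> /ss' /(_ si).
rewrite (indF uss'); last by move=> i; rewrite /C; case: ifPn.
rewrite (indF us mB) (indF us' mB') big_cat /=; congr (_ * _)%E.
  by apply: eq_big_seq => i si; rewrite /C si.
apply: eq_big_seq => i si; rewrite /C ifN//; apply/negP => /ss'; exact.
Qed.

(** Uniqueness of measures is used twice, once for each event: with the other event fixed,
    restriction to it and scaling by its probability are finite measures that agree on the
    cylinders. *)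
Lemma indep_subalg (J J' : set I) (A A' : set T) : (forall i, J i -> ~ J' i) ->
  @measurable _ (subalg J) A -> @measurable _ (subalg J') A' ->
  P (A `&` A') = (P A * P A')%E.
Proof.
move=> JJ' mA mA'.
have step (J1 : set I) (C : set T) : measurable C ->
    (forall D, cylinders J1 D -> P (D `&` C) = (P D * P C)%E) ->
    forall D, @measurable _ (subalg J1) D -> P (D `&` C) = (P D * P C)%E.
  move=> mC hC D mD.
  have PC : (0 <= fine (P C))%R by rewrite fine_ge0.
  have fPC : P C = (fine (P C))%:E by rewrite fineK// fin_num_measure.
  rewrite [in RHS]fPC muleC.
  apply: (@g_sigma_algebra_measure_unique _ _ T (cylinders J1) _
     (fun=> setT) _ _ (mrestr P mC) (mscale (NngNum PC) P)).
  - exact: cylinders_measurable.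
  - by move=> _; exact: cylindersT.
  - by rewrite bigcup_const//; exists 0%N.
  - exact: cylinders_setI.
  - by move=> E cE; rewrite /= /mscale/= -fPC muleC; exact: hC.
  - move=> _; apply: (@le_lt_trans _ _ 1%E); last exact: ltry.
    by rewrite /= /mrestr; apply: probability_le1; exact: measurableI.
  - exact: cylinders_generate.
have mA'T := subalg_measurable mA'.
apply: (step J A' mA'T _ A mA) => D cD; rewrite setIC muleC.
apply: (step J' D (cylinders_measurable cD) _ A' mA') => E cE.
by rewrite setIC muleC; exact: indep_cylinders cD cE.
Qed.

End Independence.

(** * Means and a strong law *)

Section Independent_pair.
Context {R : realType} {d d1 d2 : measure_display} {T : measurableType d}.
Context {T1 : measurableType d1} {T2 : measurableType d2}.
Variables (P : probability T R) (f : T -> T1) (g : T -> T2).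
Hypotheses (mf : measurable_fun setT f) (mg : measurable_fun setT g).
Hypothesis indfg : forall A B, measurable A -> measurable B ->
  P (f @^-1` A `&` g @^-1` B) = (P (f @^-1` A) * P (g @^-1` B))%E.

Local Open Scope ereal_scope.

Let Xf : {mfun T >-> T1} := HB.pack f (isMeasurableFun.Build _ _ _ _ f mf).
Let Xg : {mfun T >-> T2} := HB.pack g (isMeasurableFun.Build _ _ _ _ g mg).
Let mfg : measurable_fun setT (fun w => (f w, g w)).
Proof. exact: measurable_fun_pair. Qed.
Let Xfg : {mfun T >-> (T1 * T2)%type} :=
  HB.pack (fun w => (f w, g w)) (isMeasurableFun.Build _ _ _ _ _ mfg).

Lemma joint_law (C : set (T1 * T2)) : measurable C ->
  (distribution P Xf \x distribution P Xg) C = distribution P Xfg C.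
Proof. by move=> mC; apply: product_measure_unique => // A B; exact: indfg. Qed.

(** The joint law is the product of the marginals, so Tonelli applies. With both integrals taken
    over [P], the first variable can be treated as a constant in the inner one. *)
Lemma ge0_integral_indep (phi : T1 * T2 -> \bar R) :
  measurable_fun [set: T1 * T2] phi ->
  (forall z, 0 <= phi z) ->
  \int[P]_w phi (f w, g w) = \int[P]_w \int[P]_w' phi (f w, g w').
Proof.
move=> mphi phi0.
transitivity (\int[distribution P Xfg]_z phi z).
  by rewrite ge0_integral_distribution.
transitivity (\int[distribution P Xf \x distribution P Xg]_z phi z).
  by apply: eq_measure_integral => A mA _; apply/esym; exact: joint_law.
rewrite fubini_tonelli1// ge0_integral_distribution//=; last 2 first.
- exact: measurable_fun_fubini_tonelli_F.
- by move=> x; exact: integral_ge0.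
apply: eq_integral => w _; rewrite /fubini_F.
by rewrite ge0_integral_distribution//; exact: measurableT_comp.
Qed.

End Independent_pair.

Section Mean.
Context {R : realType} {d : measure_display} {T : measurableType d}.
Variable P : probability T R.
Implicit Types (f g : T -> R) (u v : R).

(** A relation rather than a function: the value is a real number, and integrability travels with it
    through all computations. *)
Definition has_mean f v : Prop :=
  P.-integrable setT (EFin \o f) /\ (\int[P]_w (f w)%:E = v%:E)%E.

Lemma has_mean_measurable f v : has_mean f v -> measurable_fun setT f.
Proof. by case=> /measurable_int /measurable_EFinP. Qed.

Lemma has_mean_uniq f u v : has_mean f u -> has_mean f v -> u = v.
Proof. by move=> [_ fu] [_]; rewrite fu => -[]. Qed.

Lemma eq_has_mean f g v : f =1 g -> has_mean f v -> has_mean g v.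
Proof. by move=> /funext ->. Qed.

Lemma ge0_has_mean f v : measurable_fun setT f -> (forall w, 0 <= f w) ->
  (\int[P]_w (f w)%:E = v%:E)%E -> has_mean f v.
Proof.
move=> mf f0 fv; split => //; apply/integrableP; split.
  exact/measurable_EFinP.
under eq_integral do rewrite /= ger0_norm//.
by rewrite fv ltry.
Qed.

Lemma has_mean_exists f : measurable_fun setT f ->
  (\int[P]_w `|f w|%:E < +oo)%E -> exists v, has_mean f v.
Proof.
move=> mf foo.
have fi : P.-integrable setT (EFin \o f).
  by apply/integrableP; split => //; exact/measurable_EFinP.
exists (fine (\int[P]_w (f w)%:E)%E); split => //.
by rewrite fineK//; exact: (integrable_fin_num measurableT fi).
Qed.

Lemma has_mean_le f g v : measurable_fun setT f -> (forall w, `|f w| <= g w) ->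
  has_mean g v -> exists u, has_mean f u.
Proof.
move=> mf fg hg; apply: has_mean_exists => //; apply: (@le_lt_trans _ _ v%:E).
  rewrite -(proj2 hg); apply: ge0_le_integral => //=.
  - exact/measurable_EFinP/measurableT_comp.
  - exact/measurable_EFinP/(has_mean_measurable hg).
  - by move=> x _; rewrite lee_fin.
exact: ltry.
Qed.

Lemma le_has_mean f g u v : has_mean f u -> has_mean g v ->
  (forall w, f w <= g w) -> u <= v.
Proof.
move=> [fi fu] [gi gv] fg; rewrite -lee_fin -fu -gv.
by apply: le_integral => // w _; rewrite lee_fin.
Qed.

Lemma has_mean_cst v : has_mean (fun=> v) v.
Proof.
split; first exact: finite_measure_integrable_cst.
by rewrite integral_cst//= probability_setT mule1.
Qed.

Lemma has_meanD f g u v : has_mean f u -> has_mean g v ->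
  has_mean (fun w => f w + g w) (u + v).
Proof.
move=> [fi fu] [gi gv]; split.
  by rewrite (_ : EFin \o _ = (EFin \o f) \+ (EFin \o g))%E//; exact: integrableD.
under eq_integral do rewrite EFinD.
by rewrite integralD// fu gv.
Qed.

Lemma has_meanZ k f u : has_mean f u -> has_mean (fun w => k * f w) (k * u).
Proof.
move=> [fi fu]; split.
  rewrite (_ : EFin \o _ = (fun w => k%:E * (EFin \o f) w))%E//.
  exact: integrableZl.
under eq_integral do rewrite EFinM.
by rewrite integralZl// fu.
Qed.

Lemma has_meanN f u : has_mean f u -> has_mean (fun w => - f w) (- u).
Proof.
move=> /(has_meanZ (-1)); rewrite mulN1r; apply: eq_has_mean => w.
by rewrite mulN1r.
Qed.

Lemma has_meanB f g u v : has_mean f u -> has_mean g v ->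
  has_mean (fun w => f w - g w) (u - v).
Proof. by move=> fu /has_meanN; exact: has_meanD. Qed.

Lemma has_mean_sum (I : eqType) (s : seq I) (F : I -> T -> R) (V : I -> R) :
  (forall i, i \in s -> has_mean (F i) (V i)) ->
  has_mean (fun w => \sum_(i <- s) F i w) (\sum_(i <- s) V i).
Proof.
elim: s => [_|i s IH FV].
  rewrite big_nil; apply: eq_has_mean (has_mean_cst 0) => w.
  by rewrite big_nil.
rewrite big_cons.
have hi : has_mean (F i) (V i) by apply: FV; rewrite inE eqxx.
have hs : has_mean (fun w => \sum_(i <- s) F i w) (\sum_(i <- s) V i).
  by apply: IH => j js; apply: FV; rewrite inE js orbT.
by apply: eq_has_mean (has_meanD hi hs) => w; rewrite big_cons.
Qed.

Lemma has_mean_ae f g v : measurable_fun setT g -> {ae P, forall w, f w = g w} ->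
  has_mean f v -> has_mean g v.
Proof.
move=> mg fg hf; have mf := has_mean_measurable hf.
have fgE : ae_eq P setT (EFin \o f) (EFin \o g).
  by apply: filterS fg => w /= -> _.
have mfE : measurable_fun setT (EFin \o f) by exact/measurable_EFinP.
have mgE : measurable_fun setT (EFin \o g) by exact/measurable_EFinP.
split; last by rewrite -(proj2 hf); apply/esym/ae_eq_integral.
apply/integrableP; split => //.
rewrite -(@ge0_ae_eq_integral _ _ _ P setT (fun w => `|(f w)%:E|)%E)//.
- by case: hf => /integrableP[].
- exact: measurableT_comp.
- exact: measurableT_comp.
- by apply: filterS fg => w /= -> _.
Qed.

(** Tonelli covers nonnegative factors; in general both variables are split into positive and
    negative parts and the four products are recombined. *)
Lemma has_mean_indep f g u v : has_mean f u -> has_mean g v ->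
  (forall A B, measurable A -> measurable B ->
    P (f @^-1` A `&` g @^-1` B) = (P (f @^-1` A) * P (g @^-1` B))%E) ->
  has_mean (fun w => f w * g w) (u * v).
Proof.
move=> hf hg fg.
have mf := has_mean_measurable hf; have mg := has_mean_measurable hg.
have mm : measurable_fun setT (fun z : R * R => z.1 * z.2).
  by apply: measurable_funM; [exact: measurable_fst|exact: measurable_snd].
have key (h1 h2 : R -> R) : measurable_fun setT h1 -> measurable_fun setT h2 ->
    (forall x, 0 <= h1 x) -> (forall x, 0 <= h2 x) ->
    (\int[P]_w (h1 (f w) * h2 (g w))%:E =
     (\int[P]_w (h1 (f w))%:E) * (\int[P]_w (h2 (g w))%:E))%E.
  move=> mh1 mh2 h10 h20.
  have mh : measurable_fun [set: R * R] (fun z : R * R => (h1 z.1 * h2 z.2)%:E).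
    apply/measurable_EFinP/measurable_funM.
      by apply: measurableT_comp => //; exact: measurable_fst.
    by apply: measurableT_comp => //; exact: measurable_snd.
  have h0 (z : R * R) : (0 <= (h1 z.1 * h2 z.2)%:E)%E.
    by rewrite lee_fin mulr_ge0.
  rewrite (ge0_integral_indep mf mg fg mh h0) /=.
  have E w : (\int[P]_w' (h1 (f w) * h2 (g w'))%:E =
      (h1 (f w))%:E * \int[P]_w' (h2 (g w'))%:E)%E.
    under eq_integral do rewrite EFinM.
    rewrite ge0_integralZl//; first by apply/measurable_EFinP; exact: measurableT_comp.
      by move=> x _; rewrite lee_fin.
    by rewrite lee_fin.
  rewrite (eq_integral (fun w => (h1 (f w))%:E * \int[P]_w' (h2 (g w'))%:E)%E); last by [].
  rewrite ge0_integralZr//; first by apply/measurable_EFinP; exact: measurableT_comp.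
  - by move=> x _; rewrite lee_fin.
  - by apply: integral_ge0 => x _; rewrite lee_fin.
have mfg : measurable_fun setT (fun w => f w * g w) by exact: measurable_funM.
have [[fi fu] [gi gv]] := (hf, hg).
pose p (x : R) := Num.max x 0; pose n (x : R) := Num.max (- x) 0.
have mp : measurable_fun setT p by exact: measurable_maxr.
have mn : measurable_fun setT n.
  by apply: measurable_maxr => //; exact: measurableT_comp.
have p0 x : 0 <= p x by rewrite /p le_max lexx orbT.
have n0 x : 0 <= n x by rewrite /n le_max lexx orbT.
have pn x : x = p x - n x.
  rewrite /p /n; have [x0|/ltW x0] := lerP 0 x.
    by rewrite [X in _ - X]max_r ?oppr_le0// subr0.
  by rewrite max_l ?oppr_ge0// sub0r opprK.
have pabs x : `|p x| <= `|x|.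
  by rewrite ger0_norm// /p ge_max normr_ge0 ler_norm.
have nabs x : `|n x| <= `|x|.
  by rewrite ger0_norm// /n ge_max normr_ge0 -normrN ler_norm.
have abs h w : has_mean h w -> exists w', has_mean (fun x => `|h x|) w'.
  move=> hh; apply: has_mean_exists.
    exact/measurableT_comp/(has_mean_measurable hh).
  under eq_integral do rewrite normr_id.
  by case: hh => /integrableP[].
have [fa hfa] := abs _ _ hf; have [ga hga] := abs _ _ hg.
have [fp hfp] : exists v, has_mean (p \o f) v.
  by apply: has_mean_le hfa => [|w]; [exact: measurableT_comp|exact: pabs].
have [fn hfn] : exists v, has_mean (n \o f) v.
  by apply: has_mean_le hfa => [|w]; [exact: measurableT_comp|exact: nabs].
have [gp hgp] : exists v, has_mean (p \o g) v.
  by apply: has_mean_le hga => [|w]; [exact: measurableT_comp|exact: pabs].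
have [gn hgn] : exists v, has_mean (n \o g) v.
  by apply: has_mean_le hga => [|w]; [exact: measurableT_comp|exact: nabs].
have prod h1 h2 v1 v2 : measurable_fun setT h1 -> measurable_fun setT h2 ->
    (forall x : R, 0 <= h1 x :> R) -> (forall x : R, 0 <= h2 x :> R) ->
    has_mean (h1 \o f) v1 -> has_mean (h2 \o g) v2 ->
    has_mean (fun w => h1 (f w) * h2 (g w)) (v1 * v2).
  move=> m1 m2 h10 h20 [_ e1] [_ e2]; apply: ge0_has_mean.
  - by apply: measurable_funM; exact: measurableT_comp.
  - by move=> w; exact: mulr_ge0.
  - by rewrite key// e1 e2.
have -> : u = fp - fn.
  apply: (has_mean_uniq hf); apply: eq_has_mean (has_meanB hfp hfn) => w.
  by rewrite /= -pn.
have -> : v = gp - gn.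
  apply: (has_mean_uniq hg); apply: eq_has_mean (has_meanB hgp hgn) => w.
  by rewrite /= -pn.
have := has_meanB (has_meanD (prod p p fp gp mp mp p0 p0 hfp hgp)
                             (prod n n fn gn mn mn n0 n0 hfn hgn))
                  (has_meanD (prod p n fp gn mp mn p0 n0 hfp hgn)
                             (prod n p fn gp mn mp n0 p0 hfn hgp)).
set a := (_ - _); set b := (_ * _); have -> : a = b by rewrite /a /b; ring.
by apply: eq_has_mean => w; rewrite [in RHS](pn (f w)) [in RHS](pn (g w)); ring.
Qed.

End Mean.

Section Square_integrable.
Context {R : realType} {d : measure_display} {T : measurableType d}.
Variable P : probability T R.
Implicit Types (f g : T -> R) (u v : R).

Definition square_integrable f : Prop :=
  measurable_fun setT f /\ exists v, has_mean P (fun w => f w ^+ 2) v.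

Lemma square_integrable_has_mean_mul f g :
  square_integrable f -> square_integrable g ->
  exists v, has_mean P (fun w => f w * g w) v.
Proof.
move=> [mf [u hf]] [mg [v hg]].
apply: has_mean_le (has_meanD hf hg); first exact: measurable_funM.
move=> w; have h1 : 0 <= (f w - g w) ^+ 2 by exact: sqr_ge0.
have h2 : 0 <= (f w + g w) ^+ 2 by exact: sqr_ge0.
have h3 : 0 <= f w ^+ 2 by exact: sqr_ge0.
have h4 : 0 <= g w ^+ 2 by exact: sqr_ge0.
by rewrite ler_norml; apply/andP; split; nra.
Qed.

Lemma square_integrable_cst v : square_integrable (fun=> v).
Proof. by split => //; exists (v ^+ 2); exact: has_mean_cst. Qed.

Lemma square_integrable_has_mean f : square_integrable f ->
  exists v, has_mean P f v.
Proof.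
move=> /square_integrable_has_mean_mul /(_ (square_integrable_cst 1))[v h].
by exists v; apply: eq_has_mean h => w; rewrite mulr1.
Qed.

Lemma square_integrableD f g : square_integrable f -> square_integrable g ->
  square_integrable (fun w => f w + g w).
Proof.
move=> hf hg; have [v hv] := square_integrable_has_mean_mul hf hg.
case: hf hg => mf [u hu] [mg [u' hu']]; split; first exact: measurable_funD.
exists (u + u' + 2 * v).
apply: eq_has_mean (has_meanD (has_meanD hu hu') (has_meanZ 2 hv)) => w.
by ring.
Qed.

Lemma square_integrableZ k f : square_integrable f ->
  square_integrable (fun w => k * f w).
Proof.
move=> [mf [u hu]]; split; first exact: measurable_funM.
by exists (k ^+ 2 * u); apply: eq_has_mean (has_meanZ _ hu) => w; ring.
Qed.

Lemma square_integrableB f g : square_integrable f -> square_integrable g ->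
  square_integrable (fun w => f w - g w).
Proof.
move=> hf /(square_integrableZ (-1)) /(square_integrableD hf).
by congr square_integrable; apply/funext => w; rewrite mulN1r.
Qed.

Lemma square_integrable_le f g : measurable_fun setT f ->
  (forall w, `|f w| <= `|g w|) -> square_integrable g -> square_integrable f.
Proof.
move=> mf fg [mg [v hv]]; split => //; apply: has_mean_le hv.
  exact: measurable_funX.
by move=> w; rewrite normrX -(real_normK (num_real (g w))) lerXn2r ?nnegrE.
Qed.

Lemma square_integrable_indep f g :
  square_integrable f -> square_integrable g ->
  (forall A B, measurable A -> measurable B ->
    P (f @^-1` A `&` g @^-1` B) = (P (f @^-1` A) * P (g @^-1` B))%E) ->
  square_integrable (fun w => f w * g w).
Proof.
move=> [mf [u hu]] [mg [v hv]] fg; split; first exact: measurable_funM.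
exists (u * v); under eq_fun do rewrite exprMn.
apply: has_mean_indep hu hv _ => A B mA mB.
have mX : measurable_fun setT (fun x : R => x ^+ 2) by exact: measurable_funX.
have mA' : measurable ((fun x : R => x ^+ 2) @^-1` A).
  by have := mX measurableT A mA; rewrite setTI.
have mB' : measurable ((fun x : R => x ^+ 2) @^-1` B).
  by have := mX measurableT B mB; rewrite setTI.
exact: fg mA' mB'.
Qed.

End Square_integrable.

Section Strong_law.
Context {R : realType} {d : measure_display} {T : measurableType d}.
Variable P : probability T R.

(** Telescoping, since [1 / (x + 1) ^ 2 <= 1 / (x * (x + 1)) = 1 / x - 1 / (x + 1)]. *)
Lemma sum_inv_square_le N :
  \sum_(m < N.+1) (m.+1%:R ^- 2 : R) <= 2 - N.+1%:R^-1.
Proof.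
elim: N => [|N IH]; first by rewrite big_ord1 expr1n invr1; lra.
rewrite big_ord_recr /=; apply: (le_trans (lerD IH (lexx _))).
have h1 : 0 < N.+1%:R :> R by rewrite ltr0n.
rewrite -[N.+2%:R]natr1; set x := N.+1%:R in h1 *.
rewrite -addrA lerD2l [leLHS]addrC lerBlDr [leRHS]addrC.
have -> : x^-1 - (x + 1)^-1 = (x * (x + 1))^-1.
  by field; apply/andP; split; lra.
rewrite lef_pV2 ?posrE ?mulr_gt0 ?exprn_gt0//; last 3 first; [lra..|].
by rewrite expr2; nra.
Qed.

(** By monotone convergence the sum of the series has a finite mean, so it is almost surely finite
    and its terms vanish. *)
Lemma cvg0_of_summable_means (Q : nat -> T -> R) (q : nat -> R) (K : R) :
  (forall m w, 0 <= Q m w) -> (forall m, has_mean P (Q m) (q m)) ->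
  (forall N, \sum_(m < N) q m <= K) ->
  {ae P, forall w, Q m w @[m --> \oo] --> 0}.
Proof.
move=> Q0 hQ hK.
have mQ m : measurable_fun setT (fun w => (Q m w)%:E).
  exact/measurable_EFinP/(has_mean_measurable (hQ m)).
pose S w := (\sum_(0 <= m <oo) (Q m w)%:E)%E.
have mS : measurable_fun setT S.
  by apply: ge0_emeasurable_sum => // m w _ _; rewrite lee_fin.
have S0 w : (0 <= S w)%E by apply: nneseries_ge0 => m _ _; rewrite lee_fin.
have SK : (\int[P]_w S w <= K%:E)%E.
  rewrite integral_nneseries//; last by move=> m w _; rewrite lee_fin.
  apply: lime_le.
    by apply: is_cvg_nneseries => m _ _; apply: integral_ge0 => w _; rewrite lee_fin.
  apply: nearW => N; rewrite big_mkord.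
  under eq_bigr do rewrite (proj2 (hQ _)).
  by rewrite sumEFin lee_fin.
have iS : P.-integrable setT S.
  apply/integrableP; split => //.
  under eq_integral do rewrite gee0_abs//.
  by rewrite (le_lt_trans SK)// ltry.
have := integrable_ae measurableT iS.
apply: filterS => w /(_ I) Sfin; apply: cvg_series_cvg_0.
apply: nondecreasing_is_cvgn.
  by apply/nondecreasing_seqP => n; rewrite /series /= big_nat_recr//= lerDl.
exists (fine (S w)) => _ [n _ <-].
rewrite -lee_fin fineK// /series /= -sumEFin.
by apply: nneseries_lim_ge => m _ _; rewrite lee_fin.
Qed.

Variables (D : nat -> T -> R) (V : nat -> R) (C : R).
Hypothesis hV : forall v, has_mean P (fun w => D v w ^+ 2) (V v).
Hypothesis mD : forall v, measurable_fun setT (D v).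
Hypothesis VC : forall v, V v <= C.
Hypothesis D_orth : forall u v, (u < v)%N -> has_mean P (fun w => D u w * D v w) 0.

Let S M k w := \sum_(M <= v < M + k) D v w.

(** Orthogonality removes the cross terms, so the second moment of [k] consecutive terms grows at
    most linearly in [k]. *)
Let orth_block M k : exists s,
  has_mean P (fun w => S M k w ^+ 2) s /\ s <= C * k%:R.
Proof.
elim: k => [|k [s [hs sC]]].
  exists 0; split; last by rewrite mulr0.
  apply: eq_has_mean (has_mean_cst P 0) => w.
  by rewrite /S addn0 big_geq// expr0n.
exists (s + V (M + k)%N); split; last first.
  by rewrite -natr1 mulrDr mulr1 lerD.
have h0 : has_mean P (fun w => S M k w * D (M + k)%N w) 0.
  rewrite /S; under eq_fun do rewrite mulr_suml.
  have := @has_mean_sum _ _ _ P nat (index_iota M (M + k))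
    (fun i w => D i w * D (M + k)%N w) (fun=> 0).
  rewrite big1//; apply => i; rewrite mem_index_iota => /andP[_ ik].
  exact: D_orth.
have := has_meanD (has_meanD hs (hV (M + k)%N)) (has_meanZ 2 h0).
rewrite mulr0 addr0; apply: eq_has_mean => w.
rewrite /S addnS big_nat_recr/= ?leq_addr//.
by ring.
Qed.

Lemma exists_sqrt_between N : exists m, (m ^ 2 <= N < m.+1 ^ 2)%N.
Proof.
elim: N => [|N [m /andP[mN Nm]]]; first by exists 0%N.
case: (ltnP N.+1 (m.+1 ^ 2)) => h.
  by exists m; rewrite h andbT ltnW.
by exists m.+1; rewrite h /=; lia.
Qed.

(* The averages converge along the squares [N = m ^ 2] since their second moments
   are summable, and the partial sums vary little between two squares. *)
Theorem uncorrelated_strong_law :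
  {ae P, forall w, (N%:R^-1 * \sum_(v < N) D v w) @[N --> \oo] --> 0}.
Proof.
pose s M k := sval (cid (orth_block M k)).
have hs M k : has_mean P (fun w => S M k w ^+ 2) (s M k) /\ s M k <= C * k%:R.
  exact: svalP (cid (orth_block M k)).
(* The sum over all [k <= 2 * (m + 1)] replaces a maximum over the partial blocks between the
   squares of [m + 1] and [m + 2]; no maximal inequality is needed. *)
pose Q m w := ((m.+1%:R ^- 2) ^+ 2) * (S 0 (m.+1 ^ 2) w ^+ 2 +
   \sum_(k <- iota 0 (2 * m.+1).+1) S (m.+1 ^ 2) k w ^+ 2) : R.
pose q m := ((m.+1%:R ^- 2) ^+ 2) * (s 0 (m.+1 ^ 2)%N +
   \sum_(k <- iota 0 (2 * m.+1).+1) s (m.+1 ^ 2)%N k) : R.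
have C0 : 0 <= C.
  apply: le_trans (VC 0); apply: (@le_has_mean _ _ _ P (fun=> 0)) (hV 0) _.
    exact: has_mean_cst.
  by move=> w; exact: sqr_ge0.
have hQ m : has_mean P (Q m) (q m).
  apply: has_meanZ; apply: has_meanD; first exact: (proj1 (hs _ _)).
  by apply: has_mean_sum => k _; exact: (proj1 (hs _ _)).
have Q0 m w : 0 <= Q m w.
  by rewrite mulr_ge0 ?sqr_ge0// addr_ge0 ?sqr_ge0// sumr_ge0// => k _; exact: sqr_ge0.
(* With [x = m + 1], the bracket is at most [C x ^ 2 + 2 C x (2 x + 1)], which is below [10 C x ^ 2]
   as [x >= 1]. *)
have qC m : q m <= 10 * C * m.+1%:R ^- 2.
  have m0 : 0 < m.+1%:R :> R by rewrite ltr0n.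
  have m1 : 1 <= m.+1%:R :> R by rewrite ler1n.
  have h1 : s 0 (m.+1 ^ 2)%N <= C * m.+1%:R ^+ 2.
    by rewrite -natrX; exact: (proj2 (hs _ _)).
  have h2 : \sum_(k <- iota 0 (2 * m.+1).+1) s (m.+1 ^ 2)%N k <=
            \sum_(k <- iota 0 (2 * m.+1).+1) C * (2 * m.+1%:R).
    rewrite big_seq [leRHS]big_seq; apply: ler_sum => k.
    rewrite mem_iota /= add0n => km; apply: (le_trans (proj2 (hs _ _))).
    by apply: ler_wpM2l => //; rewrite -natrM ler_nat -ltnS.
  have h3 : \sum_(k <- iota 0 (2 * m.+1).+1) C * (2 * m.+1%:R) =
            C * (2 * m.+1%:R) * (2 * m.+1%:R + 1).
    rewrite big_const_seq count_predT size_iota iter_addr_0 -[LHS]mulr_natr.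
    by rewrite -[(2 * m.+1).+1]addn1 natrD natrM.
  have -> : 10 * C * m.+1%:R ^- 2 = (m.+1%:R ^- 2) ^+ 2 * (10 * C * m.+1%:R ^+ 2).
    by field; lra.
  apply: ler_wpM2l; first exact: sqr_ge0.
  rewrite h3 in h2; set x := m.+1%:R in m0 m1 h1 h2 *.
  apply: (le_trans (lerD h1 h2)).
  suff : C * x <= C * x ^+ 2 by nra.
  by apply: ler_wpM2l => //; rewrite expr2; nra.
have sumq N : \sum_(m < N) q m <= 20 * C.
  apply: (@le_trans _ _ (\sum_(m < N) 10 * C * m.+1%:R ^- 2)).
    by apply: ler_sum => m _; exact: qC.
  rewrite -mulr_sumr; case: N => [|N]; first by rewrite big_ord0 mulr0; nra.
  have := sum_inv_square_le N; have : 0 < N.+1%:R^-1 :> R by rewrite invr_gt0 ltr0n.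
  set y := N.+1%:R^-1; set z := (\sum_(_ < _) _) => y0 zy.
  suff : 10 * C * z <= 10 * C * 2 by nra.
  by apply: ler_wpM2l; nra.
have := cvg0_of_summable_means Q0 hQ sumq.
apply: filterS => w Qw; apply/cvgrPdist_lt => e e0.
(* The factor [1 / 2] pays for [(A + B) ^ 2 <= 2 (A ^ 2 + B ^ 2)]. *)
have /cvgrPdist_lt /(_ (e ^+ 2 / 2)) := Qw.
case; first by rewrite divr_gt0// exprn_gt0.
move=> M _ hM; exists (M.+1 ^ 2)%N => // N /= MN.
have [m /andP[mN Nm]] := exists_sqrt_between N.
have Mm : (M < m)%N.
  rewrite ltnNge; apply/negP => mM.
  suff : (m.+1 ^ 2 <= M.+1 ^ 2)%N by lia.
  by rewrite leq_exp2r.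
case: m mN Nm Mm => // m mN Nm Mm.
have := hM m; rewrite /= -ltnS => /(_ Mm).
rewrite !sub0r !normrN ger0_norm//.
have m0 : 0 < m.+1%:R ^+ 2 :> R by rewrite exprn_gt0// ltr0n.
have N0 : m.+1%:R ^+ 2 <= N%:R :> R by rewrite -natrX ler_nat.
set A := S 0 (m.+1 ^ 2) w; pose B := S (m.+1 ^ 2) (N - m.+1 ^ 2) w.
have AB : \sum_(v < N) D v w = A + B.
  rewrite -(big_mkord xpredT (fun v => D v w)) /A /B /S add0n subnKC//.
  by rewrite -big_cat_nat.
have QAB : (m.+1%:R ^- 2) ^+ 2 * (A ^+ 2 + B ^+ 2) <= Q m w.
  apply: ler_wpM2l; first exact: sqr_ge0.
  rewrite lerD2l (bigD1_seq (N - m.+1 ^ 2)%N) ?iota_uniq//; last first.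
    by rewrite mem_iota; lia.
  by rewrite lerDl sumr_ge0// => k _; exact: sqr_ge0.
move=> Qe; have {Qe QAB} := le_lt_trans QAB Qe.
rewrite AB; set x := m.+1%:R ^- 2 => QAB.
have x0 : 0 < x by rewrite invr_gt0.
rewrite -(@ltr_pXn2r _ 2) ?nnegrE ?(ltW e0)// real_normK ?num_real//.
have Nx : N%:R^-1 <= x by rewrite lef_pV2 ?posrE//; lra.
have Ninv : 0 <= N%:R^-1 :> R by rewrite invr_ge0.
rewrite exprMn; apply: (@le_lt_trans _ _ (x ^+ 2 * (A + B) ^+ 2)).
  by apply: ler_wpM2r; [exact: sqr_ge0|rewrite lerXn2r ?nnegrE// ltW].
have : 0 <= x ^+ 2 * (A - B) ^+ 2 by rewrite mulr_ge0 ?sqr_ge0.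
by nra.
Qed.

End Strong_law.

(** * Order statistics of shifted exponential samples *)

Section Order_statistics.
Context {R : realType} {n : nat}.
Implicit Types (k : nat) (x : 'I_n -> R).

Lemma sorted_nth_le (s : seq R) (t : R) j : sorted <=%R s -> (j < size s)%N ->
  (nth 0 s j <= t) = (j < count (fun y : R => (y <= t)%R) s)%N.
Proof.
elim: s j => // y s IH j /= ys js.
have [yt|ty] := leP y t.
  case: j js => [|j] js //=; rewrite add1n ltnS.
  by apply: IH => //; exact: path_sorted ys.
rewrite add0n; apply/idP/idP => [h|].
  exfalso; move: h; rewrite leNgt => /negP; apply.
  apply: (lt_le_trans ty); case: j js => //= j js.
  move: ys; rewrite (path_sortedE le_trans) => /andP[/allP h _].
  by apply: h; exact: mem_nth.
rewrite (_ : count _ s = 0)%N//; apply/eqP; rewrite -leqn0 leqNgt -has_count.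
apply/hasPn => z zs; rewrite -ltNge; apply: (lt_le_trans ty).
by move: ys; rewrite (path_sortedE le_trans) => /andP[/allP h _]; exact: h.
Qed.

Lemma size_sort_codom x : size (sort <=%R (codom x)) = n.
Proof. by rewrite size_sort size_codom card_ord. Qed.

Lemma sorted_sort_codom x : sorted <=%R (sort <=%R (codom x)).
Proof. by apply: sort_sorted; exact: le_total. Qed.

(** Counting the values below [t] replaces sorting; measurability and law of an order statistic both
    rest on this equivalence. *)
Lemma ostat_le k x (t : R) : (0 < k <= n)%N ->
  (ostat k x <= t) = (k <= #|[pred i | (x i <= t)%R]|)%N.
Proof.
case: k => // k /= kn; rewrite /ostat sorted_nth_le ?sorted_sort_codom//; last first.
  by rewrite size_sort_codom.
congr (_ < _)%N; rewrite count_sort /codom count_map cardE -size_filter.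
rewrite /enum_mem -filter_predI; congr size; apply: eq_filter => i.
by rewrite /= !inE /= andbT.
Qed.

Lemma ostat_mem k x : (0 < k <= n)%N -> exists i, ostat k x = x i.
Proof.
case: k => // k /= kn; have : ostat k.+1 x \in codom x.
  by rewrite -(mem_sort <=%R) mem_nth// size_sort_codom.
by move=> /codomP[i ->]; exists i.
Qed.

Lemma ostat_perm k x (s : {perm 'I_n}) : ostat k (x \o s) = ostat k x.
Proof.
rewrite /ostat; congr nth; apply/perm_sortP; [exact: le_total|exact: le_trans|exact: le_anti|].
rewrite /codom /image_mem map_comp; apply: perm_map.
have us : uniq (map s (enum 'I_n)).
  by rewrite map_inj_uniq ?enum_uniq//; exact: perm_inj.
apply: uniq_perm => //; first exact: enum_uniq.
move=> i; rewrite mem_enum; apply/mapP; exists (s^-1%g i); first by rewrite mem_enum.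
by rewrite permKV.
Qed.

(** Without ties at the [k]-th value, the selected nodes are exactly the first [k] entries of the
    sorted sample. *)
Lemma among_earliest_sum (f : R -> R) k x : injective x -> (0 < k <= n)%N ->
  \sum_(i | among_earliest k x i) f (x i) = \sum_(j < k) f (ostat j.+1 x).
Proof.
move=> xinj /andP[k0 kn].
set s := sort <=%R (codom x).
have us : uniq s by rewrite sort_uniq map_inj_uniq// enum_uniq.
have ss : sorted <=%R s by exact: sorted_sort_codom.
have sz : size s = n by exact: size_sort_codom.
transitivity (\sum_(y <- s | y <= ostat k x) f y).
  rewrite (perm_big (codom x)) /=; last by rewrite perm_sort.
  by rewrite /codom /image_mem big_map big_enum_cond; apply: eq_bigl => i; rewrite inE.
rewrite (big_nth 0) sz.
rewrite (@big_cat_nat _ _ _ k)//= [X in _ + X]big_nat_cond.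
rewrite [X in _ + X]big_pred0 ?addr0; last first.
  move=> j; apply/negbTE; apply/negP => /andP[/andP[kj jn]].
  have : (ostat k x < nth 0 s j).
    rewrite /ostat -/s lt_neqAle; apply/andP; split.
      by rewrite nth_uniq ?sz//; lia.
    by apply: (sorted_leq_nth le_trans lexx) => //; rewrite ?inE ?sz; lia.
  by rewrite ltNge => /negP.
rewrite big_mkord [LHS]big_mkcond; apply: eq_bigr => j _.
rewrite ifT// /ostat -/s /=.
have := ltn_ord j => jk.
by apply: (sorted_leq_nth le_trans lexx) => //; rewrite ?inE ?sz; lia.
Qed.

Lemma among_earliest_card k x : injective x -> (0 < k <= n)%N ->
  \sum_i (among_earliest k x i)%:R = k%:R :> R.
Proof.
move=> xinj kn; have := among_earliest_sum (fun=> 1) xinj kn.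
rewrite [RHS]sumr_const card_ord => <-; rewrite [RHS]big_mkcond.
by apply: eq_bigr => i _; case: ifP.
Qed.

Lemma measurable_fun_of_le d (T : measurableType d) (f : T -> R) :
  (forall t, measurable_fun setT (fun w => f w <= t)) -> measurable_fun setT f.
Proof.
move=> mf; apply: (measurability _ (RGenOInfty.measurableE R)) => //.
move=> _ [_ [t ->] <-]; rewrite setTI.
have := mf t measurableT [set false]; rewrite setTI => /(_ I).
congr measurable; apply/seteqP; split => w /=; rewrite in_itv /= andbT ltNge.
  by move=> ->.
by move=> /negbTE.
Qed.

Lemma measurable_ostat d (T : measurableType d) k (X : T -> 'I_n -> R) :
  (0 < k <= n)%N -> (forall i, measurable_fun setT (X ^~ i)) ->
  measurable_fun setT (fun w => ostat k (X w)).
Proof.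
move=> kn mX; apply: measurable_fun_of_le => t.
rewrite (_ : (fun _ => _) = (fun w => k%:R <= \sum_i (X w i <= t)%R%:R :> R)); last first.
  apply/funext => w; rewrite ostat_le// -natr_sum ler_nat; congr (_ <= _)%N.
  rewrite -sum1_card big_mkcond; apply: eq_bigr => i _.
  by rewrite inE; case: (_ <= _).
apply: measurable_fun_ler => //; apply: measurable_sum => i.
have -> : (fun w => (X w i <= t)%R%:R) =
    (fun w => if X w i <= t then 1 else 0) :> (T -> R).
  by apply/funext => w; case: (_ <= _).
by apply: measurable_fun_ifT => //; exact: measurable_fun_ler.
Qed.

Lemma measurable_among_earliest d (T : measurableType d) k (X : T -> 'I_n -> R)
    i : (0 < k <= n)%N -> (forall i, measurable_fun setT (X ^~ i)) ->
  measurable_fun setT (fun w => among_earliest k (X w) i).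
Proof. by move=> kn mX; apply: measurable_fun_ler => //; exact: measurable_ostat. Qed.

End Order_statistics.

(** * Laws of independent families and exchangeability *)

Section Coordinate_law.
Context {R : realType} {d : measure_display} {T : measurableType d}.
Variables (I : eqType) (P : probability T R).

(** The product sigma-algebra on [I -> R], presented through the evaluation maps so that the results
    on cylinders serve again. *)
Definition coord_space : Type := subalg (fun (i : I) (x : I -> R) => x i) setT.

HB.instance Definition _ := Measurable.on coord_space.

Definition sample_map (F : I -> T -> R) (w : T) : coord_space := fun i => F i w.

Lemma measurable_sample_map (F : I -> T -> R) :
  (forall i, measurable_fun setT (F i)) -> measurable_fun setT (sample_map F).
Proof.
move=> mF; apply: measurability; first by [].
move=> _ [_ [i [_ [B [mB ->]]]] <-].
exact: mF.
Qed.

Lemma measurable_coord_space i : measurable_fun setT (fun x : coord_space => x i).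
Proof. exact: measurable_coord. Qed.

Variables (F G : I -> T -> R).
Hypotheses (mF : forall i, measurable_fun setT (F i))
  (mG : forall i, measurable_fun setT (G i)).
Hypotheses (iF : mutually_independent P F) (iG : mutually_independent P G).
Hypothesis FG : forall i B, measurable B -> P (F i @^-1` B) = P (G i @^-1` B).

Lemma sample_law_unique (A : set coord_space) : measurable A ->
  P (sample_map F @^-1` A) = P (sample_map G @^-1` A).
Proof.
move=> mA.
pose XF : {mfun T >-> coord_space} := HB.pack (sample_map F)
  (isMeasurableFun.Build _ _ _ _ _ (measurable_sample_map mF)).
pose XG : {mfun T >-> coord_space} := HB.pack (sample_map G)
  (isMeasurableFun.Build _ _ _ _ _ (measurable_sample_map mG)).
pose cyl := @cylinders R _ coord_space I (fun i x => x i) setT.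
have mpr i : measurable_fun setT (fun x : coord_space => x i).
  exact: measurable_coord_space.
apply: (@g_sigma_algebra_measure_unique _ R coord_space cyl _
  (fun=> setT) _ _ (distribution P XF) (distribution P XG)).
- exact: cylinders_measurable.
- by move=> _; exact: cylindersT.
- by rewrite bigcup_const//; exists 0%N.
- exact: cylinders_setI.
- move=> _ [s [B [us _ mB ->]]].
  transitivity (P (\bigcap_(i in [set` s]) (F i @^-1` B i))); first by [].
  transitivity (P (\bigcap_(i in [set` s]) (G i @^-1` B i))); last by [].
  by rewrite iF// iG//; apply: eq_bigr => i _; exact: FG.
- move=> _; apply: (@le_lt_trans _ _ 1%E); last exact: ltry.
  exact: probability_le1.
- exact: cylinders_generate.
Qed.

Lemma sample_has_mean (phi : coord_space -> R) v : measurable_fun setT phi ->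
  has_mean P (phi \o sample_map F) v -> has_mean P (phi \o sample_map G) v.
Proof.
move=> mphi [phiF Fv].
pose XF : {mfun T >-> coord_space} := HB.pack (sample_map F)
  (isMeasurableFun.Build _ _ _ _ _ (measurable_sample_map mF)).
pose XG : {mfun T >-> coord_space} := HB.pack (sample_map G)
  (isMeasurableFun.Build _ _ _ _ _ (measurable_sample_map mG)).
have mE : measurable_fun setT (EFin \o phi) by exact/measurable_EFinP.
have lawE (f : coord_space -> \bar R) :
    (\int[distribution P XF]_x f x = \int[distribution P XG]_x f x)%E.
  by apply: eq_measure_integral => A mA _; exact: sample_law_unique.
have iG' : P.-integrable setT (EFin \o phi \o XG).
  apply/integrableP; split; first exact: measurableT_comp.
  pose f (y : coord_space) := `|(phi y)%:E|%E.
  have mf : measurable_fun setT f by exact: measurableT_comp.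
  have E : (\int[P]_x f (XG x) = \int[P]_x f (XF x))%E.
    transitivity (\int[distribution P XG]_y f y)%E.
      by apply/esym/ge0_integral_distribution => // y; exact: abse_ge0.
    rewrite -lawE; apply: ge0_integral_distribution => // y.
    exact: abse_ge0.
  apply: (@le_lt_trans _ _ (\int[P]_x f (XF x))%E).
    by rewrite le_eqVlt; apply/orP; left; apply/eqP.
  by case/integrableP: phiF.
split => //.
have := integral_distribution mE iG'; rewrite -lawE.
rewrite integral_distribution//.
by move=> <-; rewrite -Fv.
Qed.

End Coordinate_law.

Section Exchangeable.
Context {R : realType} {d : measure_display} {T : measurableType d}.
Variables (n : nat) (P : probability T R) (X : 'I_n -> T -> R).
Hypotheses (mX : forall i, measurable_fun setT (X i))
  (iX : mutually_independent P X).
Hypothesis sameX : forall i j B, measurable B -> P (X i @^-1` B) = P (X j @^-1` B).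

Lemma mutually_independent_inj (I J : eqType) (F : I -> T -> R) (g : J -> I) :
  injective g -> mutually_independent P F ->
  mutually_independent P (fun j => F (g j)).
Proof.
move=> ginj iF s B us mB.
case: (pselect (exists j : J, True)) => [[j0 _]|noJ]; last first.
  case: s us => [|j s] us; last by exfalso; apply: noJ; exists j.
  rewrite big_nil; transitivity (P setT); last exact: probability_setT.
  by congr (P _); apply/seteqP; split.
(* A left inverse of [g], with junk value [j0] off its range; it carries the constraints from [J]
   over to [I]. *)
pose h i := if pselect (exists j, g j = i) is left e then sval (cid e) else j0.
have hg j : h (g j) = j.
  rewrite /h; case: pselect => [e|]; last by case; exists j.
  by apply: ginj; exact: svalP (cid e).
have := iF (map g s) (B \o h); rewrite map_inj_uniq// us => /(_ isT).
have mBh i : measurable ((B \o h) i) by exact: mB.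
move=> /(_ mBh).
rewrite big_map; under eq_bigr do rewrite /= hg.
move=> <-; congr (P _); apply/seteqP; split => w /= hw.
  by move=> i /= /mapP[j js ->]; rewrite /preimage /= hg; exact: hw.
move=> j js; have := hw (g j); rewrite /= map_f// /preimage /= hg; exact.
Qed.

(** The law of the sample is invariant under the transposition of [a] and [i], so all [n]
    coordinates of [phi] have the same mean, and these add up to the mean of [Phi]. The sum identity
    is only required almost everywhere because ties spoil it. *)
Lemma exchangeable_mean (phi : coord_space 'I_n -> 'I_n -> R)
    (Phi : coord_space 'I_n -> R) (a : 'I_n) u v :
  (forall i, measurable_fun setT (phi ^~ i)) ->
  (forall x (s : {perm 'I_n}) i, phi (x \o s) i = phi x (s i)) ->
  {ae P, forall w, \sum_i phi (X ^~ w) i = Phi (X ^~ w)} ->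
  has_mean P (fun w => phi (X ^~ w) a) u ->
  has_mean P (fun w => Phi (X ^~ w)) v -> has_mean P (fun w => phi (X ^~ w) a) (n%:R^-1 * v).
Proof.
move=> mphi phis sumphi hu hv.
have n0 : n%:R != 0 :> R by rewrite pnatr_eq0 -lt0n (leq_trans _ (ltn_ord a)).
have hi i : has_mean P (fun w => phi (X ^~ w) i) u.
  have hperm := @mutually_independent_inj _ _ X (tperm a i) perm_inj iX.
  have := @sample_has_mean _ _ _ _ P X (fun j => X (tperm a i j)) mX
    (fun j => mX _) iX hperm (fun j B mB => sameX _ _ mB) (phi ^~ a) u (mphi a) hu.
  apply: eq_has_mean => w /=.
  rewrite -[X in _ = phi _ X](tpermL a i) -phis.
  by congr phi; apply/funext => j.
have hs : has_mean P (fun w => \sum_(i <- enum 'I_n) phi (X ^~ w) i) (\sum_(i <- enum 'I_n) u).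
  by apply: has_mean_sum => i _; exact: hi.
rewrite big_enum/= sumr_const card_ord in hs.
have {}hs : has_mean P (fun w => Phi (X ^~ w)) (u *+ n).
  apply: has_mean_ae hs; first exact: has_mean_measurable hv.
  by apply: filterS sumphi => w <-; rewrite big_enum.
suff -> : n%:R^-1 * v = u by [].
by rewrite (has_mean_uniq hv hs) -[u *+ n]mulr_natl mulrA mulVf// mul1r.
Qed.

End Exchangeable.

(** * Tails of exponential order statistics as polynomials *)

Section Tail_polynomials.
Context {R : realType}.
Variables (n : nat) (lam : R).
Hypothesis lam_gt0 : 0 < lam.
Local Notation e := (fun t => expR (- lam * t)).

(** At [exp (- lam * t)], the probability that exactly [j] of [n] exponential variables are at most
    [t]. *)
Definition bin_poly (j : nat) : {poly R} :=
  'C(n, j)%:R *: ((1 - 'X) ^+ j * 'X^(n - j)).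

(* [(tail_poly 0 k).[exp (- lam * t)]] is the probability that fewer than [k] of
   [n] exponential variables are at most [t]; raising the first index integrates
   from [t] to infinity. *)
Fixpoint tail_poly (r k : nat) : {poly R} :=
  if r is r'.+1 then
    \sum_(j < k) (lam * (n - j)%:R)^-1 *: tail_poly r' j.+1
  else \sum_(j < k) bin_poly j.

Lemma tail_polyS r k : tail_poly r.+1 k =
  \sum_(j < k) (lam * (n - j)%:R)^-1 *: tail_poly r j.+1.
Proof. by []. Qed.

Lemma deriv_sum (I : Type) (s : seq I) (F : I -> {poly R}) :
  (\sum_(i <- s) F i)^`() = \sum_(i <- s) (F i)^`().
Proof. exact: raddf_sum. Qed.

Definition tail_fun r k t := (tail_poly r k).[e t].

(** Up to the factor [lam], the operator ['X] times derivative is minus the time derivative. The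
    identity is the forward equation of a pure death process and telescopes when summed over [j]. *)
Lemma mulX_deriv_bin_poly j : (j < n)%N ->
  'X * (bin_poly j.+1)^`() =
  (n - j.+1)%:R *: bin_poly j.+1 - (n - j)%:R *: bin_poly j.
Proof.
move=> jn; rewrite /bin_poly.
have -> : (n - j = (n - j.+1).+1)%N by lia.
set m := (n - j.+1)%N.
have E1 : ('C(n, j.+1)%:R * j.+1%:R = 'C(n, j)%:R * m.+1%:R :> {poly R}).
  by rewrite -!natrM; congr _%:R; rewrite mulnC mul_bin_left mulnC; congr muln; lia.
have E2 : ('X * ('X^(m.-1) *+ m) = 'X^m * m%:R :> {poly R}).
  by rewrite mulr_natr; case: (m) => [|p]; rewrite ?mulr0n ?mulr0//= mulrnAr -exprS.
rewrite derivZ derivM deriv_exp derivXn derivB derivC derivX /= sub0r.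
rewrite -!mul_polyC !polyC_natr.
rewrite mulrDr mulrDr.
have -> : 'X * ('C(n, j.+1)%:R * ((1 - 'X) ^+ j.+1 * ('X^(m.-1) *+ m))) =
  'C(n, j.+1)%:R * ((1 - 'X) ^+ j.+1 * ('X * ('X^(m.-1) *+ m))) :> {poly R}.
  by ring.
rewrite E2 -[_ *+ j.+1]mulr_natr ['X^(m.+1)]exprS [(1 - 'X) ^+ j.+1]exprS.
set u := (1 - 'X) ^+ j; set v := 'X^m.
transitivity (- ('C(n, j.+1)%:R * j.+1%:R) * 'X * u * v +
  'C(n, j.+1)%:R * (1 - 'X) * u * v * m%:R : {poly R}); first by ring.
by rewrite E1; ring.
Qed.

Lemma mulX_deriv_tail_poly0 k : (k <= n)%N ->
  'X * (tail_poly 0 k.+1)^`() = (n - k)%:R *: bin_poly k.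
Proof.
elim: k => [|k IH] kn /=.
  rewrite big_ord1 /bin_poly bin0 scale1r expr0 mul1r subn0 derivXn.
  rewrite scaler_nat; case: (n) => [|m]; first by rewrite !mulr0n mulr0.
  by rewrite /= mulrnAr -exprS.
rewrite big_ord_recr /= derivD mulrDr mulX_deriv_bin_poly//.
by rewrite IH ?(ltnW kn)// addrC subrK.
Qed.

(** Raising the first index inverts the operator: by telescoping, the weight [1 / (lam * (n - j))],
    the mean of the spacing after [j] arrivals, cancels the factor that differentiation produces. *)
Lemma mulX_deriv_tail_poly r k : (k <= n)%N ->
  lam *: ('X * (tail_poly r.+1 k)^`()) = tail_poly r k.
Proof.
have ne0 (j : 'I_k) : (k <= n)%N -> (n - j)%:R != 0 :> R.
  by move=> kn; rewrite pnatr_eq0 subn_eq0 -ltnNge (leq_trans (ltn_ord j)).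
elim: r k ne0 => [|r IH] k ne0 kn.
  rewrite tail_polyS deriv_sum mulr_sumr scaler_sumr /=; apply: eq_bigr => j _.
  rewrite derivZ -scalerAr mulX_deriv_tail_poly0; last first.
    by rewrite (leq_trans _ kn)// ltnW.
  rewrite scalerA scalerA -[RHS]scale1r; congr (_ *: _).
  by field; rewrite ne0// gt_eqF.
rewrite tail_polyS [RHS]tail_polyS deriv_sum mulr_sumr scaler_sumr; apply: eq_bigr => j _.
rewrite derivZ -scalerAr scalerA mulrC -scalerA IH//; last first.
  by rewrite (leq_trans _ kn).
move=> i jn; rewrite pnatr_eq0 subn_eq0 -ltnNge.
by rewrite (leq_trans (ltn_ord i)).
Qed.

Lemma root_tail_poly r k : (k <= n)%N -> (tail_poly r k).[0] = 0.
Proof.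
move=> kn; rewrite -(mulX_deriv_tail_poly r kn) hornerZ hornerM hornerX.
by rewrite mul0r mulr0.
Qed.

Lemma tail_poly0_1 k : (tail_poly 0 k.+1).[1] = 1.
Proof.
rewrite /= horner_sum big_ord_recl big1 ?addr0 => [|j _].
  by rewrite /bin_poly bin0 expr0 mul1r scale1r hornerXn expr1n.
by rewrite /bin_poly /= hornerZ hornerM horner_exp hornerD hornerN hornerC hornerX subrr expr0n mul0r mulr0.
Qed.

Lemma is_derive_expRM (t : R) :
  is_derive t 1 e (- lam * expR (- lam * t)).
Proof.
rewrite mulrC; apply: (@is_derive1_comp _ expR (fun t => - lam * t)).
by have := @is_deriveZ _ _ _ id (- lam) t 1 1 (is_derive_id _ _); rewrite /GRing.scale /= mulr1.
Qed.

Lemma is_derive_tail_fun r k (t : R) : (k <= n)%N ->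
  is_derive t 1 (tail_fun r.+1 k) (- tail_fun r k t).
Proof.
move=> kn; have -> : - tail_fun r k t =
    (tail_poly r.+1 k)^`().[e t] * (- lam * expR (- lam * t)).
  rewrite /tail_fun -(mulX_deriv_tail_poly r kn) hornerZ hornerM hornerX.
  by ring.
apply: (@is_derive1_comp _ (horner (tail_poly r.+1 k)) e).
exact: is_derive_expRM.
Qed.

Lemma tail_fun_ge0 r k (t : R) : 0 <= t -> (k <= n)%N -> 0 <= tail_fun r k t.
Proof.
move=> t0; have e0 : 0 <= expR (- lam * t) by exact: expR_ge0.
have e1 : expR (- lam * t) <= 1 by rewrite expR_le1 mulNr oppr_le0 mulr_ge0// ltW.
rewrite /tail_fun; elim: r k => [|r IH] k kn /=; rewrite horner_sum sumr_ge0// => j _.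
  rewrite hornerZ hornerM horner_exp !hornerE mulr_ge0// mulr_ge0//.
    by rewrite exprn_ge0// subr_ge0.
rewrite hornerZ mulr_ge0 ?invr_ge0 ?mulr_ge0 ?(ltW lam_gt0)//.
by apply: IH; rewrite (leq_trans _ kn).
Qed.

Lemma cvg_expRM : e t @[t --> +oo] --> 0.
Proof.
rewrite (_ : e = (fun x => expR (- x)) \o (fun t => lam * t)); last first.
  by apply/funext => t /=; rewrite mulNr.
apply: (@cvg_comp _ _ _ _ _ _ (pinfty_nbhs R)); last exact: cvgr_expR.
exact: gt0_cvgMry.
Qed.

Lemma cvg_pow_expRM m : (t ^+ m * expR (- lam * t)) @[t --> +oo] --> 0.
Proof.
(* Keeping only the Taylor term of order [m + 1] in [exp (lam * t)] bounds the function by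
   [K / t]. *)
pose K := (m.+1)`!%:R / lam ^+ m.+1.
have K0 : 0 <= K by rewrite divr_ge0// exprn_ge0// ltW.
apply: (@squeeze_cvgr _ _ _ _ (fun=> 0) (fun t => K * t^-1)).
- near=> t; have t0 : 0 < t by near: t; exact: nbhs_pinfty_gt.
  apply/andP; split; first by rewrite mulr_ge0 ?exprn_ge0 ?expR_ge0 ?ltW.
  have lt0 : 0 <= lam * t by rewrite mulr_ge0 ?ltW.
  have h := expR_ge1Dxn m lt0.
  have {}h : (lam * t) ^+ m.+1 / (m.+1)`!%:R <= expR (lam * t) by lra.
  rewrite mulNr expRN ler_pdivrMr ?expR_gt0//.
  apply: le_trans (ler_wpM2l _ h); last by rewrite mulr_ge0// invr_ge0 ltW.
  rewrite /K exprMn exprS.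
  rewrite le_eqVlt; apply/orP; left; apply/eqP; rewrite [t ^+ m.+1]exprS.
  field.
  by rewrite !gt_eqF// ?exprn_gt0// ltr0n fact_gt0.
- exact: cvg_cst.
- rewrite -[X in _ --> X](mulr0 K); apply: cvgMr; apply/gtr0_cvgV0.
    by near=> x; near: x; exact: nbhs_pinfty_gt.
  exact: cvg_id.
Unshelve. all: by end_near. Qed.

Lemma cvg_pow_tail_fun m r k : (k <= n)%N ->
  (t ^+ m * tail_fun r k t) @[t --> +oo] --> 0.
Proof.
move=> kn; have /factor_theorem[q qE] : root (tail_poly r k) 0.
  by apply/rootP/root_tail_poly.
have -> : (fun t => t ^+ m * tail_fun r k t) =
    (fun t => (t ^+ m * expR (- lam * t)) * q.[e t]).
  apply/funext => t; rewrite /tail_fun qE hornerM hornerXsubC subr0.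
  by ring.
rewrite -[X in _ --> X](mul0r q.[0]); apply: cvgM; first exact: cvg_pow_expRM.
apply: (@cvg_comp _ _ _ e (horner q) _ (nbhs (0 : R))); first exact: cvg_expRM.
by apply: differentiable_continuous; apply/derivable1_diffP; exact: ex_derive.
Qed.

(** Repeated integration by parts: each step lowers the power of [t] and raises [r]. At [0] only the
    last term survives. *)
Fixpoint tail_antiderivative m r k (t : R) : R :=
  if m is m'.+1 then
    - (t ^+ m / m`!%:R * tail_fun r.+1 k t) + tail_antiderivative m' r.+1 k t
  else - tail_fun r.+1 k t.

Lemma is_derive_tail_antiderivative m r k (t : R) : (k <= n)%N ->
  is_derive t 1 (tail_antiderivative m r k) (t ^+ m / m`!%:R * tail_fun r k t).
Proof.
move=> kn; elim: m r => [|m IH] r.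
  rewrite expr0 fact0 divr1 mul1r -[X in is_derive _ _ _ X]opprK.
  exact: is_deriveN (is_derive_tail_fun r t kn).
have h1 : is_derive t 1 (fun t : R => t ^+ m.+1 / (m.+1)`!%:R) (t ^+ m / m`!%:R).
  have -> : (fun t : R => t ^+ m.+1 / (m.+1)`!%:R) = (m.+1)`!%:R^-1 *: (@id R) ^+ m.+1.
    apply/funext => x; rewrite mulrC /=.
    by rewrite -[RHS]/((m.+1)`!%:R^-1 *: ((id ^+ m.+1) x)) exprfctE.
  apply: is_derive_eq; rewrite /GRing.scale /= mulr1 factS natrM.
  field; apply/andP; split; last by rewrite nat1r pnatr_eq0.
  by rewrite pnatr_eq0 -lt0n fact_gt0.
have h2 := is_deriveN (is_deriveM h1 (is_derive_tail_fun r t kn)).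
have h3 := is_deriveD h2 (IH r.+1).
rewrite (_ : _ * tail_fun r k t = - (t ^+ m.+1 / (m.+1)`!%:R *: - tail_fun r k t +
    tail_fun r.+1 k t *: (t ^+ m / m`!%:R)) +
    t ^+ m / m`!%:R * tail_fun r.+1 k t); last by rewrite /GRing.scale /=; ring.
exact: h3.
Qed.

Lemma tail_antiderivative0 m r k :
  tail_antiderivative m r k 0 = - (tail_poly (r + m).+1 k).[1].
Proof.
elim: m r => [|m IH] r /=; first by rewrite addn0 /tail_fun mulr0 expR0.
by rewrite expr0n /= !mul0r oppr0 add0r IH addSnnS.
Qed.

Lemma cvg_tail_antiderivative m r k : (k <= n)%N ->
  tail_antiderivative m r k t @[t --> +oo] --> 0.
Proof.
move=> kn; elim: m r => [|m IH] r /=.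
  rewrite -oppr0; apply: cvgN.
  have := cvg_pow_tail_fun 0 r.+1 kn.
  by under eq_fun do rewrite expr0 mul1r.
rewrite -[X in _ --> X](addr0 0); apply: cvgD; last exact: IH.
rewrite -oppr0; apply: cvgN; rewrite -(mulr0 ((m.+1)`!%:R^-1)).
under eq_fun do rewrite mulrAC mulrC.
by apply: cvgMr; exact: cvg_pow_tail_fun.
Qed.

Lemma integral_pow_tail_fun m k : (k <= n)%N ->
  (\int[lebesgue_measure]_(t in `[0%R, +oo[) (t ^+ m / m`!%:R * tail_fun 0 k t)%:E
   = (tail_poly m.+1 k).[1]%:E)%E.
Proof.
move=> kn; have der t := is_derive_tail_antiderivative m 0 t kn.
have cont_at (f df : R -> R) : (forall t : R, is_derive t 1 f (df t)) -> continuous f.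
  move=> h t; have := h t => ht.
  by apply: differentiable_continuous; apply/derivable1_diffP; exact: ex_derive.
rewrite (@ge0_continuous_FTC2y _ _ (tail_antiderivative m 0 k) _ 0)//.
- by rewrite tail_antiderivative0 EFinN oppeK add0e.
- by move=> t t0; rewrite mulr_ge0 ?tail_fun_ge0// divr_ge0// exprn_ge0.
- apply: continuous_subspaceT => t.
  apply: cvgM; first by apply: cvgM; [exact: exprn_continuous|exact: cvg_cst].
  rewrite /tail_fun; apply: (@continuous_comp _ _ _ e (horner (tail_poly 0 k))).
    exact: cont_at is_derive_expRM t.
  by apply: differentiable_continuous; apply/derivable1_diffP; exact: ex_derive.
- exact: cvg_tail_antiderivative.
- by apply: cvg_at_right_filter; exact: cont_at der 0.
- by move=> t _; have dt := der t; rewrite derive1E; exact: derive_val.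
Qed.

End Tail_polynomials.

(** * Exponential probabilities and moments from tails *)

Section Exponential.
Context {R : realType}.
Implicit Types (rate t : R).

Lemma exponential_prob_lt0 rate (B : set R) : B `<=` `]-oo, 0[ ->
  exponential_prob rate B = 0%E.
Proof.
move=> B0; apply: integral0_eq => x /B0; rewrite /= in_itv /= => x0.
by rewrite lt0_exponential_pdf.
Qed.

Lemma exponential_prob_set1 rate t : exponential_prob rate [set t] = 0%E.
Proof. by rewrite /exponential_prob integral_set1. Qed.

Lemma exponential_prob_le rate t : 0 < rate -> 0 <= t ->
  exponential_prob rate `]-oo, t] = (1 - expR (- rate * t))%:E.
Proof.
move=> r0 t0.
have -> : `]-oo, t]%classic = `]-oo, 0[%classic `|` `[0, t]%classic :> set R.
  apply/seteqP; split => x /=; rewrite !in_itv /=.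
    by have [|] := ltP x 0; [left|right].
  by case=> [/ltW/le_trans|/andP[_]//]; apply.
rewrite /exponential_prob ge0_integral_setU//=; last 3 first.
- by apply/measurable_EFinP; apply: measurable_funTS; exact: measurable_exponential_pdf.
- by move=> x _; rewrite lee_fin exponential_pdf_ge0// ltW.
- apply/disj_setPS => x [] /=; rewrite !in_itv /= => x0 /andP[x1 _].
  by move: x1; rewrite leNgt x0.
rewrite -/(exponential_prob rate `]-oo, 0[) exponential_prob_lt0// add0e.
move: t0; rewrite le_eqVlt => /orP[/eqP <-|t0].
  by rewrite set_itv1 integral_set1 mulr0 expR0 subrr.
by rewrite -/(exponential_prob rate `[0, t]) exponential_prob_itv0c.
Qed.

End Exponential.

Section Moments.
Context {R : realType} {d : measure_display} {T : measurableType d}.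
Variable P : probability T R.

Lemma measurable_natr_bool d' (S : measurableType d') (b : S -> bool) :
  measurable_fun setT b -> measurable_fun setT (fun w => (b w)%:R : R).
Proof.
move=> mb; rewrite (_ : (fun w => _) = (fun w => if b w then 1 else 0)).
  exact: measurable_fun_ifT.
by apply/funext => w; case: (b w).
Qed.

Lemma is_derive_pow_fact m (t : R) :
  is_derive t 1 (fun t : R => t ^+ m.+1 / (m.+1)`!%:R) (t ^+ m / m`!%:R).
Proof.
have -> : (fun t : R => t ^+ m.+1 / (m.+1)`!%:R) = (m.+1)`!%:R^-1 *: (@id R) ^+ m.+1.
  apply/funext => x; rewrite mulrC /=.
  by rewrite -[RHS]/((m.+1)`!%:R^-1 *: ((id ^+ m.+1) x)) exprfctE.
apply: is_derive_eq; rewrite /GRing.scale /= mulr1 factS natrM.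
field; apply/andP; split; last by rewrite nat1r pnatr_eq0.
by rewrite pnatr_eq0 -lt0n fact_gt0.
Qed.

Lemma integral_pow_lt m (v : R) : 0 <= v ->
  (\int[lebesgue_measure]_t
     ((0 <= t)%R%:R * (t ^+ m / m`!%:R) * (t < v)%R%:R)%:E =
   (v ^+ m.+1 / (m.+1)`!%:R)%:E)%E.
Proof.
move=> v0; pose f (t : R) := t ^+ m / m`!%:R.
have cf : continuous f.
  by move=> t; apply: cvgM; [exact: exprn_continuous|exact: cvg_cst].
transitivity (\int[lebesgue_measure]_(t in `[0%R, v[) (f t)%:E)%E.
  rewrite [RHS]integral_mkcond; apply: eq_integral => t _.
  rewrite patchE; case: ifPn; rewrite ?notin_setE ?inE /= in_itv /=.
    by move=> /andP[-> ->]; rewrite mul1r mulr1.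
  by case: (0 <= t); case: (t < v) => //=; rewrite ?mul0r ?mulr0.
rewrite integral_itv_bndo_bndc; last first.
  apply/measurable_EFinP; apply: measurable_funTS.
  exact: continuous_measurable_fun.
move: v0; rewrite le_eqVlt => /orP[/eqP <-|v0].
  by rewrite set_itv1 integral_set1 expr0n mul0r.
have der := is_derive_pow_fact m.
have cF : continuous (fun t : R => t ^+ m.+1 / (m.+1)`!%:R).
  by move=> t; apply: cvgM; [exact: exprn_continuous|exact: cvg_cst].
rewrite (@continuous_FTC2 _ _ (fun t : R => t ^+ m.+1 / (m.+1)`!%:R))//.
- by rewrite expr0n /= mul0r sube0.
- exact: continuous_subspaceT.
- split.
  + by move=> t _; have dt := der t; exact: ex_derive.
  + by apply: cvg_at_right_filter; exact: cF.
  + by apply: cvg_at_left_filter; exact: cF.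
- by move=> t _; have dt := der t; rewrite derive1E; exact: derive_val.
Qed.

(** Layer cake formula: up to factorials, a power of [V] is the integral of a power of [t] over
    [0 <= t < V], and Tonelli exchanges the two integrals. *)
Lemma has_mean_pow_of_tail (V : T -> R) (q : R -> R) m (u : R) :
  measurable_fun setT V -> {ae P, forall w, 0 <= V w} ->
  (forall t, 0 <= t -> P [set w | t < V w] = (q t)%:E) ->
  (\int[lebesgue_measure]_(t in `[0%R, +oo[) (t ^+ m / m`!%:R * q t)%:E = u%:E)%E ->
  has_mean P (fun w => V w ^+ m.+1) ((m.+1)`!%:R * u).
Proof.
move=> mV V0 Vq qu.
(* [V] is nonnegative only almost surely, while the pointwise formula needs it everywhere. *)
pose V' w := Num.max (V w) 0.
have mV' : measurable_fun setT V' by exact: measurable_maxr.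
have V'0 w : 0 <= V' w by rewrite le_max lexx orbT.
have fact0 k : k`!%:R != 0 :> R by rewrite pnatr_eq0 -lt0n fact_gt0.
apply: (@has_mean_ae _ _ _ _ (fun w => (m.+1)`!%:R * (V' w ^+ m.+1 / (m.+1)`!%:R))).
- exact: measurable_funX.
- apply: filterS V0 => w V0; rewrite mulrC divfK//.
  by rewrite /V' max_l.
apply: has_meanZ; apply: ge0_has_mean.
- by apply: measurable_funM => //; exact: measurable_funX.
- by move=> w; rewrite divr_ge0// exprn_ge0.
pose phi (z : T * R) :=
  ((0 <= z.2)%R%:R * (z.2 ^+ m / m`!%:R) * (z.2 < V' z.1)%R%:R)%:E.
have mphi : measurable_fun [set: T * R] phi.
  have m1 : measurable_fun [set: T * R] (fun z : T * R => V' z.1).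
    by apply: measurableT_comp => //; exact: measurable_fst.
  have m2 : measurable_fun [set: T * R] (fun z : T * R => z.2) by exact: measurable_snd.
  apply/measurable_EFinP; apply: measurable_funM; last first.
    by apply: measurable_natr_bool; exact: measurable_fun_ltr.
  apply: measurable_funM; last by apply: measurable_funM => //; exact: measurable_funX.
  by apply: measurable_natr_bool; exact: measurable_fun_ler.
have phi0 z : (0 <= phi z)%E.
  rewrite lee_fin; have [z0|z0] := leP 0 z.2; last by rewrite !mul0r.
  by rewrite mulr_ge0// mul1r divr_ge0// exprn_ge0.
transitivity (\int[P]_w \int[lebesgue_measure]_t phi (w, t))%E.
  by apply: eq_integral => w _; rewrite -integral_pow_lt.
rewrite fubini_tonelli//= -qu [RHS]integral_mkcond; apply: eq_integral => t _.
rewrite patchE; case: ifPn; rewrite ?notin_setE ?inE /= in_itv /= andbT.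
  move=> t0; rewrite /phi /= t0 mul1r.
  under eq_integral do rewrite EFinM.
  have mtV : measurable [set w | t < V w].
    have := measurable_fun_ltr (measurable_cst t) mV.
    by move=> /(_ measurableT [set true]); rewrite setTI; apply.
  rewrite ge0_integralZl//.
  - rewrite [RHS]EFinM -Vq//; congr (_ * _)%E.
    rewrite -[X in P X]setIT -integral_indic//; apply: eq_integral => w _.
    rewrite indicE mem_setE /V' lt_max [(t < 0)%R]ltNge t0 orbF.
    by congr _%:R%:E.
  - apply/measurable_EFinP/measurable_natr_bool.
    by apply: measurable_fun_ltr => //.
  - by rewrite lee_fin divr_ge0// exprn_ge0.
move=> t0; apply: integral0_eq => w _.
by rewrite /phi /= (negbTE (introN idP t0)) !mul0r.
Qed.

End Moments.

(** * Harmonic sums and moments of shifted exponential order statistics *)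

Section Harmonic_sums.
Context {R : realType}.

(** For [k <= n] this is [H_n - H_(n - k)], the mean of the [k]-th smallest of [n] exponentials of
    rate 1; [harmonic_tail2] is the corresponding variance. *)
Definition harmonic_tail (n k : nat) : R := \sum_(j < k) (n - j)%:R^-1.

Definition harmonic_tail2 (n k : nat) : R := \sum_(j < k) (n - j)%:R ^- 2.

Lemma tail_poly1_1 n (lam : R) k : 0 < lam ->
  (tail_poly n lam 1 k).[1] = harmonic_tail n k / lam.
Proof.
move=> l0; rewrite tail_polyS horner_sum /harmonic_tail mulr_suml.
by apply: eq_bigr => j _; rewrite hornerZ tail_poly0_1 mulr1 invfM mulrC.
Qed.

Lemma tail_poly2_1 n (lam : R) k : 0 < lam ->
  2 * (tail_poly n lam 2 k).[1] =
  (harmonic_tail n k ^+ 2 + harmonic_tail2 n k) / lam ^+ 2.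
Proof.
move=> l0; elim: k => [|k IH].
  rewrite tail_polyS big_ord0 horner0 mulr0.
  by rewrite /harmonic_tail /harmonic_tail2 !big_ord0 expr0n addr0 mul0r.
rewrite tail_polyS big_ord_recr -tail_polyS hornerD mulrDr IH hornerZ tail_poly1_1//.
rewrite /harmonic_tail /harmonic_tail2 !big_ord_recr /= -/(harmonic_tail n k).
rewrite -!exprVn invfM.
by set x := (n - k)%:R^-1; set H := harmonic_tail n k; ring.
Qed.

End Harmonic_sums.

Lemma has_mean_finsum {R : realType} {d} {T : measurableType d}
    (P : probability T R) (I : finType) (Q : pred I) (F : I -> T -> R) (V : I -> R) :
  (forall i, Q i -> has_mean P (F i) (V i)) ->
  has_mean P (fun w => \sum_(i | Q i) F i w) (\sum_(i | Q i) V i).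
Proof.
move=> FV; rewrite -big_filter.
have hF i : i \in [seq i <- index_enum I | Q i] -> has_mean P (F i) (V i).
  by rewrite mem_filter => /andP[Qi _]; exact: FV.
by apply: eq_has_mean (has_mean_sum hF) => w; rewrite big_filter.
Qed.

Section Shifted_exponential_sample.
Context {R : realType} {d : measure_display} {T : measurableType d}.
Variables (P : probability T R) (n k : nat) (lam c : R) (X : 'I_n -> T -> R).
Hypotheses (mX : forall i, measurable_fun setT (X i))
  (iX : mutually_independent P X)
  (lawX : forall i, shifted_exponential P lam c (X i)).
Hypotheses (lam0 : 0 < lam) (k0n : (0 < k <= n)%N).

Lemma has_mean_indic d' (S : measurableType d') (Q : probability S R) (A : set S) :
  measurable A -> has_mean Q (fun w => \1_A w) (fine (Q A)).
Proof.
move=> mA; apply: ge0_has_mean; first exact: measurable_indic.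
  by move=> w; exact: ler0n.
by rewrite fineK ?fin_num_measure// integral_indic// setIT.
Qed.

Lemma has_mean_prob d' (S : measurableType d') (Q : probability S R) (b : S -> bool) :
  measurable_fun setT b ->
  has_mean Q (fun w => (b w)%:R) (fine (Q [set w | b w])).
Proof.
move=> mb; have mB : measurable [set w | b w].
  by have := mb measurableT [set true]; rewrite setTI; apply.
apply: eq_has_mean (has_mean_indic Q mB) => w.
by rewrite indicE mem_setE.
Qed.

Lemma shifted_exponential_le i t : 0 <= t ->
  P (X i @^-1` `]-oo, c + t]) = (1 - expR (- lam * t))%:E.
Proof.
move=> t0; rewrite lawX// -exponential_prob_le//; congr exponential_prob.
by apply/seteqP; split => x; rewrite /= !in_itv /= lerD2l.
Qed.

Lemma shifted_exponential_gt i t : 0 <= t ->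
  P (X i @^-1` `]c + t, +oo[) = (expR (- lam * t))%:E.
Proof.
move=> t0; have mA : measurable (X i @^-1` `]-oo, c + t]).
  by have := mX i measurableT (measurable_itv `]-oo, c + t]); rewrite setTI.
have -> : X i @^-1` `]c + t, +oo[ = ~` (X i @^-1` `]-oo, c + t]).
  apply/seteqP; split => w /=; rewrite !in_itv /= andbT ltNge; first by move/negP.
  by move/negP.
rewrite probability_setC// shifted_exponential_le//.
by rewrite -EFinB; congr (_%:E); ring.
Qed.

Lemma ae_sample_gt : {ae P, forall w, forall i, c < X i w}.
Proof.
apply: filter_forall => i; exists (X i @^-1` `]-oo, c]); split.
- by have := mX i measurableT (measurable_itv `]-oo, c]); rewrite setTI.
- by have := shifted_exponential_le i (lexx 0); rewrite addr0 mulr0 expR0 subrr.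
- by move=> w /= /negP; rewrite -leNgt in_itv.
Qed.

(** With [X i] fixed, the independent variable [X j] has to hit a single point, which is a null
    event. *)
Lemma sample_eq_null i j : i != j -> P [set w | X i w = X j w] = 0%E.
Proof.
move=> ij.
have indij A B : measurable A -> measurable B ->
    P (X i @^-1` A `&` X j @^-1` B) = (P (X i @^-1` A) * P (X j @^-1` B))%E.
  move=> mA mB; apply: (@indep_subalg _ _ _ _ X mX P iX [set i] [set j]).
  - by move=> l /= -> /eqP; rewrite (negbTE ij).
  - by have := @measurable_coord _ _ _ X [set i] i erefl measurableT A mA; rewrite setTI.
  - by have := @measurable_coord _ _ _ X [set j] j erefl measurableT B mB; rewrite setTI.
have mD : measurable_fun [set: R * R] (fun z : R * R => ((z.1 == z.2)%:R : R)%:E).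
  apply/measurable_EFinP/measurable_natr_bool.
  by apply: measurable_fun_eqr; [exact: measurable_fst|exact: measurable_snd].
have D0 (z : R * R) : (0 <= ((z.1 == z.2)%:R : R)%:E)%E by rewrite lee_fin.
have := ge0_integral_indep (mX i) (mX j) indij mD D0.
have mb : measurable_fun setT (fun w => X i w == X j w) by exact: measurable_fun_eqr.
have mE : measurable [set w | X i w = X j w].
  have := mb measurableT [set true]; rewrite setTI => /(_ I).
  congr measurable; apply/seteqP; split => w /=; first by move/eqP.
  by move=> ->; rewrite eqxx.
have [_ ->] := has_mean_prob P mb.
rewrite integral0_eq => [[]|w _].
  rewrite (_ : [set w | X i w == X j w] = [set w | X i w = X j w]); last first.
    by apply/seteqP; split => w /= /eqP.
  have fE : P [set w | X i w = X j w] \is a fin_num by exact: fin_num_measure.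
  by move=> h; rewrite -(fineK fE) h.
rewrite /=; transitivity (\int[P]_w' (\1_(X j @^-1` [set X i w]) w')%:E)%E.
  apply: eq_integral => w' _; rewrite indicE; congr ((nat_of_bool _)%:R%:E).
  apply/idP/idP => [/eqP h|/set_mem /= ->]; last exact: eqxx.
  exact/mem_set.
rewrite integral_indic//; last first.
  by have := mX j measurableT (measurable_set1 (X i w)); rewrite setTI.
rewrite setIT; apply: eq_trans (lawX j (measurable_set1 (X i w))) _.
rewrite (_ : _ @^-1` _ = [set X i w - c]) ?exponential_prob_set1//.
by apply/seteqP; split => e /=; [move=> <-; ring|move=> ->; ring].
Qed.

Lemma ae_sample_inj : {ae P, forall w, injective (X ^~ w)}.
Proof.
have : {ae P, forall w, forall i j, i != j -> X i w <> X j w}.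
  apply: filter_forall => i; apply: filter_forall => j.
  case: (eqVneq i j) => [->|ij]; first exact: aeW.
  exists [set w | X i w = X j w]; split; last 2 first.
  - exact: sample_eq_null.
  - by move=> w /= h; apply: contrapT => h'; apply: h.
  have mb : measurable_fun setT (fun w => X i w == X j w) by exact: measurable_fun_eqr.
  have := mb measurableT [set true]; rewrite setTI => /(_ I).
  congr measurable; apply/seteqP; split => w /=; first by move/eqP.
  by move=> ->; rewrite eqxx.
apply: filterS => w h i j Xij; apply: contrapT => /eqP ij.
exact: h ij Xij.
Qed.

Definition sample_pattern t w : {set 'I_n} := finset (fun i => X i w <= c + t).

Lemma sample_patternE (A : {set 'I_n}) t :
  [set w | sample_pattern t w == A] = \bigcap_(i in [set` enum 'I_n])
    (X i @^-1` (if i \in A then `]-oo, c + t]%classic else `]c + t, +oo[%classic)).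
Proof.
apply/seteqP; split => w /=.
  move=> /eqP h i _; rewrite /preimage /= -h inE.
  by case: ifPn; rewrite /= in_itv /= ?andbT // ltNge.
move=> h; apply/eqP/setP => i; rewrite inE.
have := h i; rewrite /= mem_enum => /(_ isT); rewrite /preimage /=.
by case: ifPn => _; rewrite /= in_itv /= ?andbT // ltNge => /negbTE.
Qed.

Lemma measurable_sample_pattern (A : {set 'I_n}) t :
  measurable [set w | sample_pattern t w == A].
Proof.
rewrite sample_patternE; apply: fin_bigcap_measurable; first exact: finite_seq.
move=> i _; case: ifP => _.
  by have := mX i measurableT (measurable_itv `]-oo, c + t]); rewrite setTI.
by have := mX i measurableT (measurable_itv `]c + t, +oo[); rewrite setTI.
Qed.

Lemma sample_pattern_prob (A : {set 'I_n}) t : 0 <= t ->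
  P [set w | sample_pattern t w == A] =
  ((1 - expR (- lam * t)) ^+ #|A| * expR (- lam * t) ^+ (n - #|A|))%:E.
Proof.
move=> t0; rewrite sample_patternE.
rewrite (iX (B := fun i => if i \in A then `]-oo, c + t]%classic else `]c + t, +oo[%classic))
  ?enum_uniq//; last by move=> i; case: ifPn => _; exact: measurable_itv.
rewrite big_enum /=.
rewrite (eq_bigr (fun i =>
  (if i \in A then 1 - expR (- lam * t) else expR (- lam * t))%:E)); last first.
  move=> i _; case: ifPn => _; first by rewrite shifted_exponential_le.
  by rewrite shifted_exponential_gt.
rewrite prodEFin; congr (_%:E).
rewrite (bigID (mem A)) /=; congr (_ * _).
  by rewrite (eq_bigr (fun=> 1 - expR (- lam * t))) ?prodr_const// => i ->.
rewrite (eq_bigr (fun=> expR (- lam * t))); last by move=> i /negbTE ->.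
rewrite prodr_const; congr (_ ^+ _).
have An := max_card (mem A); rewrite card_ord in An.
apply/eqP; rewrite -(eqn_add2l #|A|) subnKC//.
by have := cardC (mem A); rewrite card_ord => /eqP.
Qed.

Lemma sum_card_lt (g : nat -> R) (m : nat) :
  \sum_(A : {set 'I_n} | (#|A| < m)%N) g #|A| = \sum_(j < m) 'C(n, j)%:R * g j.
Proof.
elim: m => [|m IH]; first by rewrite big_ord0 big_pred0.
rewrite big_ord_recr /= -IH (bigID (fun A : {set 'I_n} => #|A| == m)) /= addrC.
congr (_ + _).
  by apply: eq_bigl => A; rewrite ltnS [(#|A| < m)%N]ltn_neqAle andbC.
rewrite (eq_bigl (fun A : {set 'I_n} => #|A| == m)); last first.
  by move=> A; case: eqP => [->|]; rewrite ?andbF// ltnSn.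
rewrite (eq_bigr (fun=> g m)); last by move=> A /eqP ->.
rewrite sumr_const -[LHS]mulr_natl; congr (_%:R * _).
by rewrite -[in RHS](card_ord n) -card_draws cardsE.
Qed.

(** The event says that fewer than [k] variables are at most [c + t]; it is split by the set [A] of
    their indices, whose probability depends on the size of [A] alone. *)
Lemma prob_lt_ostat t : 0 <= t ->
  P [set w | t < ostat k (X ^~ w) - c] = (tail_fun n lam 0 k t)%:E.
Proof.
move=> t0.
have mS : measurable_fun setT (fun w => ostat k (X ^~ w)).
  by apply: measurable_ostat.
have mb : measurable_fun setT (fun w => t < ostat k (X ^~ w) - c).
  by apply: measurable_fun_ltr => //; exact: measurable_funB.
have h1 := has_mean_prob P mb.
have h2 := @has_mean_finsum _ _ _ P {set 'I_n} (fun A => (#|A| < k)%N)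
  (fun A => \1_[set w | sample_pattern t w == A]) _
  (fun A _ => has_mean_indic P (measurable_sample_pattern A t)).
have mE : measurable [set w | t < ostat k (X ^~ w) - c].
  by have := mb measurableT [set true]; rewrite setTI; apply.
rewrite -[LHS]fineK ?fin_num_measure//; congr (_%:E).
apply: (has_mean_uniq h1); move: h2.
rewrite (eq_bigr (fun A : {set 'I_n} =>
  (1 - expR (- lam * t)) ^+ #|A| * expR (- lam * t) ^+ (n - #|A|))); last first.
  by move=> A _; rewrite sample_pattern_prob.
rewrite (sum_card_lt (fun a => (1 - expR (- lam * t)) ^+ a * expR (- lam * t) ^+ (n - a))).
rewrite (_ : \sum_(j < k) _ = tail_fun n lam 0 k t); last first.
  rewrite /tail_fun /= horner_sum; apply: eq_bigr => j _.
  by rewrite hornerZ hornerM horner_exp hornerD hornerN hornerC hornerX hornerXn.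
apply: eq_has_mean => w.
rewrite ltrBrDl ltNge ostat_le// -ltnNge.
rewrite big_mkcond (bigD1 (sample_pattern t w)) //= big1 ?addr0 => [|A Aw].
  rewrite indicE mem_set //= (_ : #|sample_pattern t w| = #|[pred i | (X i w <= c + t)%R]|).
    by case: ifP.
  by apply: eq_card => i; rewrite !inE.
rewrite indicE memNset ?if_same//=.
by apply/negP; rewrite eq_sym.
Qed.

Lemma has_mean_ostat_pow m :
  has_mean P (fun w => (ostat k (X ^~ w) - c) ^+ m) (m`!%:R * (tail_poly n lam m k).[1]).
Proof.
case: m => [|m].
  move/andP: k0n => [k0 _]; rewrite -(prednK k0) tail_poly0_1 fact0 mulr1.
  by apply: eq_has_mean (has_mean_cst P 1) => w; rewrite expr0.
have mS : measurable_fun setT (fun w => ostat k (X ^~ w)).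
  by apply: measurable_ostat.
move/andP: (k0n) => [_ kn].
apply: (has_mean_pow_of_tail _ _ prob_lt_ostat).
- exact: measurable_funB.
- apply: filterS ae_sample_gt => w h; have [i ->] := ostat_mem (X ^~ w) k0n.
  by rewrite subr_ge0 ltW.
- exact: integral_pow_tail_fun.
Qed.

Lemma has_mean_ostat : has_mean P (fun w => ostat k (X ^~ w)) (c + harmonic_tail n k / lam).
Proof.
have := has_meanD (has_mean_cst P c) (has_mean_ostat_pow 1).
rewrite mul1r tail_poly1_1//; apply: eq_has_mean => w; rewrite expr1; ring.
Qed.

Lemma has_mean_ostat2 : has_mean P (fun w => ostat k (X ^~ w) ^+ 2)
  ((c + harmonic_tail n k / lam) ^+ 2 + harmonic_tail2 n k / lam ^+ 2).
Proof.
have h := has_meanD (has_meanD (has_mean_cst P (c ^+ 2))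
  (has_meanZ (2 * c) (has_mean_ostat_pow 1))) (has_mean_ostat_pow 2).
move: h; rewrite tail_poly2_1// mul1r tail_poly1_1//.
set u := (_ + _ + _) => h.
rewrite [X in has_mean _ _ X](_ : _ = u); last by rewrite /u -!exprVn; ring.
by apply: eq_has_mean h => w; ring.
Qed.

Lemma square_integrable_ostat : square_integrable P (fun w => ostat k (X ^~ w)).
Proof.
split; first by apply: measurable_ostat.
by eexists; exact: has_mean_ostat2.
Qed.

Lemma square_integrable_ostat2 : square_integrable P (fun w => ostat k (X ^~ w) ^+ 2).
Proof.
have mS : measurable_fun setT (fun w => ostat k (X ^~ w)).
  by apply: measurable_ostat.
have s2 : square_integrable P (fun w => (ostat k (X ^~ w) - c) ^+ 2).
  split; first by apply: measurable_funX; exact: measurable_funB.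
  exists (4`!%:R * (tail_poly n lam 4 k).[1]).
  by apply: eq_has_mean (has_mean_ostat_pow 4) => w; ring.
have := square_integrableB (square_integrableD s2
  (square_integrableZ (2 * c) square_integrable_ostat)) (square_integrable_cst P (c ^+ 2)).
by congr square_integrable; apply/funext => w; ring.
Qed.

End Shifted_exponential_sample.

Section Almost_everywhere_domination.
Context {R : realType} {d : measure_display} {T : measurableType d}.
Variable P : probability T R.

Lemma square_integrable_ae (f g : T -> R) : measurable_fun setT g ->
  {ae P, forall w, f w = g w} -> square_integrable P f -> square_integrable P g.
Proof.
move=> mg fg [mf [v hv]]; split => //; exists v.
apply: has_mean_ae hv; first exact: measurable_funX.
by apply: filterS fg => w ->.
Qed.

Lemma square_integrable_le_ae (f g : T -> R) : measurable_fun setT f ->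
  {ae P, forall w, `|f w| <= `|g w|} -> square_integrable P g -> square_integrable P f.
Proof.
move=> mf fg sg; have mg := proj1 sg.
pose f' w := if `|f w| <= `|g w| then f w else 0.
have mf' : measurable_fun setT f'.
  apply: measurable_fun_ifT => //; apply: measurable_fun_ler.
    exact: measurableT_comp.
  exact: measurableT_comp.
apply: (@square_integrable_ae f') => //.
  by apply: filterS fg => w; rewrite /f' => ->.
by apply: square_integrable_le sg => // w; rewrite /f'; case: ifP => // _; rewrite normr0.
Qed.

End Almost_everywhere_domination.

Lemma harmonic_tailS {R : realType} (n k : nat) :
  harmonic_tail n k.+1 = harmonic_tail n k + (n - k)%:R^-1 :> R.
Proof. by rewrite /harmonic_tail big_ord_recr. Qed.

(** The fraction [1 / (n - i)] occurs [k - i] times on the left, and [k - i = (n - i) - (n - k)]. *)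
Lemma sum_harmonic_tail {R : realType} (n k : nat) : (k <= n)%N ->
  \sum_(j < k) harmonic_tail n j.+1 = k%:R - (n - k)%:R * harmonic_tail n k :> R.
Proof.
elim: k => [|k IH] kn; first by rewrite big_ord0 /harmonic_tail big_ord0 mulr0 subr0.
rewrite big_ord_recr /= (IH (ltnW kn)) harmonic_tailS.
have -> : (n - k = (n - k.+1).+1)%N by lia.
rewrite -!natr1; set m := (n - k.+1)%:R; set H := harmonic_tail n k.
have m0 : m + 1 != 0 :> R by rewrite natr1 pnatr_eq0.
by field; rewrite addrC.
Qed.

(** * Means for one node among the earliest [k] *)

Section Among_earliest_means.
Context {R : realType} {d : measure_display} {T : measurableType d}.
Variables (P : probability T R) (n k : nat) (lam c : R) (X : 'I_n -> T -> R).
Hypotheses (mX : forall i, measurable_fun setT (X i))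
  (iX : mutually_independent P X)
  (lawX : forall i, shifted_exponential P lam c (X i)).
Hypotheses (lam0 : 0 < lam) (c0 : 0 < c) (k0n : (0 < k <= n)%N).
Variable a : 'I_n.

Local Notation among w i := (among_earliest k (X ^~ w) i).

Let sameX i j B : measurable B -> P (X i @^-1` B) = P (X j @^-1` B).
Proof. by move=> mB; rewrite !lawX. Qed.

Let mcoord i : measurable_fun setT (fun x : coord_space 'I_n => x i : R).
Proof. exact: measurable_coord_space. Qed.

Let mamong i : measurable_fun setT (fun x : coord_space 'I_n =>
  (among_earliest k (x : 'I_n -> R) i)%:R : R).
Proof. by apply: measurable_natr_bool; exact: measurable_among_earliest. Qed.

Let mostat : measurable_fun setT (fun x : coord_space 'I_n => ostat k (x : 'I_n -> R)).
Proof. exact: measurable_ostat. Qed.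

Let among_perm (x : 'I_n -> R) (s : {perm 'I_n}) i :
  among_earliest k (x \o s) i = among_earliest k x (s i).
Proof. by rewrite /among_earliest ostat_perm. Qed.

Let mamongT : measurable_fun setT (fun w => (among w a)%:R : R).
Proof. by apply: measurable_natr_bool; exact: measurable_among_earliest. Qed.

Let mostatT : measurable_fun setT (fun w => ostat k (X ^~ w)).
Proof. exact: measurable_ostat. Qed.

Lemma among_earliest_prob : has_mean P (fun w => (among w a)%:R) (k%:R / n%:R).
Proof.
rewrite mulrC; apply: (@exchangeable_mean _ _ _ n P X mX iX sameX
  (fun x i => (among_earliest k (x : 'I_n -> R) i)%:R) (fun=> k%:R)) => //.
- by move=> x s i; rewrite among_perm.
- apply: filterS (ae_sample_inj mX iX lawX) => w inj.
  exact: among_earliest_card.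
- by apply: has_mean_prob; exact: measurable_among_earliest.
- exact: has_mean_cst.
Qed.

Lemma has_mean_among_ostat : has_mean P (fun w => (among w a)%:R * ostat k (X ^~ w))
  (k%:R / n%:R * (c + harmonic_tail n k / lam)).
Proof.
have [u hu] : exists u, has_mean P (fun w => (among w a)%:R * ostat k (X ^~ w)) u.
  apply: (@square_integrable_has_mean).
  apply: square_integrable_le (square_integrable_ostat mX iX lawX lam0 k0n) => [|w].
    exact: measurable_funM.
  by rewrite normrM ler_piMl// normr_nat lern1 leq_b1.
rewrite (_ : k%:R / n%:R * _ = n%:R^-1 * (k%:R * (c + harmonic_tail n k / lam))); last by ring.
apply: (@exchangeable_mean _ _ _ n P X mX iX sameX
  (fun x i => (among_earliest k (x : 'I_n -> R) i)%:R * ostat k (x : 'I_n -> R))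
  (fun x => k%:R * ostat k (x : 'I_n -> R))) hu _ => //.
- by move=> i; exact: measurable_funM.
- by move=> x s i; rewrite among_perm ostat_perm.
- apply: filterS (ae_sample_inj mX iX lawX) => w inj.
  by rewrite -mulr_suml among_earliest_card.
- by apply: has_meanZ; exact: has_mean_ostat.
Qed.

Lemma square_integrable_among_delay :
  square_integrable P (fun w => (among w a)%:R * X a w).
Proof.
apply: square_integrable_le_ae (square_integrable_ostat mX iX lawX lam0 k0n).
  exact: measurable_funM.
apply: filterS (ae_sample_gt mX lawX lam0) => w /(_ a) Xa.
have Xa0 : 0 < X a w by exact: lt_trans Xa.
case: (boolP (among w a)) => [h|_]; last by rewrite mul0r normr0.
rewrite mul1r (ger0_norm (ltW Xa0)) ger0_norm//.
exact: le_trans (ltW Xa0) h.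
Qed.

(** By symmetry, [n] times this mean is the mean of the sum of the [k] smallest delays. *)
Lemma has_mean_among_delay : has_mean P (fun w => (among w a)%:R * X a w)
  (k%:R / n%:R * c + (k%:R - (n - k)%:R * harmonic_tail n k) / n%:R / lam).
Proof.
have [u hu] := square_integrable_has_mean square_integrable_among_delay.
have kn : (k <= n)%N by case/andP: k0n.
rewrite (_ : _ + _ = n%:R^-1 * (\sum_(j < k) (c + harmonic_tail n j.+1 / lam))); last first.
  rewrite big_split /= sumr_const card_ord -mulr_suml sum_harmonic_tail//.
  by rewrite -mulr_natl; ring.
apply: (@exchangeable_mean _ _ _ n P X mX iX sameX
  (fun x i => (among_earliest k (x : 'I_n -> R) i)%:R * (x : 'I_n -> R) i)
  (fun x => \sum_(j < k) ostat j.+1 (x : 'I_n -> R))) hu _ => //.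
- by move=> i; exact: measurable_funM.
- by move=> x s i; rewrite among_perm.
- apply: filterS (ae_sample_inj mX iX lawX) => w inj.
  rewrite -(@among_earliest_sum _ _ id) // [RHS]big_mkcond; apply: eq_bigr => i _.
  by case: ifP; rewrite ?mul1r ?mul0r.
- apply: has_mean_finsum => j _; apply: has_mean_ostat => //.
  by rewrite /= (leq_trans (ltn_ord j)).
Qed.

End Among_earliest_means.

(** * Sample paths of the relay *)

Section First_from.
Implicit Types (G : pred nat) (l m j : nat).

Lemma first_fromP G l m : (l <= m)%N -> G m ->
  [/\ (l <= first_from G l)%N, G (first_from G l) & (first_from G l <= m)%N].
Proof.
move=> lm Gm; rewrite /first_from; case: pselect => [h|]; last by case; exists m; rewrite lm.
case: ex_minnP => i /andP[li Gi] min; split => //.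
by apply: min; rewrite lm.
Qed.

Lemma first_from_eq G l m : (l <= m)%N -> G m ->
  (forall j, (l <= j < m)%N -> ~~ G j) -> first_from G l = m.
Proof.
move=> lm Gm hj; have [lf Gf fm] := first_fromP lm Gm.
apply/eqP; rewrite eqn_leq fm leqNgt; apply/negP => fltm.
by have := hj (first_from G l); rewrite lf fltm Gf => /(_ isT).
Qed.

Lemma first_from_none G l : (forall m, (l <= m)%N -> ~~ G m) -> first_from G l = 0%N.
Proof.
move=> h; rewrite /first_from; case: pselect => [h'|//]; exfalso.
by case: h' => m /andP[lm Gm]; have := h m lm; rewrite Gm.
Qed.

Lemma first_from_before G l m j : (l <= m)%N -> G m -> (l <= j < first_from G l)%N -> ~~ G j.
Proof.
move=> lm Gm /andP[lj jf]; apply/negP => Gj.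
by have [_ _] := first_fromP lj Gj; rewrite leqNgt jf.
Qed.

Definition count_before G m := \sum_(i < m) (G i : nat).

Lemma count_beforeS G m : count_before G m.+1 = (count_before G m + G m)%N.
Proof. by rewrite /count_before big_ord_recr. Qed.

Lemma leq_count_before G m m' : (m <= m')%N -> (count_before G m <= count_before G m')%N.
Proof.
elim: m' => [|m' IH]; first by rewrite leqn0 => /eqP ->.
rewrite leq_eqVlt => /orP[/eqP <- //|mm']; rewrite count_beforeS.
by rewrite (leq_trans (IH mm'))// leq_addr.
Qed.

(** Turns the recursive [occurrence] into a condition on [G] up to [m] only, which is what lets a
    random index be decided by the past. *)
Lemma occurrence_eq G j m : G m -> count_before G m = j -> occurrence G j = m.
Proof.
have const m0 m1 : (m0 <= m1)%N -> count_before G m0 = count_before G m1 ->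
    forall i, (m0 <= i < m1)%N -> ~~ G i.
  move=> m01 E i /andP[m0i im1]; apply/negP => Gi.
  have h1 := leq_count_before G m0i; have h2 := leq_count_before G im1.
  by move: h2; rewrite count_beforeS Gi; lia.
elim: j m => [|j IH] m Gm cm /=.
  apply: first_from_eq => // i im; apply: (const 0%N m) => //.
  by rewrite cm /count_before big_ord0.
have [m' [m'm Gm' cm']] : exists m', [/\ (m' < m)%N, G m' & count_before G m' = j].
  elim: m cm {Gm} => [|m IHm]; first by rewrite /count_before big_ord0.
  rewrite count_beforeS; case: (boolP (G m)) => Gm.
    by rewrite addn1 => -[cm]; exists m.
  by rewrite addn0 => /IHm[m' [m'm Gm' cm']]; exists m'; split => //; lia.
rewrite (IH m' Gm' cm').
apply: first_from_eq => // i im; apply: (const m'.+1 m) => //.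
by rewrite count_beforeS Gm' cm' cm addn1.
Qed.

Lemma exists_count_before G j m : (j < count_before G m)%N ->
  exists m', [/\ (m' < m)%N, G m' & count_before G m' = j].
Proof.
elim: m => [|m IH]; first by rewrite /count_before big_ord0.
rewrite count_beforeS => h.
case: (ltnP j (count_before G m)) => [/IH[m' [? ? ?]]|jm].
  by exists m'; split => //; lia.
case: (boolP (G m)) h => Gm h; last by exfalso; lia.
by exists m; split => //; lia.
Qed.

Definition infinitely_often G := forall l, exists2 m, (l <= m)%N & G m.

Lemma occurrence_spec G j : infinitely_often G ->
  G (occurrence G j) /\ count_before G (occurrence G j) = j.
Proof.
move=> io.
have [m jm] : exists m, (j < count_before G m)%N.
  elim: j => [|j [m jm]].
    by have [m _ Gm] := io 0%N; exists m.+1; rewrite count_beforeS Gm addn1.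
  have [m' mm' Gm'] := io m; exists m'.+1; rewrite count_beforeS Gm' addn1 ltnS.
  exact: leq_trans (leq_count_before _ mm').
have [m' [_ Gm' cm']] := exists_count_before jm.
by rewrite (occurrence_eq Gm' cm').
Qed.

Lemma count_before_frozen G G' m : (forall i, (i < m)%N -> G i = G' i) ->
  count_before G m = count_before G' m.
Proof. by move=> GG'; apply: eq_bigr => i _; rewrite GG'. Qed.

Lemma occurrence_frozen G G' m j : (forall i, (i < m)%N -> G i = G' i) ->
  (j < count_before G m)%N -> occurrence G j = occurrence G' j /\ (occurrence G j < m)%N.
Proof.
move=> GG' /exists_count_before[m' [m'm Gm' cm']].
rewrite (occurrence_eq Gm' cm'); split => //.
apply/esym/occurrence_eq; first by rewrite -GG'.
by rewrite -cm'; apply/esym/count_before_frozen => i im'; rewrite GG'//; exact: ltn_trans m'm.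
Qed.

End First_from.

(** * Measurability of randomly indexed quantities *)

Section Random_indices.
Context {d : measure_display} {T : measurableType d}.

Lemma measurable_fun_natP (f : T -> nat) :
  (forall j, measurable [set w | f w = j]) -> measurable_fun setT f.
Proof.
move=> mf _ Y _; rewrite setTI.
rewrite (_ : f @^-1` Y = \bigcup_(j in Y) [set w | f w = j]).
  by apply: bigcup_measurable => j _; exact: mf.
by apply/seteqP; split => [w Yw|w [j Yj /= fwj]]; [exists (f w)|rewrite /preimage /= fwj].
Qed.

Lemma measurable_nat_eq (f : T -> nat) j : measurable_fun setT f ->
  measurable [set w | f w = j].
Proof. by move=> mf; have := mf measurableT [set j]; rewrite setTI; apply. Qed.

(** Splitting by the countably many values of [l] makes the index constant on each piece. *)
Lemma measurable_random_index d' (U : measurableType d') (F : nat -> T -> U) (l : T -> nat) :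
  (forall i, measurable_fun setT (F i)) -> measurable_fun setT l ->
  measurable_fun setT (fun w => F (l w) w).
Proof.
move=> mF ml _ Y mY; rewrite setTI.
rewrite (_ : _ @^-1` Y = \bigcup_i ([set w | l w = i] `&` F i @^-1` Y)).
  apply: bigcup_measurable => i _; apply: measurableI; first exact: measurable_nat_eq.
  by have := mF i measurableT Y mY; rewrite setTI.
apply/seteqP; split => [w Yw|w [i _ [/= <-]]] //.
by exists (l w).
Qed.

Lemma measurable_setb (b : T -> bool) : measurable_fun setT b -> measurable [set w | b w].
Proof. by move=> mb; have := mb measurableT [set true]; rewrite setTI; apply. Qed.

Lemma measurable_set_cst (Q : Prop) : measurable [set _ : T | Q].
Proof.
case: (pselect Q) => q; first by rewrite (_ : [set _ | _] = setT)//; apply/seteqP; split.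
by rewrite (_ : [set _ | _] = set0)//; apply/seteqP; split.
Qed.

Lemma measurable_first_from (G : T -> pred nat) l :
  (forall m, measurable_fun setT (G ^~ m)) ->
  measurable_fun setT (fun w => first_from (G w) l).
Proof.
move=> mG; apply: measurable_fun_natP => j.
pose hit := [set w | (l <= j)%N] `&` ([set w | G w j] `&`
  \bigcap_(m in [set m | (l <= m < j)%N]) [set w | ~~ G w m]).
(* When nothing is found the junk value [0] is returned, so the preimage of [0] has this extra
   piece. *)
pose none := \bigcap_(m in [set m | (l <= m)%N]) [set w | ~~ G w m].
rewrite (_ : [set w | _] = hit `|` ([set w | j = 0%N] `&` none)).
  apply: measurableU.
    apply: measurableI; first exact: measurable_set_cst.
    apply: measurableI; first exact: measurable_setb.
    apply: bigcap_measurableType => m _.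
    by apply: measurable_setb; exact: measurable_neg.
  apply: measurableI; first exact: measurable_set_cst.
  apply: bigcap_measurableType => m _.
  by apply: measurable_setb; exact: measurable_neg.
apply/seteqP; split => w /=; last first.
  case=> [[lj [Gj h]]|[-> h]]; first exact: first_from_eq.
  exact: first_from_none.
move=> fj; case: (pselect (exists2 m, (l <= m)%N & G w m)) => [[m lm Gm]|h].
  left; have [lf Gf fm] := first_fromP lm Gm; rewrite /hit -fj; do 2 split => //.
  by move=> i /= /(first_from_before lm Gm).
have none_w : forall m, (l <= m)%N -> ~~ G w m.
  by move=> m lm; apply/negP => Gm; apply: h; exists m.
by right; rewrite -fj; split => //; exact: first_from_none.
Qed.

Lemma measurable_succ : measurable_fun setT (S : nat -> nat).
Proof. by []. Qed.

Lemma measurable_occurrence (G : T -> pred nat) j :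
  (forall m, measurable_fun setT (G ^~ m)) ->
  measurable_fun setT (fun w => occurrence (G w) j).
Proof.
move=> mG; elim: j => [|j IH] /=; first exact: measurable_first_from.
apply: (@measurable_random_index _ _ (fun i w => first_from (G w) i.+1)) => // i.
exact: measurable_first_from.
Qed.

End Random_indices.

Section Paths.
Context {R : realType} {n : nat}.
Variables (k : nat) (y : nat -> 'I_n -> R).
Implicit Types r : nat -> R.

Definition divergent_path r : Prop :=
  (forall j, 0 <= r j) /\ (forall B : R, exists m, B <= arrival_time r m).

Lemma arrival_timeS r j : arrival_time r j.+1 = arrival_time r j + r j.+1.
Proof. by rewrite /arrival_time big_ord_recr. Qed.

Lemma le_arrival_time r i j : divergent_path r -> (i <= j)%N ->
  arrival_time r i <= arrival_time r j.
Proof.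
move=> [r0 _]; elim: j => [|j IH]; first by rewrite leqn0 => /eqP ->.
rewrite leq_eqVlt => /orP[/eqP -> //|ij]; rewrite arrival_timeS.
by apply: (le_trans (IH ij)); rewrite lerDl.
Qed.

(** Divergence makes every search succeed, so [accepted] never takes the junk value of [first_from]
    and its recursion can be read as intended. *)
Lemma accepted_spec r v : divergent_path r ->
  [/\ (accepted k y r v < accepted k y r v.+1)%N,
      arrival_time r (accepted k y r v) + ostat k (y v) <=
        arrival_time r (accepted k y r v.+1) &
      forall j, (accepted k y r v < j < accepted k y r v.+1)%N ->
        arrival_time r j < arrival_time r (accepted k y r v) + ostat k (y v)].
Proof.
move=> gr; set t := arrival_time r (accepted k y r v) + ostat k (y v).
pose G j := t <= arrival_time r j.
have [m lm Gm] : exists2 m, ((accepted k y r v).+1 <= m)%N & G m.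
  have [m tm] := proj2 gr t; exists (maxn m (accepted k y r v).+1).
    exact: leq_maxr.
  by apply: (le_trans tm); apply: le_arrival_time => //; exact: leq_maxl.
have [h1 h2 _] := first_fromP lm Gm; split => // j jj.
by have := first_from_before lm Gm jj; rewrite /G -ltNge.
Qed.

Lemma leq_accepted r u v : divergent_path r -> (u <= v)%N ->
  (accepted k y r u <= accepted k y r v)%N.
Proof.
move=> gr; elim: v => [|v IH]; first by rewrite leqn0 => /eqP ->.
rewrite leq_eqVlt => /orP[/eqP -> //|uv]; apply: (leq_trans (IH uv)).
by have [/ltnW] := accepted_spec v gr.
Qed.

Lemma ltn_accepted r u v : divergent_path r -> (u < v)%N ->
  (accepted k y r u < accepted k y r v)%N.
Proof.
move=> gr uv; have [h _ _] := accepted_spec u gr.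
exact: leq_trans h (leq_accepted gr uv).
Qed.

(** Stopping-time property: an accepted index is determined by the interarrival times up to itself.
    Only [r] has to diverge, since the same arrivals end each search along [r']. *)
Lemma accepted_agree r r' j v : divergent_path r ->
  (forall i, (i <= j)%N -> r i = r' i) -> (accepted k y r v <= j)%N ->
  accepted k y r' v = accepted k y r v.
Proof.
move=> gr rr'.
have T i : (i <= j)%N -> arrival_time r' i = arrival_time r i.
  move=> ij; apply: eq_bigr => l _; rewrite rr'//.
  by rewrite (leq_trans _ ij)// -ltnS.
elim: v => // v IH vj; have [h1 h2 h3] := accepted_spec v gr.
have vj' : (accepted k y r v <= j)%N by exact: leq_trans (ltnW h1) vj.
rewrite [LHS]/= (IH vj') (T _ vj').
apply: first_from_eq => //; first by rewrite T.
by move=> i /andP[vi iv]; rewrite T -?ltNge ?h3 ?vi// (leq_trans (ltnW iv)).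
Qed.

(* [idle_time v] is the time that the middle node waits, before its transmission
   number [v], for the next update. *)
Definition idle_time r v : R :=
  if v is v'.+1 then
    arrival_time r (accepted k y r v'.+1) -
    (arrival_time r (accepted k y r v') + ostat k (y v'))
  else r 0%N.

(* What happens up to arrival [j] does not depend on the later interarrival times.
   Replacing these by [1] turns this into measurability with respect to the earlier
   ones, and keeps the path divergent. *)
Definition frozen j r i : R := if (i <= j)%N then r i else 1.

Lemma divergent_frozen j r : divergent_path r -> divergent_path (frozen j r).
Proof.
move=> [r0 _]; have f0 i : 0 <= frozen j r i by rewrite /frozen; case: ifP.
split => // B.
have mT m : m%:R <= arrival_time (frozen j r) (j + m).
  elim: m => [|m IH]; first exact: sumr_ge0.
  rewrite addnS arrival_timeS -natr1 lerD// /frozen ifF//.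
  by apply/negbTE; rewrite -ltnNge ltnS leq_addr.
exists (j + Num.bound `|B|)%N; apply: le_trans (mT _).
by apply: (le_trans (ler_norm B)); apply/ltW/archi_boundP.
Qed.

Lemma arrival_time_frozen j r i : (i <= j)%N ->
  arrival_time (frozen j r) i = arrival_time r i.
Proof.
move=> ij; apply: eq_bigr => l _; rewrite /frozen ifT//.
by rewrite (leq_trans _ ij)// -ltnS.
Qed.

End Paths.

Section Measurable_paths.
Context {R : realType} {n : nat} {d : measure_display} {T : measurableType d}.
Variables (k : nat) (y : T -> nat -> 'I_n -> R) (r : T -> nat -> R).
Hypothesis mr : forall j, measurable_fun setT (fun w => r w j).

Lemma measurable_arrival_time j : measurable_fun setT (fun w => arrival_time (r w) j).
Proof. exact: measurable_sum. Qed.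

(** Only the services before transmission [v] have to be measurable, so the lemma also applies in
    sub-sigma-algebras that describe the past. *)
Lemma measurable_accepted v :
  (forall u, (u < v)%N -> measurable_fun setT (fun w => ostat k (y w u))) ->
  measurable_fun setT (fun w => accepted k (y w) (r w) v).
Proof.
elim: v => [|v IH] mS; first exact: measurable_cst.
have mv : measurable_fun setT (fun w => accepted k (y w) (r w) v).
  by apply: IH => u uv; apply: mS; exact: ltnW.
apply: (@measurable_random_index _ _ _ _ (fun i w => first_from
  (fun j => arrival_time (r w) i + ostat k (y w v) <= arrival_time (r w) j) i.+1)) => // i.
apply: measurable_first_from => m; apply: measurable_fun_ler.
  by apply: measurable_funD; [exact: measurable_arrival_time|exact: mS].
exact: measurable_arrival_time.
Qed.

Lemma measurable_arrival_accepted v :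
  (forall u, (u < v)%N -> measurable_fun setT (fun w => ostat k (y w u))) ->
  measurable_fun setT (fun w => arrival_time (r w) (accepted k (y w) (r w) v)).
Proof.
move=> mS; apply: (@measurable_random_index _ _ _ _ (fun i w => arrival_time (r w) i)).
  exact: measurable_arrival_time.
exact: measurable_accepted.
Qed.

Lemma measurable_idle_time v :
  (forall u, (u < v)%N -> measurable_fun setT (fun w => ostat k (y w u))) ->
  measurable_fun setT (fun w => idle_time k (y w) (r w) v).
Proof.
case: v => [|v] mS; first exact: mr.
apply: measurable_funB; first exact: measurable_arrival_accepted.
apply: measurable_funD; last exact: mS.
by apply: measurable_arrival_accepted => u uv; apply: mS; exact: ltnW.
Qed.

End Measurable_paths.

(** * Independence of the relay cycles *)

Section Probability_of_events.
Context {R : realType} {d : measure_display} {T : measurableType d}.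
Variable P : probability T R.

Lemma eq_prob_ae (A B : set T) : measurable A -> measurable B ->
  {ae P, forall w, A w <-> B w} -> P A = P B.
Proof.
move=> mA mB AB.
have hA := has_mean_indic P mA; have hB := has_mean_indic P mB.
have hAB : {ae P, forall w, (\1_A w : R) = \1_B w}.
  apply: filterS AB => w AB; rewrite !indicE; congr ((nat_of_bool _)%:R).
  by apply/idP/idP => /set_mem h; apply/mem_set/AB.
have m1B : measurable_fun setT (\1_B : T -> R) by exact: measurable_indic.
have := has_mean_uniq (has_mean_ae m1B hAB hA) hB.
by move=> h; rewrite -(fineK (fin_num_measure P A mA)) h fineK// fin_num_measure.
Qed.

(** Reduces a product formula to the pieces where a random index is constant; the factor [q] must be
    the same on all of them. *)
Lemma prob_partition_mul (kappa : T -> nat) (A B : set T) (q : \bar R) :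
  measurable_fun setT kappa -> measurable A -> measurable B ->
  (0 <= q)%E -> q \is a fin_num ->
  (forall j, P ((A `&` B) `&` [set w | kappa w = j]) =
             (P (A `&` [set w | kappa w = j]) * q)%E) ->
  P (A `&` B) = (P A * q)%E.
Proof.
move=> mk mA mB q0 qfin h.
have part C : measurable C -> P C = (\sum_(0 <= j <oo) P (C `&` [set w | kappa w = j]))%E.
  move=> mC; have := @measure_bigcup _ _ _ P setT (fun j => C `&` [set w | kappa w = j]).
  rewrite -setI_bigcupr (_ : \bigcup_(i in _) _ = setT) ?setIT; last first.
    by apply/seteqP; split => // w _; exists (kappa w).
  move=> ->; first by apply: eq_eseriesl => j; rewrite in_setT.
    by move=> j _; apply: measurableI => //; exact: measurable_nat_eq.
  by move=> i j _ _ [w [[_ /= <-] [_ /= <-]]].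
rewrite (part _ (measurableI _ _ mA mB)) (part _ mA).
rewrite -[in RHS](fineK qfin) muleC -nneseriesZl//; last first.
by apply: eq_eseriesr => j _; rewrite h muleC fineK.
Qed.

End Probability_of_events.

(** * Memorylessness at a random threshold *)

Section Memoryless.
Context {R : realType} {d : measure_display} {T : measurableType d}.
Variables (P : probability T R) (rate : R) (Z : T -> R).
Hypotheses (mZ : measurable_fun setT Z) (rate0 : 0 < rate)
  (lawZ : exponential_rv P rate Z).

Lemma exponential_gt t : 0 <= t -> P (Z @^-1` `]t, +oo[) = (expR (- rate * t))%:E.
Proof.
move=> t0; have mA : measurable (Z @^-1` `]-oo, t]).
  by have := mZ measurableT (measurable_itv `]-oo, t]); rewrite setTI.
have -> : Z @^-1` `]t, +oo[ = ~` (Z @^-1` `]-oo, t]).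
  by apply/seteqP; split => w /=; rewrite !in_itv /= andbT ltNge => /negP.
rewrite probability_setC// lawZ// exponential_prob_le//.
by rewrite -EFinB; congr (_%:E); ring.
Qed.

Lemma ae_exponential_gt0 : {ae P, forall w, 0 < Z w}.
Proof.
exists (Z @^-1` `]-oo, 0]); split.
- by have := mZ measurableT (measurable_itv `]-oo, 0]); rewrite setTI.
- by rewrite lawZ// exponential_prob_le// mulr0 expR0 subrr.
- by move=> w /= /negP; rewrite -leNgt in_itv.
Qed.

(** Both sides are finite measures of [C], and they agree on the rays []t, +oo[], which generate the
    Borel sets. *)
Lemma exponential_memoryless v (C : set R) : 0 <= v -> measurable C ->
  P [set w | v <= Z w /\ C (Z w - v)] = ((expR (- rate * v))%:E * P (Z @^-1` C))%E.
Proof.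
move=> v0 mC.
have mZv : measurable_fun setT (fun w => Z w - v) by exact: measurable_funB.
pose XZ : {mfun T >-> R} := HB.pack Z (isMeasurableFun.Build _ _ _ _ Z mZ).
pose Xv : {mfun T >-> R} := HB.pack (fun w => Z w - v)
  (isMeasurableFun.Build _ _ _ _ _ mZv).
have mI : measurable (`[0, +oo[%classic : set R) by exact: measurable_itv.
have e0 : 0 <= expR (- rate * v) by exact: expR_ge0.
have mge (t : R) : measurable (Z @^-1` `]t, +oo[).
  by have := mZ measurableT (measurable_itv `]t, +oo[); rewrite setTI.
have dE B : distribution P XZ B = P (Z @^-1` B) by [].
have dEv B : distribution P Xv B = P [set w | B (Z w - v)] by [].
have key : forall C, measurable C -> mrestr (distribution P Xv) mI C =
    mscale (NngNum e0) (distribution P XZ) C.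
  move=> {mC}C mC; apply: (measure_unique (@RGenOInfty.G R) (fun i : nat => `]- i%:R, +oo[%classic)) => //.
  - exact: RGenOInfty.measurableE.
  - move=> _ _ [s ->] [t ->]; exists (Num.max s t); apply/seteqP; split => x /=.
      by rewrite !in_itv /= !andbT gt_max => -[-> ->].
    by rewrite !in_itv /= !andbT gt_max => /andP[].
  - by move=> i; exists (- i%:R).
  - apply/seteqP; split => // x _; exists (Num.bound `|x|) => //=.
    by rewrite in_itv /= andbT ltrNl (le_lt_trans (ler_norm _))// normrN archi_boundP.
  - move=> _ [t ->].
    rewrite /= /mrestr /mscale /= dE dEv.
    have [t0|t0] := leP 0 t.
      rewrite (_ : [set w | _] = Z @^-1` `]v + t, +oo[).
        rewrite !exponential_gt ?addr_ge0// -EFinM -expRD; congr ((expR _)%:E); ring.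
      apply/seteqP; split => w /=; rewrite !in_itv /= !andbT ltrBrDl; first by case.
      move=> h; split => //; rewrite subr_ge0.
      by apply: ltW; apply: le_lt_trans h; rewrite lerDl.
    (* For [t < 0] the ray contains all of [[0, +oo[], so only [v <= Z w] matters, and this differs
       from [v < Z w] by a null event. *)
    have ge0 : P [set w | v <= Z w] = P (Z @^-1` `]v, +oo[).
      apply: eq_prob_ae => //.
        by have := mZ measurableT (measurable_itv `[v, +oo[); rewrite setTI;
          congr measurable; apply/seteqP; split => w /=; rewrite in_itv /= andbT.
      exists (Z @^-1` [set v]); split.
      - by have := mZ measurableT (measurable_set1 v); rewrite setTI.
      - by rewrite lawZ// exponential_prob_set1.
      - move=> w /= h; apply: contrapT => /eqP Zv; apply: h.
        by rewrite in_itv /= andbT lt_neqAle eq_sym Zv.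
    rewrite (_ : [set w | _] = [set w | v <= Z w]); last first.
      apply/seteqP; split => w /=; rewrite !in_itv /= !andbT subr_ge0; first by case.
      by move=> h; split => //; apply: (lt_le_trans t0); rewrite subr_ge0.
    rewrite ge0 exponential_gt//.
    rewrite (@eq_prob_ae _ _ _ _ _ setT) ?probability_setT ?mule1//.
    apply: filterS ae_exponential_gt0 => w Z0; split => // _.
    by rewrite /= in_itv /= andbT (lt_trans t0).
  - move=> i; apply: (@le_lt_trans _ _ 1%E); last exact: ltry.
    by rewrite /mrestr; apply: probability_le1; exact: measurableI.
have := key C mC; rewrite /= /mrestr /mscale /distribution /pushforward /= => <-.
congr (P _); apply/seteqP; split => w /=; rewrite in_itv /= andbT subr_ge0; first by case.
by case.
Qed.

Variable f : T -> R.
Hypothesis mf : measurable_fun setT f.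
Hypothesis indfZ : forall A B, measurable A -> measurable B ->
  P (f @^-1` A `&` Z @^-1` B) = (P (f @^-1` A) * P (Z @^-1` B))%E.

(** Integrating memorylessness over the independent threshold [f] produces a factor that does not
    depend on [C]; the case of [setT] identifies it. *)
Lemma memoryless_overshoot (C : set R) : measurable C ->
  P [set w | (0 < f w <= Z w)%R /\ C (Z w - f w)] =
  (P [set w | (0 < f w <= Z w)%R] * P (Z @^-1` C))%E.
Proof.
pose I := (\int[P]_w ((0 < f w)%R%:R * expR (- rate * f w))%:E)%E.
have main (D : set R) : measurable D ->
    P [set w | (0 < f w <= Z w)%R /\ D (Z w - f w)] = (I * P (Z @^-1` D))%E.
  move=> mD.
  pose E := [set z : R * R | (0 < z.1 <= z.2) /\ D (z.2 - z.1)].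
  have mE : measurable E.
    have m1 : measurable_fun [set: R * R] (fun z : R * R => z.1) by exact: measurable_fst.
    have m2 : measurable_fun [set: R * R] (fun z : R * R => z.2) by exact: measurable_snd.
    apply: measurableI.
      by apply: measurable_setb; apply: measurable_and;
        [exact: measurable_fun_ltr|exact: measurable_fun_ler].
    by have := measurable_funB m2 m1 measurableT mD; rewrite setTI.
  have mphi : measurable_fun [set: R * R] (fun z : R * R => (\1_E z : R)%:E).
    by apply/measurable_EFinP; exact: measurable_indic.
  have phi0 (z : R * R) : (0 <= (\1_E z : R)%:E)%E by rewrite lee_fin.
  have := ge0_integral_indep mf mZ indfZ mphi phi0.
  have mEfZ : measurable [set w | (0 < f w <= Z w)%R /\ D (Z w - f w)].
    by have := measurable_fun_pair mf mZ measurableT mE; rewrite setTI.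
  rewrite (_ : (\int[P]_w _)%E = P [set w | (0 < f w <= Z w)%R /\ D (Z w - f w)]); last first.
    by rewrite -[X in P X]setIT -integral_indic//; apply: eq_integral.
  move=> ->.
  transitivity (\int[P]_w (((0 < f w)%R%:R * expR (- rate * f w))%:E * P (Z @^-1` D)))%E.
    apply: eq_integral => w _.
    have [f0|f0] := ltP 0 (f w); last first.
      rewrite mul0r mul0e; apply: integral0_eq => w' _.
      by rewrite indicE memNset//= => -[/andP[]]; rewrite ltNge f0.
    rewrite mul1r -exponential_memoryless ?ltW//.
    have mEw : measurable [set w' | f w <= Z w' /\ D (Z w' - f w)].
      apply: measurableI.
        have := mZ measurableT (measurable_itv `[f w, +oo[); rewrite setTI.
        by congr measurable; apply/seteqP; split => w' /=; rewrite in_itv /= andbT.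
      by have := measurable_funB mZ (measurable_cst (f w)) measurableT mD; rewrite setTI.
    rewrite -[X in P X]setIT -integral_indic//; apply: eq_integral => w' _.
    rewrite !indicE; congr ((nat_of_bool _)%:R%:E).
    apply/idP/idP => /set_mem h; apply/mem_set; last by rewrite /E /= f0; exact: h.
    by move: h; rewrite /E /= f0.
  rewrite ge0_integralZr//.
  - apply/measurable_EFinP; apply: measurable_funM.
      by apply: measurable_natr_bool; exact: measurable_fun_ltr.
    by apply: measurableT_comp => //; exact: measurable_funM.
move=> mC; rewrite main//; congr (_ * _)%E.
have := main setT measurableT; rewrite preimage_setT probability_setT mule1 => <-.
by congr (P _); apply/seteqP; split => w //= [].
Qed.

End Memoryless.

Section Overshoot.
Context {R : realType} {n : nat}.
Variables (k : nat) (y : nat -> 'I_n -> R).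
Implicit Types r : nat -> R.

Lemma idle_time_agree r r' j v : divergent_path r ->
  (forall i, (i <= j)%N -> r i = r' i) -> (accepted k y r v <= j)%N ->
  idle_time k y r' v = idle_time k y r v.
Proof.
move=> gr rr'; have T i : (i <= j)%N -> arrival_time r' i = arrival_time r i.
  move=> ij; apply: eq_bigr => l _; rewrite rr'//.
  by rewrite (leq_trans _ ij)// -ltnS.
case: v => [_|v vj]; first by rewrite /= rr'.
have vj' : (accepted k y r v <= j)%N.
  by apply: leq_trans vj; apply: leq_accepted.
by rewrite /idle_time !(accepted_agree gr rr')// !T.
Qed.

(* If [accepted N <= j], this is the time from arrival [j] to the end of
   transmission [N]; update [j.+1] is the next accepted one when the overshoot is
   positive and at most [r j.+1]. *)
Definition overshoot j N r : R :=
  arrival_time (frozen j r) (accepted k y (frozen j r) N) + ostat k (y N) -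
  arrival_time (frozen j r) j.

Lemma frozen_eq r j i : (i <= j)%N -> frozen j r i = r i.
Proof. by rewrite /frozen => ->. Qed.

Lemma accepted_frozen r j v : divergent_path r ->
  (accepted k y (frozen j r) v <= j)%N = (accepted k y r v <= j)%N.
Proof.
move=> gr; apply/idP/idP => h.
  rewrite (accepted_agree (r := frozen j r) (j := j))//.
    exact: divergent_frozen.
  by move=> i ij; rewrite frozen_eq.
by rewrite (accepted_agree gr (j := j))// => i ij; rewrite frozen_eq.
Qed.

(** Acceptance of arrival [j.+1] becomes a comparison of [r j.+1] with a quantity computed on the
    path frozen at [j], the form that [memoryless_overshoot] handles. Positive service covers the
    case where transmission [N] starts at arrival [j] itself. *)
Lemma accepted_succ_eq r j N : divergent_path r -> 0 < ostat k (y N) ->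
  accepted k y r N.+1 = j.+1 <->
  (accepted k y (frozen j r) N <= j)%N /\ 0 < overshoot j N r <= r j.+1.
Proof.
move=> gr S0.
have fE i : (i <= j)%N -> r i = frozen j r i by move=> ij; rewrite frozen_eq.
have Tj : arrival_time (frozen j r) j = arrival_time r j by exact: arrival_time_frozen.
rewrite accepted_frozen//; split.
  move=> E; have [h1 h2 h3] := accepted_spec k y N gr.
  rewrite E in h1 h2 h3; have Nj : (accepted k y r N <= j)%N by rewrite -ltnS.
  split => //; rewrite /overshoot (accepted_agree gr fE Nj) Tj arrival_time_frozen//.
  rewrite arrival_timeS in h2; apply/andP; split; last by lra.
  rewrite subr_gt0; move: Nj; rewrite leq_eqVlt => /orP[/eqP ->|Nj].
    by rewrite ltrDl.
  by apply: h3; rewrite Nj /=.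
move=> [Nj]; rewrite /overshoot (accepted_agree gr fE Nj) Tj arrival_time_frozen//.
move=> /andP[V0 Vr]; rewrite [accepted _ _ _ N.+1]/=; apply: first_from_eq => //.
  by rewrite arrival_timeS; lra.
move=> i /andP[Ni ij]; rewrite -ltNge.
have := le_arrival_time gr (_ : (i <= j)%N); rewrite -ltnS => /(_ ij).
by lra.
Qed.

Lemma idle_time_overshoot r j N : divergent_path r ->
  accepted k y r N.+1 = j.+1 -> idle_time k y r N.+1 = r j.+1 - overshoot j N r.
Proof.
move=> gr E; have [h1 _ _] := accepted_spec k y N gr.
have Nj : (accepted k y r N <= j)%N by rewrite -ltnS -E.
have fE i : (i <= j)%N -> r i = frozen j r i by move=> ij; rewrite frozen_eq.
rewrite /idle_time E /overshoot (accepted_agree gr fE Nj) !arrival_time_frozen//.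
by rewrite arrival_timeS; ring.
Qed.

End Overshoot.

(** * Product formula for idle times and hop-2 delays *)

Section Two_hop.
Context {R : realType} {d : measure_display} {T : measurableType d}.
Variables (P : probability T R) (n k1 k2 : nat) (a : 'I_n).
Variables (X Y : nat -> 'I_n -> T -> R) (Z : nat -> T -> R).
Hypotheses (mX : forall m i, measurable_fun setT (X m i))
  (mY : forall v i, measurable_fun setT (Y v i))
  (mZ : forall j, measurable_fun setT (Z j)).
Hypotheses (k1n : (0 < k1 <= n)%N) (k2n : (0 < k2 <= n)%N).

Definition family (q : (nat * 'I_n) + (nat * 'I_n) + nat) : T -> R :=
  match q with
  | inl (inl (m, i)) => X m i
  | inl (inr (v, i)) => Y v i
  | inr j => Z j
  end.

Hypothesis indF : mutually_independent P family.

Lemma measurable_family q : measurable_fun setT (family q).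
Proof. by case: q => [[[m i]|[v i]]|j] /=. Qed.

Definition xpath (w : T) m i := X m i w.
Definition ypath (w : T) v i := Y v i w.
Definition zpath (w : T) j := Z j w.

Hypothesis ae_divergent : {ae P, forall w, divergent_path (zpath w)}.
Hypothesis ae_service_gt0 : {ae P, forall w, forall v, 0 < ostat k2 (ypath w v)}.

Variable rate : R.
Hypothesis rate0 : 0 < rate.
Hypothesis lawZ : forall j, exponential_rv P rate (Z j).

Definition hop2_index (v : nat) : set ((nat * 'I_n) + (nat * 'I_n) + nat) :=
  [set q | if q is inl (inr (v', _)) then v' = v else False].

Definition past_index (N j : nat) : set ((nat * 'I_n) + (nat * 'I_n) + nat) :=
  [set q | match q with
    | inl (inl _) => False | inl (inr (v, _)) => (v < N)%N | inr i => (i <= j)%N end].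

Definition relay_index (N : nat) : set ((nat * 'I_n) + (nat * 'I_n) + nat) :=
  [set q | match q with
    | inl (inl _) => False | inl (inr (v, _)) => (v < N)%N | inr i => True end].

Local Notation sub J := (subalg family J).

Lemma measurable_service_sub J v : (forall i, J (inl (inr (v, i)))) ->
  measurable_fun setT ((fun w => ostat k2 (ypath w v)) : sub J -> R).
Proof.
move=> Jv; apply: measurable_ostat => // i.
exact: (measurable_coord (F := family) (Jv i)).
Qed.

Lemma measurable_frozen_sub J j i : (forall l, (l <= j)%N -> J (inr l)) ->
  measurable_fun setT ((fun w => frozen j (zpath w) i) : sub J -> R).
Proof.
move=> Jj; rewrite /frozen; have [ij|_] := boolP (i <= j)%N; last exact: measurable_cst.
exact: (measurable_coord (F := family) (Jj i ij)).
Qed.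

Lemma measurable_idle_sub N v : (v <= N)%N ->
  measurable_fun setT ((fun w => idle_time k2 (ypath w) (zpath w) v) : sub (relay_index N) -> R).
Proof.
move=> vN; apply: (@measurable_idle_time _ _ _ (sub (relay_index N))).
  by move=> j; apply: (measurable_coord (F := family) (i := inr j)).
by move=> u uv; apply: measurable_service_sub => i /=; exact: leq_trans uv vN.
Qed.

Variables (U : nat -> set T) (C : nat -> set R).
Hypothesis mU : forall v, @measurable _ (sub (hop2_index v)) (U v).
Hypothesis mC : forall v, measurable (C v).

(** The idle time number [v] precedes transmission [v], hence one more idle time than
    transmissions. *)
Definition idle_event N := [set w | (forall v, (v < N)%N -> U v w) /\
  (forall v, (v <= N)%N -> C v (idle_time k2 (ypath w) (zpath w) v))].

Lemma idle_event_measurable_sub N : @measurable _ (sub (relay_index N)) (idle_event N).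
Proof.
rewrite (_ : idle_event N = (\bigcap_(v in [set v | (v < N)%N]) U v) `&`
  (\bigcap_(v in [set v | (v <= N)%N])
     (fun w => idle_time k2 (ypath w) (zpath w) v) @^-1` C v)); last first.
  by apply/seteqP; split => w [h h']; split => v /=; [exact: h|exact: h'|exact: h|exact: h'].
apply: measurableI; apply: bigcap_measurableType => v /= vN.
  by apply: subset_subalg (@mU v) => -[[//|[v' i]]|//] /= ->.
by have := measurable_idle_sub vN measurableT (@mC v); rewrite setTI.
Qed.

Lemma idle_event_measurable N : measurable (idle_event N).
Proof. exact: (subalg_measurable measurable_family (@idle_event_measurable_sub N)). Qed.

Lemma U_measurable v : measurable (U v).
Proof. exact: (subalg_measurable measurable_family (@mU v)). Qed.

Definition frozen_event N j := [set w | [/\ (forall v, (v < N.+1)%N -> U v w),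
  (forall v, (v <= N)%N -> C v (idle_time k2 (ypath w) (frozen j (zpath w)) v)) &
  (accepted k2 (ypath w) (frozen j (zpath w)) N <= j)%N]].

(** The value [-1] violates the condition [0 < f] of [memoryless_overshoot], so a single variable
    encodes both the event and the threshold. *)
Definition frozen_overshoot N j w : R :=
  if w \in frozen_event N j then overshoot k2 (ypath w) j N (zpath w) else -1.

Lemma frozen_event_measurable N j :
  @measurable _ (sub (past_index N.+1 j)) (frozen_event N j).
Proof.
have mz i := @measurable_frozen_sub (past_index N.+1 j) j i (fun l lj => lj).
have mS v : (v < N.+1)%N -> measurable_fun setT
    ((fun w => ostat k2 (ypath w v)) : sub (past_index N.+1 j) -> R).
  by move=> vN; exact: measurable_service_sub.
rewrite (_ : frozen_event N j = (\bigcap_(v in [set v | (v < N.+1)%N]) U v) `&`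
  ((\bigcap_(v in [set v | (v <= N)%N])
     (fun w => idle_time k2 (ypath w) (frozen j (zpath w)) v) @^-1` C v) `&`
   [set w | (accepted k2 (ypath w) (frozen j (zpath w)) N <= j)%N])); last first.
  apply/seteqP; split => w; first by move=> [h h' h'']; do 2 split => //.
  by move=> [h [h' h'']]; split.
apply: measurableI; [|apply: measurableI].
- apply: bigcap_measurableType => v /= vN.
  by apply: subset_subalg (@mU v) => -[[//|[v' i]]|//] /= ->.
- apply: bigcap_measurableType => v /= vN.
  have := @measurable_idle_time _ _ _ (sub (past_index N.+1 j)) k2 ypath _ mz v.
  move=> /(_ (fun u uv => mS u (ltnW (leq_trans uv vN))) measurableT _ (@mC v)).
  by rewrite setTI.
- have := @measurable_accepted _ _ _ (sub (past_index N.+1 j)) k2 ypath _ mz N.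
  move=> /(_ (fun u uv => mS u (ltnW uv))) /measurable_random_index => /(_ _ _ (fun i _ => i <= j)%N).
  by move=> h; apply: measurable_setb; apply: h => i; exact: measurable_cst.
Qed.

Lemma frozen_overshoot_measurable N j :
  measurable_fun setT (frozen_overshoot N j : sub (past_index N.+1 j) -> R).
Proof.
have mz i := @measurable_frozen_sub (past_index N.+1 j) j i (fun l lj => lj).
have mS v : (v < N.+1)%N -> measurable_fun setT
    ((fun w => ostat k2 (ypath w v)) : sub (past_index N.+1 j) -> R).
  by move=> vN; exact: measurable_service_sub.
apply: (@measurable_fun_ifT _ _ (sub (past_index N.+1 j))); last exact: measurable_cst.
  apply: (measurable_fun_bool true); rewrite setTI.
  rewrite (_ : _ @^-1` _ = frozen_event N j); first exact: frozen_event_measurable.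
  by apply/seteqP; split => w /=; [move/set_mem|move=> h; exact/mem_set].
apply: measurable_funB; last exact: (@measurable_arrival_time _ _ (sub (past_index N.+1 j))).
apply: measurable_funD; last exact: mS.
apply: (@measurable_arrival_accepted _ _ _ (sub (past_index N.+1 j))) => // u uN.
by apply: mS; exact: ltnW.
Qed.

Let acc N w := accepted k2 (ypath w) (zpath w) N.

Lemma measurable_acc N : measurable_fun setT (acc N).
Proof. by apply: measurable_accepted => // u _; apply: measurable_ostat => // i; exact: mY. Qed.

Lemma frozen_event_ae N j : {ae P, forall w,
  (idle_event N w /\ U N w) /\ acc N.+1 w = j.+1 <->
  0 < frozen_overshoot N j w <= Z j.+1 w}.
Proof.
apply: filterS2 ae_divergent ae_service_gt0 => w gz /(_ N) S0.
have E := accepted_succ_eq j gz S0; rewrite /frozen_overshoot; split.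
  move=> [[[hU hC] hN] /E [accN V]]; rewrite mem_set//; split => //.
    by move=> v; rewrite ltnS leq_eqVlt => /orP[/eqP ->//|]; exact: hU.
  move=> v vN; rewrite (@idle_time_agree _ _ _ _ (zpath w) _ j)//.
  - exact: hC.
  - by move=> i ij; rewrite frozen_eq.
  - rewrite accepted_frozen// in accN; apply: leq_trans accN.
    exact: leq_accepted.
case: ifPn => [/set_mem [hU hC accN] V|_]; last by rewrite ltNge lerN10.
have accN' := accN; rewrite accepted_frozen// in accN'.
split; last exact/E; split; last exact: hU.
split => [v vN|v vN]; first by apply: hU; exact: ltnW.
have := hC v vN; rewrite (@idle_time_agree _ _ _ _ (zpath w) _ j)//.
- by move=> i ij; rewrite frozen_eq.
- by apply: leq_trans accN'; exact: leq_accepted.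
Qed.

(** Partition by the next accepted index [j.+1]. On each piece the past reads
    [0 < frozen_overshoot N j <= Z j.+1], and the new idle time is the excess of [Z j.+1] over the
    overshoot, which is again exponential. *)
Lemma idle_event_succ N :
  P (idle_event N.+1) = (P (idle_event N `&` U N) * exponential_prob rate (C N.+1))%E.
Proof.
have EN : idle_event N.+1 = (idle_event N `&` U N) `&`
    [set w | C N.+1 (idle_time k2 (ypath w) (zpath w) N.+1)].
  apply/seteqP; split => w.
    move=> [h h']; split; last exact: h'.
    split; last exact: h.
    by split => v vN; [apply: h; exact: ltnW|apply: h'; exact: leqW].
  move=> [[[h h'] hN] hC]; split => v.
    by rewrite ltnS leq_eqVlt => /orP[/eqP ->//|]; exact: h.
  by rewrite leq_eqVlt => /orP[/eqP ->//|]; exact: h'.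
have mI : measurable [set w | C N.+1 (idle_time k2 (ypath w) (zpath w) N.+1)].
  have := @measurable_idle_time _ _ _ _ k2 ypath zpath mZ N.+1.
  move=> h; have := h _ measurableT _ (@mC N.+1); rewrite setTI; apply.
  by move=> u _; apply: measurable_ostat => // i; exact: mY.
have mA : measurable (idle_event N `&` U N).
  by apply: measurableI; [exact: idle_event_measurable|exact: U_measurable].
rewrite EN; apply: (prob_partition_mul (measurable_acc N.+1)) => //.
- by rewrite -(lawZ 0)//; exact: measure_ge0.
- rewrite -(lawZ 0)//; apply: fin_num_measure.
  by have := mZ 0 measurableT (@mC N.+1); rewrite setTI.
(* Accepted indices strictly increase along a divergent path, so the piece with index [0] is
   null. *)
case=> [|j].
  have z D : measurable D -> P (D `&` [set w | acc N.+1 w = 0%N]) = 0%E.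
    move=> mD; rewrite (@eq_prob_ae _ _ _ P _ set0) ?measure0//.
      by apply: measurableI => //; apply: measurable_nat_eq; exact: measurable_acc.
    apply: filterS ae_divergent => w gz; split => // -[_ accN].
    have : (acc N w < acc N.+1 w)%N by have [] := accepted_spec k2 (ypath w) N gz.
    by rewrite accN.
  by rewrite !z ?mul0e//; exact: measurableI.
rewrite -(lawZ j.+1)//.
have mf := @frozen_overshoot_measurable N j.
have mfT := measurable_fun_subalg measurable_family mf.
have ind A B : measurable A -> measurable B ->
    P (frozen_overshoot N j @^-1` A `&` Z j.+1 @^-1` B) =
    (P (frozen_overshoot N j @^-1` A) * P (Z j.+1 @^-1` B))%E.
  move=> mA' mB'.
  apply: (indep_subalg measurable_family indF (J := past_index N.+1 j) (J' := [set inr j.+1])).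
  - by move=> q /= h qE; move: h; rewrite qE /= ltnn.
  - by have := mf measurableT A mA'; rewrite setTI.
  - have := @measurable_coord _ _ _ family [set inr j.+1] (inr j.+1) erefl measurableT B mB'.
    by rewrite setTI.
have := memoryless_overshoot (mZ j.+1) rate0 (lawZ j.+1) mfT ind (@mC N.+1).
have mb : measurable [set w | 0 < frozen_overshoot N j w <= Z j.+1 w].
  apply: measurable_setb; apply: measurable_and; first exact: measurable_fun_ltr.
  exact: measurable_fun_ler.
have mk : measurable [set w | acc N.+1 w = j.+1].
  by apply: measurable_nat_eq; exact: measurable_acc.
rewrite (@eq_prob_ae _ _ _ P [set w | (0 < frozen_overshoot N j w <= Z j.+1 w)%R]
  ((idle_event N `&` U N) `&` [set w | acc N.+1 w = j.+1]))//; last 2 first.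
- exact: measurableI.
- by apply: filterS (frozen_event_ae N j) => w E; exact: iff_sym E.
move=> <-; apply: eq_prob_ae.
- by apply: measurableI => //; exact: measurableI.
- apply: measurableI => //.
  by have := measurable_funB (mZ j.+1) mfT measurableT (@mC N.+1); rewrite setTI.
apply: filterS2 ae_divergent (frozen_event_ae N j) => w gz [h1 h2]; split.
  move=> [[hA hC] hk]; have V := h1 (conj hA hk); split => //.
  move: V; rewrite /frozen_overshoot; case: ifPn => [_ _|_]; last by rewrite ltNge lerN10.
  have := hC : C N.+1 (idle_time k2 (ypath w) (zpath w) N.+1).
  by rewrite (idle_time_overshoot gz hk).
move=> [V hC]; have [hA hk] := h2 V; split; last exact: hk.
split; first exact: hA.
suff : C N.+1 (idle_time k2 (ypath w) (zpath w) N.+1) by [].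
rewrite (idle_time_overshoot gz hk).
by move: V hC; rewrite /frozen_overshoot; case: ifPn => // _; rewrite ltNge lerN10.
Qed.

Lemma idle_event_prob N : P (idle_event N) =
  ((\prod_(v < N) P (U v)) * (\prod_(v < N.+1) exponential_prob rate (C v)))%E.
Proof.
elim: N => [|N IH].
  rewrite big_ord0 mul1e big_ord1 -(lawZ 0)//; congr (P _).
  apply/seteqP; split => w /=; first by move=> [_ /(_ 0%N)]; exact.
  by move=> h; split => // v; rewrite leqn0 => /eqP ->.
rewrite idle_event_succ (indep_subalg measurable_family indF
  (J := relay_index N) (J' := hop2_index N)).
- by rewrite [X in _ = (X * _)%E]big_ord_recr [X in _ = (_ * X)%E]big_ord_recr /= muleACA -IH muleA.
- move=> [[p [] |[v i] vN vE]|j _ []].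
  by move: vE vN => /= ->; rewrite ltnn.
- exact: idle_event_measurable_sub.
- exact: (@mU N).
Qed.

End Two_hop.

(** * First link delays of the relayed updates *)

Section Hop1.
Context {R : realType} {d : measure_display} {T : measurableType d}.
Variables (P : probability T R) (n k1 k2 : nat) (a : 'I_n).
Variables (X Y : nat -> 'I_n -> T -> R) (Z : nat -> T -> R).
Hypotheses (mX : forall m i, measurable_fun setT (X m i))
  (mY : forall v i, measurable_fun setT (Y v i))
  (mZ : forall j, measurable_fun setT (Z j)).
Hypotheses (k1n : (0 < k1 <= n)%N) (k2n : (0 < k2 <= n)%N).
Hypothesis indF : mutually_independent P (family X Y Z).

Local Notation fam := (family X Y Z).
Local Notation sub J := (subalg fam J).
Local Notation xpath := (xpath X).
Local Notation ypath := (ypath Y).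
Local Notation zpath := (zpath Z).

Definition yz_index : set ((nat * 'I_n) + (nat * 'I_n) + nat) :=
  [set q | if q is inl (inl _) then False else True].

Definition hop1_past_index (m : nat) : set ((nat * 'I_n) + (nat * 'I_n) + nat) :=
  [set q | if q is inl (inl (i, _)) then (i < m)%N else True].

Definition hop1_index (m : nat) : set ((nat * 'I_n) + (nat * 'I_n) + nat) :=
  [set q | if q is inl (inl (i, _)) then i = m else False].

Hypothesis ae_divergent : {ae P, forall w, divergent_path (zpath w)}.
Hypothesis ae_received : {ae P, forall w, infinitely_often (received k1 a (xpath w))}.

Local Notation acc v w := (accepted k2 (ypath w) (zpath w) v).
Local Notation rec w := (received k1 a (xpath w)).

Definition relayed_delay v w := hop1_delay k1 a (xpath w) (acc v w).

(** [eta] stands for the law of a link delay conditioned on reception; the product form of [eta_rec]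
    avoids a division. *)
Variables (p : R) (eta : set R -> \bar R).
Hypothesis p_rec : forall m, P [set w | rec w m] = p%:E.
Hypothesis eta_rec : forall m D, measurable D ->
  P [set w | rec w m /\ D (X m a w)] = (p%:E * eta D)%E.
Hypothesis p_gt0 : 0 < p.

Lemma eta_ge0 D : measurable D -> (0 <= eta D)%E.
Proof.
move=> mD; have h : (0 <= p%:E * eta D)%E by rewrite -(eta_rec 0%N mD); exact: measure_ge0.
by rewrite -(pmule_rge0 _ (x := p%:E))// lte_fin.
Qed.

Lemma measurable_received m : measurable_fun setT (fun w => rec w m).
Proof. exact: (@measurable_among_earliest R n d T k1 (fun w => xpath w m) a k1n (mX m)). Qed.

Lemma eta_fin_num D : measurable D -> eta D \is a fin_num.
Proof.
move=> mD; have mE : measurable [set w | rec w 0%N /\ D (X 0%N a w)].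
  apply: measurableI.
    by apply: measurable_setb; exact: measurable_received.
  by have := mX 0%N a measurableT mD; rewrite setTI.
have h : (p%:E * eta D)%E \is a fin_num by rewrite -(eta_rec 0%N mD); exact: fin_num_measure.
move: h; rewrite ge0_fin_numE ?eta_ge0//; last first.
  by rewrite mule_ge0 ?lee_fin ?(ltW p_gt0) ?eta_ge0.
rewrite ge0_fin_numE ?eta_ge0// !ltey; apply: contraNN => /eqP ->.
by rewrite gt0_muley ?lte_fin.
Qed.

Lemma measurable_relayed_delay v : measurable_fun setT (relayed_delay v).
Proof.
apply: (@measurable_random_index _ _ _ _ (fun i w => X i a w)) => //.
apply: (@measurable_random_index _ _ _ _ (fun i w => occurrence (rec w) i)).
  by move=> i; apply: measurable_occurrence => m; exact: measurable_received.
by apply: measurable_accepted => // u _; apply: measurable_ostat => // i; exact: mY.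
Qed.

(* the analogue of [frozen] for the hop-1 delays of the cycles [m], [m.+1], ... *)
Definition xfrozen (m : nat) (x : nat -> 'I_n -> R) (i : nat) : 'I_n -> R :=
  if (i < m)%N then x i else fun=> 0.

Variables (A : set T) (D : nat -> set R).
Hypothesis mA : @measurable _ (sub yz_index) A.
Hypothesis mD : forall v, measurable (D v).

Definition hop1_event N := A `&` [set w | forall v, (v < N)%N -> D v (relayed_delay v w)].

Definition xfrozen_delay m v w :=
  xfrozen m (xpath w) (occurrence (received k1 a (xfrozen m (xpath w))) (acc v w)) a.

(** The last condition says that cycle [m], if received, carries update number [acc N w]. Unlike the
    equation for [occurrence], it does not look at cycle [m]. *)
Definition hop1_past_event N m := [set w | [/\ A w,
  forall v, (v < N)%N -> D v (xfrozen_delay m v w) &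
  acc N w = count_before (rec w) m]].

Let AT : measurable A.
Proof. exact: (subalg_measurable (measurable_family mX mY mZ) mA). Qed.

Lemma hop1_event_measurable N : measurable (hop1_event N).
Proof.
apply: measurableI => //.
rewrite (_ : [set w | _] = \bigcap_(v in [set v | (v < N)%N]) (relayed_delay v @^-1` D v)).
  apply: bigcap_measurableType => v _.
  by have := measurable_relayed_delay v measurableT (@mD v); rewrite setTI.
by apply/seteqP; split.
Qed.

Lemma measurable_count_before d' (S : measurableType d') (G : S -> pred nat) m :
  (forall i, (i < m)%N -> measurable_fun setT (G ^~ i)) ->
  measurable_fun setT (fun w => count_before (G w) m).
Proof.
elim: m => [|m IH] mG.
  by under eq_fun do rewrite /count_before big_ord0; exact: measurable_cst.
under eq_fun do rewrite count_beforeS.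
apply: (@measurable_random_index _ _ _ _ (fun i w => (i + G w m)%N)); last first.
  by apply: IH => i im; apply: mG; exact: ltnW.
move=> i; rewrite (_ : (fun w => _) = (fun w => if G w m then i.+1 else i)).
  by apply: measurable_fun_ifT => //; exact: mG.
by apply/funext => w; case: (G w m); rewrite ?addn1 ?addn0.
Qed.

Lemma measurable_nat_eqfun d' (S : measurableType d') (f g : S -> nat) :
  measurable_fun setT f -> measurable_fun setT g -> measurable [set w | f w = g w].
Proof.
move=> mf mg; rewrite (_ : [set w | _] = \bigcup_i ([set w | f w = i] `&` [set w | g w = i])).
  apply: bigcup_measurable => i _.
  by apply: measurableI; exact: measurable_nat_eq.
apply/seteqP; split => w /=; first by move=> fg; exists (f w).
by move=> [i _ [/= -> ->]].
Qed.

Lemma measurable_acc_sub v m :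
  measurable_fun setT ((fun w => acc v w) : sub (hop1_past_index m) -> nat).
Proof.
apply: (@measurable_accepted _ _ _ (sub (hop1_past_index m))).
  by move=> j; apply: (measurable_coord (F := fam) (i := inr j)).
move=> u _; apply: (@measurable_ostat _ _ _ (sub (hop1_past_index m))) => // i.
by apply: (measurable_coord (F := fam) (i := inl (inr (u, i)))).
Qed.

Lemma measurable_received_sub i m : (i < m)%N ->
  measurable_fun setT ((fun w => rec w i) : sub (hop1_past_index m) -> bool).
Proof.
move=> im; apply: (@measurable_among_earliest _ _ _ (sub (hop1_past_index m))) => // l.
by apply: (measurable_coord (F := fam) (i := inl (inl (i, l)))).
Qed.

Lemma measurable_xfrozen_delay_sub v m :
  measurable_fun setT (xfrozen_delay m v : sub (hop1_past_index m) -> R).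
Proof.
have mxf i l : measurable_fun setT
    ((fun w => xfrozen m (xpath w) i l) : sub (hop1_past_index m) -> R).
  rewrite /xfrozen; have [im|_] := boolP (i < m)%N; last exact: measurable_cst.
  by apply: (measurable_coord (F := fam) (i := inl (inl (i, l)))).
apply: (@measurable_random_index _ (sub (hop1_past_index m)) _ _
  (fun i w => xfrozen m (xpath w) i a)) => //.
apply: (@measurable_random_index _ (sub (hop1_past_index m)) _ _
  (fun i w => occurrence (received k1 a (xfrozen m (xpath w))) i)).
  move=> i; apply: (@measurable_occurrence _ (sub (hop1_past_index m))) => l.
  exact: (@measurable_among_earliest _ _ _ (sub (hop1_past_index m))).
exact: measurable_acc_sub.
Qed.

Lemma hop1_past_event_measurable_sub N m :
  @measurable _ (sub (hop1_past_index m)) (hop1_past_event N m).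
Proof.
rewrite (_ : hop1_past_event N m = A `&`
  ((\bigcap_(v in [set v | (v < N)%N]) (xfrozen_delay m v @^-1` D v)) `&`
   [set w | acc N w = count_before (rec w) m])); last first.
  by apply/seteqP; split => w [h]; [move=> h' h''|move=> [h' h'']].
apply: measurableI; last apply: measurableI.
- by apply: subset_subalg mA => -[[p'|q]|j].
- apply: bigcap_measurableType => v _.
  by have := @measurable_xfrozen_delay_sub v m measurableT _ (@mD v); rewrite setTI.
- apply: (@measurable_nat_eqfun _ (sub (hop1_past_index m))).
    exact: measurable_acc_sub.
  apply: (@measurable_count_before _ (sub (hop1_past_index m))) => i.
  exact: measurable_received_sub.
Qed.

Lemma xfrozen_delay_eq w N m v : divergent_path (zpath w) -> (v < N)%N ->
  acc N w = count_before (rec w) m -> xfrozen_delay m v w = relayed_delay v w.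
Proof.
move=> gz vN accN; have vm : (acc v w < count_before (rec w) m)%N.
  by rewrite -accN; exact: ltn_accepted.
have agree i : (i < m)%N -> rec w i = received k1 a (xfrozen m (xpath w)) i.
  by move=> im; rewrite /received /xfrozen im.
have [E lt] := occurrence_frozen agree vm.
by rewrite /xfrozen_delay /relayed_delay /hop1_delay -E /xfrozen lt.
Qed.

Lemma hop1_event_cycle N m : {ae P, forall w,
  (hop1_event N w /\ occurrence (rec w) (acc N w) = m) <->
  (hop1_past_event N m w /\ rec w m)}.
Proof.
apply: filterS2 ae_divergent ae_received => w gz io; split.
  move=> [[Aw hD] E]; have [recm cm] := occurrence_spec (acc N w) io.
  rewrite E in recm cm; split => //; split => // v vN.
  by rewrite (xfrozen_delay_eq gz vN)//; exact: hD.
move=> [[Aw hD accN] recm]; split; last exact: occurrence_eq.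
by split => // v vN; rewrite -(xfrozen_delay_eq gz vN accN); exact: hD.
Qed.

(** Partition by the source cycle [m] of the update relayed in transmission [N]. The past event is
    independent of cycle [m], which contributes [p] without the constraint [D N] and [p * eta (D N)]
    with it. *)
Lemma hop1_event_succ N : P (hop1_event N.+1) = (P (hop1_event N) * eta (D N))%E.
Proof.
have -> : hop1_event N.+1 = hop1_event N `&` (relayed_delay N @^-1` D N).
  apply/seteqP; split => w; first move=> [Aw h]; last move=> [[Aw h] hN].
    by split; [split => // v vN; apply: h; exact: ltnW|exact: h].
  by split => // v; rewrite ltnS leq_eqVlt => /orP[/eqP ->//|]; exact: h.
have mN : measurable (relayed_delay N @^-1` D N).
  by have := measurable_relayed_delay N measurableT (@mD N); rewrite setTI.
have mocc : measurable_fun setT (fun w => occurrence (rec w) (acc N w)).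
  apply: (@measurable_random_index _ _ _ _ (fun i w => occurrence (rec w) i)).
    by move=> i; apply: measurable_occurrence => m; exact: measurable_received.
  by apply: measurable_accepted => // u _; apply: measurable_ostat => // i; exact: mY.
apply: (prob_partition_mul mocc) => //.
- exact: hop1_event_measurable.
- exact: eta_ge0.
- exact: eta_fin_num.
move=> m; have mocm := measurable_nat_eq m mocc.
have mK := subalg_measurable (measurable_family mX mY mZ) (@hop1_past_event_measurable_sub N m).
have mrec : measurable [set w | rec w m] by apply: measurable_setb; exact: measurable_received.
have mXD : measurable [set w | rec w m /\ D N (X m a w)].
  by apply: measurableI => //; have := mX m a measurableT (@mD N); rewrite setTI.
have hyp q : hop1_past_index m q -> ~ hop1_index m q.
  by move: q => [[[i l] im E|q _ []]|j _ []]; move: E im => /= ->; rewrite ltnn.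
have hop1_coord l : measurable_fun setT (X m l : sub (hop1_index m) -> R).
  by apply: (measurable_coord (F := fam) (i := inl (inl (m, l)))).
have mrecS : @measurable _ (sub (hop1_index m)) [set w | rec w m].
  apply: (@measurable_setb _ (sub (hop1_index m))).
  exact: (@measurable_among_earliest _ _ _ (sub (hop1_index m))).
have mXDS : @measurable _ (sub (hop1_index m)) [set w | rec w m /\ D N (X m a w)].
  by apply: measurableI => //; have := hop1_coord a measurableT _ (@mD N); rewrite setTI.
have ind := indep_subalg (measurable_family mX mY mZ) indF hyp
  (@hop1_past_event_measurable_sub N m).
rewrite (@eq_prob_ae _ _ _ P (hop1_event N `&` _) (hop1_past_event N m `&` [set w | rec w m])); last 3 first.
- by apply: measurableI => //; exact: hop1_event_measurable.
- exact: measurableI.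
- by apply: filterS (hop1_event_cycle N m) => w; exact.
rewrite (@eq_prob_ae _ _ _ P _ (hop1_past_event N m `&` [set w | rec w m /\ D N (X m a w)])); last 3 first.
- by apply: measurableI => //; apply: measurableI => //; exact: hop1_event_measurable.
- exact: measurableI.
- apply: filterS (hop1_event_cycle N m) => w [h1 h2]; split.
    move=> [[hE hD] E]; have [hK hr] := h1 (conj hE E); split => //; split => //.
    by move: hD; rewrite /preimage /= /relayed_delay /hop1_delay E.
  move=> [hK [hr hD]]; have [hE E] := h2 (conj hK hr); split => //; split => //.
  by rewrite /preimage /= /relayed_delay /hop1_delay E.
by rewrite (ind _ mrecS) (ind _ mXDS) p_rec eta_rec// muleA.
Qed.

Lemma hop1_event_prob N : P (hop1_event N) = (P A * \prod_(v < N) eta (D v))%E.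
Proof.
elim: N => [|N IH].
  by rewrite big_ord0 mule1; congr (P _); apply/seteqP; split => [w []|w Aw].
by rewrite hop1_event_succ IH big_ord_recr /= muleA.
Qed.

End Hop1.

(** * Independence of hop-2 delays, idle times and relayed first link delays *)

Section Relay_family.
Context {R : realType} {d : measure_display} {T : measurableType d}.
Variables (P : probability T R) (n k1 k2 : nat) (a : 'I_n).
Variables (X Y : nat -> 'I_n -> T -> R) (Z : nat -> T -> R).
Hypotheses (mX : forall m i, measurable_fun setT (X m i))
  (mY : forall v i, measurable_fun setT (Y v i))
  (mZ : forall j, measurable_fun setT (Z j)).
Hypotheses (k1n : (0 < k1 <= n)%N) (k2n : (0 < k2 <= n)%N).
Hypothesis indF : mutually_independent P (family X Y Z).

Hypothesis ae_divergent : {ae P, forall w, divergent_path (zpath Z w)}.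
Hypothesis ae_service_gt0 : {ae P, forall w, forall v, 0 < ostat k2 (ypath Y w v)}.
Hypothesis ae_received : {ae P, forall w, infinitely_often (received k1 a (xpath X w))}.

Variable rate : R.
Hypothesis rate0 : 0 < rate.
Hypothesis lawZ : forall j, exponential_rv P rate (Z j).

Variables (p : R) (eta : set R -> \bar R).
Hypothesis p_rec : forall m, P [set w | received k1 a (xpath X w) m] = p%:E.
Hypothesis eta_rec : forall m D, measurable D ->
  P [set w | received k1 a (xpath X w) m /\ D (X m a w)] = (p%:E * eta D)%E.
Hypothesis p_gt0 : 0 < p.

Definition relay_idle v w := idle_time k2 (ypath Y w) (zpath Z w) v.

Local Notation relayed := (relayed_delay k1 k2 a X Y Z).

Definition relay_family (q : (nat * 'I_n) + nat + nat) : T -> R :=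
  match q with
  | inl (inl (v, i)) => Y v i
  | inl (inr v) => relay_idle v
  | inr v => relayed v
  end.

Lemma measurable_relay_idle v : measurable_fun setT (relay_idle v).
Proof.
apply: (@measurable_idle_time _ _ _ _ k2 (ypath Y) (zpath Z) mZ) => u _.
by apply: measurable_ostat => // i; exact: mY.
Qed.

Lemma measurable_relay_family q : measurable_fun setT (relay_family q).
Proof.
case: q => [[[v i]|v]|v] //=; first exact: measurable_relay_idle.
exact: measurable_relayed_delay.
Qed.

Lemma yz_subalg U C N : (forall v, @measurable _ (subalg (family X Y Z) (@hop2_index n v)) (U v)) ->
  (forall v, measurable (C v)) ->
  @measurable _ (subalg (family X Y Z) (@yz_index n)) (idle_event k2 Y Z U C N).
Proof.
move=> mU mC; have := @idle_event_measurable_sub _ _ _ n k2 X Y Z k2n U C mU mC N.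
by apply: subset_subalg => -[[[]|]|].
Qed.

Lemma relay_event_prob U C D N :
  (forall v, @measurable _ (subalg (family X Y Z) (@hop2_index n v)) (U v)) ->
  (forall v, measurable (C v)) -> (forall v, measurable (D v)) ->
  P (hop1_event k1 k2 a X Y Z (idle_event k2 Y Z U C N) D N) =
  ((\prod_(v < N) P (U v)) * (\prod_(v < N.+1) exponential_prob rate (C v)) *
   (\prod_(v < N) eta (D v)))%E.
Proof.
move=> mU mC mD; rewrite (hop1_event_prob mX mY mZ k1n k2n indF _ _ p_rec eta_rec)//.
  by rewrite (idle_event_prob mX mY mZ k2n indF _ _ rate0 lawZ).
exact: yz_subalg.
Qed.

Lemma exponential_probT : exponential_prob rate setT = 1%E.
Proof. by rewrite -(lawZ 0)// preimage_setT probability_setT. Qed.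

Lemma etaT : eta setT = 1%E.
Proof.
have E : (p%:E * eta setT = p%:E * 1)%E.
  rewrite mule1 -(eta_rec 0)// -(p_rec 0); congr (P _).
  by apply/seteqP; split => w //= [].
move: E; case: (eta setT) => [x [/(mulfI (lt0r_neq0 p_gt0)) ->]//| |].
  by rewrite gt0_muley ?lte_fin// mule1.
by rewrite gt0_muleNy ?lte_fin// mule1.
Qed.

Lemma relay_idle_law v : exponential_rv P rate (relay_idle v).
Proof.
move=> B mB; pose C u : set R := if u == v then B else setT.
have mC u : measurable (C u) by rewrite /C; case: ifP.
have -> : relay_idle v @^-1` B = idle_event k2 Y Z (fun=> setT) C v.
  apply/seteqP; split => w; last by case=> _ /(_ v (leqnn v)); rewrite /C eqxx.
  by move=> h; split => // u uv; rewrite /C; case: eqP => // ->.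
rewrite (idle_event_prob mX mY mZ k2n indF _ _ rate0 lawZ)//.
rewrite big1 ?mul1e; last by move=> i _; rewrite probability_setT.
rewrite (bigD1 ord_max)//= {1}/C eqxx big1 ?mule1// => i iv.
by rewrite /C ifN ?exponential_probT.
Qed.

Lemma relayed_delay_law v B : measurable B -> P (relayed v @^-1` B) = eta B.
Proof.
move=> mB; pose D u : set R := if u == v then B else setT.
have mD u : measurable (D u) by rewrite /D; case: ifP.
have -> : relayed v @^-1` B = hop1_event k1 k2 a X Y Z setT D v.+1.
  apply/seteqP; split => w; last by case=> _ /(_ v (ltnSn v)); rewrite /D eqxx.
  by move=> h; split => // u uv; rewrite /D; case: eqP => // ->.
rewrite (hop1_event_prob mX mY mZ k1n k2n indF _ _ p_rec eta_rec)//.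
rewrite probability_setT mul1e (bigD1 ord_max)//= {1}/D eqxx big1 ?mule1// => i iv.
by rewrite /D ifN ?etaT.
Qed.

(** A finite list of coordinates is enlarged, with [setT] as the added constraints, to all
    coordinates of the first [N] transmissions, where [relay_event_prob] gives the product. *)
Lemma relay_independent : mutually_independent P relay_family.
Proof.
move=> s B us mB; pose B' q : set R := if q \in s then B q else setT.
have mB' q : measurable (B' q) by rewrite /B'; case: ifP.
pose lev (q : (nat * 'I_n) + nat + nat) := match q with
  | inl (inl (v, i)) => v | inl (inr v) => v | inr v => v end.
have [N sN] : exists N, forall q, q \in s -> (lev q < N)%N.
  by exists (\max_(q <- s) lev q).+1 => q qs; rewrite ltnS; exact: leq_bigmax_seq.
pose U v : set T := [set w | forall i, B' (inl (inl (v, i))) (Y v i w)].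
have UE v : U v = \bigcap_(q in [set` [seq inl (inr (v, i)) | i <- enum 'I_n]])
    (family X Y Z q @^-1` (if q is inl (inr q') then B' (inl (inl q')) else setT)).
  apply/seteqP; split => w; first by move=> h q /= /mapP[i _ ->]; exact: h.
  by move=> h i; apply: (h (inl (inr (v, i)))); apply/mapP; exists i => //; rewrite mem_enum.
have mU v : @measurable _ (subalg (family X Y Z) (@hop2_index n v)) (U v).
  rewrite (_ : U v = \bigcap_(i in [set: 'I_n]) (Y v i @^-1` B' (inl (inl (v, i))))).
    apply: fin_bigcap_measurable => [|i _]; first exact: finite_finset.
    have := @measurable_coord _ _ _ (family X Y Z) (@hop2_index n v) (inl (inr (v, i))) erefl
      measurableT _ (mB' (inl (inl (v, i)))).
    by rewrite setTI.
  by apply/seteqP; split => w h i; [move=> _; exact: h|exact: (h i I)].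
have PU v : P (U v) = (\prod_(i < n) P (Y v i @^-1` B' (inl (inl (v, i)))))%E.
  rewrite UE indF; first by rewrite big_map big_enum.
    by rewrite map_inj_uniq ?enum_uniq// => i j [].
  by move=> [[?|q]|?].
rewrite (_ : \bigcap_(q in _) _ = hop1_event k1 k2 a X Y Z
    (idle_event k2 Y Z U (fun v => B' (inl (inr v))) N) (fun v => B' (inr v)) N); last first.
  apply/seteqP; split => w.
    move=> h; have h' q : B' q (relay_family q w).
      by rewrite /B'; case: ifP => // qs; exact: h.
    split; [split => v _|move=> v _].
    - by move=> i; exact: (h' (inl (inl (v, i)))).
    - exact: (h' (inl (inr v))).
    - exact: (h' (inr v)).
  move=> [[hU hC] hD] q /= qs; have BE : B q = B' q by rewrite /B' qs.
  rewrite BE; have := sN _ qs; case: q {qs BE} => [[[v i]|v]|v] /= vN.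
  - exact: hU.
  - by apply: hC; exact: ltnW.
  - exact: hD.
rewrite relay_event_prob//.
(* The idle times run up to [N] included, as in [idle_event]. *)
pose box := [seq inl (inl q) | q <- allpairs pair (iota 0 N) (enum 'I_n)] ++
  [seq inl (inr v) | v <- iota 0 N.+1] ++ [seq inr v | v <- iota 0 N]
  : seq ((nat * 'I_n) + nat + nat).
have ubox : uniq box.
  rewrite !cat_uniq !map_inj_uniq ?iota_uniq ?andbT; try by move=> ? ? [].
  rewrite allpairs_uniq ?iota_uniq ?enum_uniq//; last by move=> [? ?] [? ?].
  do ?[apply/andP; split => //]; apply/hasPn => q.
    by rewrite mem_cat => /orP[|] /mapP[v _ ->]; apply/negP => /mapP[].
  by move=> /mapP[v _ ->]; apply/negP => /mapP[].
have sbox : {subset s <= box}.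
  move=> q qs; have := sN _ qs; rewrite !mem_cat; case: q {qs} => [[[v i]|v]|v] vN; rewrite /lev in vN.
  - apply/orP; left; apply: map_f; rewrite (allpairs_f pair)// ?mem_enum//.
    by rewrite mem_iota.
  - apply/orP; right; apply/orP; left; apply: map_f.
    by rewrite mem_iota leqW.
  - apply/orP; right; apply/orP; right; apply: map_f.
    by rewrite mem_iota.
have -> : (\prod_(q <- s) P (relay_family q @^-1` B q) =
    \prod_(q <- box) P (relay_family q @^-1` B' q))%E.
  rewrite [RHS](bigID (fun q => q \in s)) /= [X in (_ * X)%E]big1 ?mule1; last first.
    by move=> q /negPf qs; rewrite /B' qs preimage_setT probability_setT.
  rewrite -[RHS]big_filter [RHS](perm_big s); last first.
    apply: uniq_perm => //; first exact: filter_uniq.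
    by move=> q; rewrite mem_filter andb_idr//; exact: sbox.
  by apply: eq_big_seq => q qs; rewrite /B' qs.
rewrite !big_cat !big_map big_allpairs -muleA; congr (_ * (_ * _))%E.
- rewrite -(big_mkord predT (fun v => P (U v))) /index_iota subn0; apply: eq_bigr => v _.
  by rewrite PU big_enum.
- rewrite -(big_mkord predT (fun v => exponential_prob rate (B' (inl (inr v))))).
  by rewrite /index_iota subn0; apply: eq_bigr => v _; rewrite relay_idle_law.
- rewrite -(big_mkord predT (fun v => eta (B' (inr v)))) /index_iota subn0.
  by apply: eq_bigr => v _; rewrite relayed_delay_law.
Qed.

End Relay_family.

(** * Receptions at the middle node *)

Section Infinitely_often.
Context {R : realType} {d : measure_display} {T : measurableType d}.
Variables (P : probability T R) (I : eqType) (F : I -> T -> R).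
Hypotheses (mF : forall i, measurable_fun setT (F i)) (indF : mutually_independent P F).
Variables (J : nat -> set I) (E : nat -> set T) (q : R).
Hypothesis J_disjoint : forall m m' i, J m i -> J m' i -> m = m'.
Hypothesis mE : forall m, @measurable _ (subalg F (J m)) (E m).
Hypothesis PE : forall m, P (E m) = q%:E.

Let avoid l N := [set w | forall m, (l <= m < l + N)%N -> E m w].

Let below N : set I := [set i | exists2 m, (m < N)%N & J m i].

Lemma avoid_measurable_sub l N :
  @measurable _ (subalg F (below (l + N)%N)) (avoid l N).
Proof.
rewrite (_ : avoid l N = \bigcap_(m in [set m | (l <= m < l + N)%N]) E m)//.
apply: bigcap_measurableType => m /= /andP[_ mN].
by apply: subset_subalg (@mE m) => i; exists m.
Qed.

Lemma avoid_prob l N : P (avoid l N) = (q ^+ N)%:E.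
Proof.
elim: N => [|N IH].
  rewrite expr0 -(probability_setT P); congr (P _); apply/seteqP; split => // w _ m.
  by rewrite addn0 => /andP[lm /(leq_ltn_trans lm)]; rewrite ltnn.
have -> : avoid l N.+1 = avoid l N `&` E (l + N)%N.
  apply/seteqP; split => w.
    move=> h; split => [m /andP[lm mN]|]; apply: h; first by rewrite lm addnS ltnS ltnW.
    by rewrite leq_addr addnS ltnS leqnn.
  move=> [h hN] m /andP[lm]; rewrite addnS ltnS leq_eqVlt => /orP[/eqP ->//|mN].
  by apply: h; rewrite lm.
rewrite (indep_subalg mF indF (J := below (l + N)%N)
    (J' := J (l + N)%N)) ?PE ?IH ?exprSr ?EFinM//.
- by move=> i [m mN Jm] Ji; rewrite (J_disjoint Jm Ji) ltnn in mN.
- exact: avoid_measurable_sub.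
Qed.

Hypothesis q_lt1 : 0 <= q < 1.

(** The events rest on disjoint coordinates and have the same probability, so [N] consecutive ones
    hold together with probability [q ^+ N], which tends to [0]. *)
Lemma ae_not_infinitely_often : {ae P, forall w, forall l, exists2 m, (l <= m)%N & ~ E m w}.
Proof.
apply/ae_foralln => l.
pose A := \bigcap_N avoid l N.
have mA N : measurable (avoid l N).
  exact: (subalg_measurable mF (@avoid_measurable_sub l N)).
exists A; split.
- exact: bigcapT_measurable.
- apply/eqP; rewrite eq_le measure_ge0 andbT; apply/lee_addgt0Pr => e e0; rewrite add0e.
  have /andP[q0 q1] := q_lt1.
  have := @cvg_expr R q; rewrite ger0_norm// => /(_ q1) /cvgr0Pnorm_lt /(_ _ e0) [N _ hN].
  apply: (@le_trans _ _ (P (avoid l N))).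
    by apply: le_measure; rewrite ?inE//; [exact: bigcapT_measurable|exact: bigcap_inf].
  rewrite avoid_prob lee_fin; apply: le_trans (ler_norm _) _; apply: ltW.
  by apply: (hN N) => /=.
- move=> w /= h N _ m /andP[lm _]; apply: contrapT => hE; apply: h.
  by exists m.
Qed.

End Infinitely_often.

Section Relay_instance.
Context {R : realType} {d : measure_display} {T : measurableType d}.
Variables (P : probability T R) (n k1 k2 : nat) (a : 'I_n).
Variables (X Y : nat -> 'I_n -> T -> R) (Z : nat -> T -> R).
Hypotheses (mX : forall m i, measurable_fun setT (X m i))
  (mY : forall v i, measurable_fun setT (Y v i))
  (mZ : forall j, measurable_fun setT (Z j)).
Hypotheses (k1n : (0 < k1 < n)%N) (k2n : (0 < k2 <= n)%N).
Hypothesis indF : mutually_independent P (family X Y Z).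
Variables (lam c lam' c' rate : R).
Hypotheses (lam0 : 0 < lam) (c0 : 0 < c) (lam'0 : 0 < lam') (c'0 : 0 < c') (rate0 : 0 < rate).
Hypotheses (lawX : forall m i, shifted_exponential P lam c (X m i))
  (lawY : forall v i, shifted_exponential P lam' c' (Y v i))
  (lawZ : forall j, exponential_rv P rate (Z j)).

Let k1n' : (0 < k1 <= n)%N.
Proof. by case/andP: k1n => -> /ltnW. Qed.

Let mF := measurable_family mX mY mZ.

Lemma hop1_sample_independent m : mutually_independent P (X m).
Proof.
have inj : injective (fun i => inl (inl (m, i)) : (nat * 'I_n) + (nat * 'I_n) + nat).
  by move=> i j [].
exact: (mutually_independent_inj inj indF).
Qed.

Lemma hop2_sample_independent v : mutually_independent P (Y v).
Proof.
have inj : injective (fun i => inl (inr (v, i)) : (nat * 'I_n) + (nat * 'I_n) + nat).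
  by move=> i j [].
exact: (mutually_independent_inj inj indF).
Qed.

Lemma ae_hop1_gt : {ae P, forall w, forall m i, c < X m i w}.
Proof. by apply/ae_foralln => m; exact: (ae_sample_gt (mX m) (lawX m) lam0). Qed.

Lemma ae_hop2_gt : {ae P, forall w, forall v i, c' < Y v i w}.
Proof. by apply/ae_foralln => v; exact: (ae_sample_gt (mY v) (lawY v) lam'0). Qed.

Lemma ae_service_gt0 : {ae P, forall w, forall v, 0 < ostat k2 (ypath Y w v)}.
Proof.
apply: filterS ae_hop2_gt => w h v; have [i ->] := ostat_mem (ypath Y w v) k2n.
exact: lt_trans (h v i).
Qed.

Lemma received_prob m : P [set w | received k1 a (xpath X w) m] = (k1%:R / n%:R)%:E.
Proof.
have mb : measurable_fun setT (fun w => received k1 a (xpath X w) m).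
  exact: measurable_received.
have := has_mean_uniq (has_mean_prob P mb)
  (among_earliest_prob (mX m) (hop1_sample_independent m) (lawX m) k1n' a).
move=> <-; rewrite fineK//; apply: fin_num_measure.
exact: measurable_setb.
Qed.

Lemma reception_prob_gt0 : 0 < k1%:R / n%:R :> R.
Proof. by case/andP: k1n => k0 kn; rewrite divr_gt0// ltr0n// (ltn_trans k0). Qed.

Lemma reception_prob_lt1 : k1%:R / n%:R < 1 :> R.
Proof.
case/andP: k1n => k0 kn; rewrite ltr_pdivrMr ?ltr0n ?(ltn_trans k0)// mul1r.
by rewrite ltr_nat.
Qed.

Lemma received_measurable_sub (m : nat) :
  measurable_fun setT ((fun w => received k1 a (xpath X w) m) :
    subalg (family X Y Z) (@hop1_index n m) -> bool).
Proof.
apply: (@measurable_among_earliest _ _ _ (subalg (family X Y Z) (@hop1_index n m))) => // l.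
by apply: (measurable_coord (F := family X Y Z) (i := inl (inl (m, l)))).
Qed.

Lemma not_received_prob m :
  P [set w | ~~ received k1 a (xpath X w) m] = (1 - k1%:R / n%:R)%:E.
Proof.
have m1 : measurable [set w | received k1 a (xpath X w) m].
  by apply: measurable_setb; exact: measurable_received.
rewrite (_ : [set w | _] = ~` [set w | received k1 a (xpath X w) m]).
  by rewrite probability_setC// received_prob.
by apply/seteqP; split => w /negP.
Qed.

Lemma not_received_measurable_sub (m : nat) :
  @measurable _ (subalg (family X Y Z) (@hop1_index n m))
    [set w | ~~ received k1 a (xpath X w) m].
Proof.
apply: (@measurable_setb _ (subalg (family X Y Z) (@hop1_index n m))).
apply: (@measurable_neg _ (subalg (family X Y Z) (@hop1_index n m))).
exact: received_measurable_sub.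
Qed.

Lemma hop1_index_disjoint m m' q : @hop1_index n m q -> hop1_index m' q -> m = m'.
Proof. by case: q => [[[i l]|]|] //= ->. Qed.

Lemma ae_received : {ae P, forall w, infinitely_often (received k1 a (xpath X w))}.
Proof.
have q01 : 0 <= (1 - k1%:R / n%:R : R) < 1.
  by have := reception_prob_gt0; have := reception_prob_lt1; move=> ? ?; apply/andP; split; lra.
have := ae_not_infinitely_often mF indF hop1_index_disjoint not_received_measurable_sub
  not_received_prob q01.
by apply: filterS => w h l; have [m lm /negP/negPn rm] := h l; exists m.
Qed.

Lemma ae_interarrival_gt0 : {ae P, forall w, forall j, 0 < Z j w}.
Proof. by apply/ae_foralln => j; exact: (ae_exponential_gt0 (mZ j) rate0 (lawZ j)). Qed.

(** Almost surely infinitely many interarrival times exceed [1], and all are positive. *)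
Lemma ae_divergent : {ae P, forall w, divergent_path (zpath Z w)}.
Proof.
pose E j := [set w | ~~ (1 < Z j w)].
have mE j : @measurable _ (subalg (family X Y Z) [set inr j]) (E j).
  apply: (@measurable_setb _ (subalg (family X Y Z) [set inr j])).
  apply: (@measurable_neg _ (subalg (family X Y Z) [set inr j])).
  apply: (@measurable_fun_ltr _ (subalg (family X Y Z) [set inr j])) => //.
  by apply: (measurable_coord (F := family X Y Z) (i := inr j)).
have PE j : P (E j) = (1 - expR (- rate * 1))%:E.
  rewrite (_ : E j = ~` (Z j @^-1` `]1, +oo[)).
    rewrite probability_setC ?(exponential_gt (mZ j) rate0 (lawZ j))//.
    by rewrite -[X in measurable X]setTI; apply: mZ => //; exact: measurable_itv.
  by apply/seteqP; split => w; rewrite /E /= in_itv /= andbT => /negP.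
have q01 : 0 <= 1 - expR (- rate * 1) < 1.
  have : expR (- rate * 1) <= expR 0 by rewrite ler_expR; have := rate0; lra.
  by rewrite expR0; have := expR_gt0 (- rate * 1); lra.
have disj j j' (q : (nat * 'I_n) + (nat * 'I_n) + nat) :
    [set inr j] q -> [set inr j'] q -> j = j'.
  by move=> /= -> [].
have := ae_not_infinitely_often mF indF disj mE PE q01.
apply: filterS2 ae_interarrival_gt0 => w Z0 hZ; split=> [j|B]; first exact/ltW/Z0.
have step K : exists m, K%:R <= arrival_time (zpath Z w) m.
  elim: K => [|K [m hm]]; first by exists 0%N; rewrite /arrival_time big_ord1 ltW// /zpath.
  have [l ml /negP/negPn Zl] := hZ m.+1; exists l.
  case: l => [//|l] in ml Zl *; rewrite arrival_timeS -natr1.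
  apply: lerD; last exact: ltW.
  apply: le_trans hm _; rewrite /arrival_time -!(big_mkord xpredT (zpath Z w)).
  rewrite [leRHS](big_cat_nat _ (n := m.+1))//= lerDl.
  by apply: sumr_ge0 => i _; rewrite ltW// /zpath.
have [m hm] := step (Num.truncn `|B|).+1; exists m; apply: le_trans hm; apply: ltW.
by rewrite (le_lt_trans (ler_norm B))// truncnS_gt.
Qed.

End Relay_instance.

(** * Conditioned means and the mean time between receptions *)

Section Conditional_mean.
Context {R : realType} {d : measure_display} {T : measurableType d}.
Variables (P : probability T R) (b : T -> bool) (f h : T -> R) (p : R).
Hypotheses (mb : measurable_fun setT b) (mf : measurable_fun setT f)
  (mh : measurable_fun setT h) (p_gt0 : 0 < p).
Hypothesis bf_h : forall D, measurable D ->
  P [set w | b w /\ D (f w)] = (p%:E * P (h @^-1` D))%E.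

(** Away from [0], the law of [b] times [f] is [p] times the law of [h]. The mass that the product
    piles up at [0] is harmless because [phi 0 = 0]. *)
Lemma has_mean_conditional (phi : R -> R) v : measurable_fun setT phi ->
  (forall t, 0 <= phi t) -> phi 0 = 0 ->
  has_mean P (fun w => phi ((b w)%:R * f w)) v -> has_mean P (fun w => phi (h w)) (p^-1 * v).
Proof.
move=> mphi phi0 phi00 [_ hv].
have mbf : measurable_fun setT (fun w => (b w)%:R * f w : R).
  by apply: measurable_funM => //; exact: measurable_natr_bool.
have mE : measurable_fun setT (EFin \o phi) by exact/measurable_EFinP.
have E0 t : (0 <= (EFin \o phi) t)%E by rewrite lee_fin.
pose Xh : {mfun T >-> R} := HB.pack h (isMeasurableFun.Build _ _ _ _ _ mh).
pose Xbf : {mfun T >-> R} :=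
  HB.pack (fun w => (b w)%:R * f w) (isMeasurableFun.Build _ _ _ _ _ mbf).
pose p' : {nonneg R} := NngNum (ltW p_gt0).
have D0 : measurable (~` [set (0 : R)]) by apply: measurableC; exact: measurable_set1.
have restr : (EFin \o phi) \_ (~` [set 0]) = EFin \o phi.
  apply/funext => t; rewrite patchE.
  by case: ifPn => // /negP; rewrite inE /= => /contrapT ->; rewrite phi00.
have E : (p%:E * \int[P]_w (phi (h w))%:E = v%:E)%E.
  rewrite -hv; transitivity (\int[mscale p' (distribution P Xh)]_t (EFin \o phi) t)%E.
    by rewrite ge0_integral_mscale// ge0_integral_distribution.
  transitivity (\int[distribution P Xbf]_t (EFin \o phi) t)%E.
    rewrite -restr -!integral_mkcond; apply: eq_measure_integral => A mA A0.
    transitivity (P [set w | b w /\ A (f w)]); first by rewrite bf_h.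
    congr (P _); apply/seteqP; split => w; rewrite /preimage /=.
      by move=> [-> ]; rewrite mul1r.
    by case: (b w) => /=; rewrite ?mul1r// mul0r => /A0; case.
  by rewrite ge0_integral_distribution.
apply: ge0_has_mean => //; first exact: measurableT_comp.
have : (\int[P]_w (phi (h w))%:E)%E != +oo%E.
  by apply/eqP => Eoo; move: E; rewrite Eoo gt0_muley ?lte_fin.
have : (0 <= \int[P]_w (phi (h w))%:E)%E by apply: integral_ge0 => w _; rewrite lee_fin.
move: E; case: (integral _ _ _) => [r| |]//= [<-] _ _.
by rewrite mulKf// gt_eqF.
Qed.

End Conditional_mean.

Section Reception_time.
Context {R : realType} {d : measure_display} {T : measurableType d}.
Variables (P : probability T R) (n k1 : nat) (a : 'I_n).
Variables (X Y : nat -> 'I_n -> T -> R) (Z : nat -> T -> R).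
Hypotheses (mX : forall m i, measurable_fun setT (X m i))
  (mY : forall v i, measurable_fun setT (Y v i))
  (mZ : forall j, measurable_fun setT (Z j)).
Hypotheses (k1n : (0 < k1 < n)%N).
Hypothesis indF : mutually_independent P (family X Y Z).
Variables (lam c : R).
Hypotheses (lam0 : 0 < lam) (c0 : 0 < c).
Hypotheses (lawX : forall m i, shifted_exponential P lam c (X m i)).

Let k1n' : (0 < k1 <= n)%N.
Proof. by case/andP: k1n => -> /ltnW. Qed.

Let mF := measurable_family mX mY mZ.
Local Notation rec w := (received k1 a (xpath X w)).
Let p : R := k1%:R / n%:R.
Let s : R := c + harmonic_tail n k1 / lam.
Let S m w := ostat k1 (xpath X w m).

(** This is the event [m < M_1]. It is decided by the cycles before [m], hence independent of
    [S m]. *)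
Let fresh m w := count_before (rec w) m == 0%N.

Let freshE m w : fresh m w <-> forall i, (i < m)%N -> ~~ rec w i.
Proof.
rewrite /fresh /count_before sum_nat_eq0; split.
  by move=> /forallP h i im; have := h (Ordinal im); rewrite /= eqb0.
by move=> h; apply/forallP => i; rewrite /= eqb0 h.
Qed.

Lemma fresh_prob m : P [set w | fresh m w] = ((1 - p) ^+ m)%:E.
Proof.
rewrite -(avoid_prob mF indF (@hop1_index_disjoint n)
  (@not_received_measurable_sub _ _ _ _ _ a X Y Z k1n) (not_received_prob a mX k1n indF lawX) 0).
congr (P _); apply/seteqP; split => w /=; rewrite freshE => h i.
  exact: (h i).
exact: (h i).
Qed.

Let measurable_S m : measurable_fun setT (S m).
Proof. by apply: measurable_ostat => // i; exact: mX. Qed.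

Let measurable_fresh m : measurable_fun setT (fresh m).
Proof.
apply: (measurable_fun_bool true); rewrite setTI.
rewrite (_ : _ @^-1` _ = [set w | count_before (rec w) m = 0%N]).
  apply: measurable_nat_eq; apply: measurable_count_before => i _.
  exact: measurable_received.
by apply/seteqP; split => w /= /eqP.
Qed.

Lemma has_mean_fresh_ostat m :
  has_mean P (fun w => (fresh m w)%:R * S m w) ((1 - p) ^+ m * s).
Proof.
have mf := has_mean_prob P (@measurable_fresh m).
rewrite fresh_prob /= in mf.
apply: (has_mean_indep mf).
  exact: (has_mean_ostat (mX m) (hop1_sample_independent indF m) (lawX m) lam0 k1n').
move=> A B mA mB; apply: (indep_subalg mF indF (J := @hop1_past_index n m) (J' := @hop1_index n m)).
- by move=> [[[i l] im E|q _ []]|j _ []]; move: E im => /= ->; rewrite ltnn.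
- have mfr : measurable_fun setT (fresh m : subalg (family X Y Z) (@hop1_past_index n m) -> bool).
    apply: (@measurable_fun_bool _ (subalg (family X Y Z) (@hop1_past_index n m)) _ _ true).
    rewrite setTI (_ : _ @^-1` _ = [set w | count_before (rec w) m = 0%N]).
      apply: (@measurable_nat_eq _ (subalg (family X Y Z) (@hop1_past_index n m))).
      apply: (@measurable_count_before _ (subalg (family X Y Z) (@hop1_past_index n m))) => i im.
      exact: measurable_received_sub.
    by apply/seteqP; split => w /= /eqP.
  have := @measurable_natr_bool R _ (subalg (family X Y Z) (@hop1_past_index n m)) _ mfr.
  by move=> /(_ measurableT A mA); rewrite setTI.
- have mS : measurable_fun setT (S m : subalg (family X Y Z) (@hop1_index n m) -> R).
    apply: (@measurable_ostat _ _ _ (subalg (family X Y Z) (@hop1_index n m))) => // l.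
    by apply: (measurable_coord (F := family X Y Z) (i := inl (inl (m, l)))).
  by have := mS measurableT B mB; rewrite setTI.
Qed.

(** Wald's identity: the reception time is the sum over all [m] of [S m] on the event [fresh m], and
    by independence the means form a geometric series of ratio [1 - p]. *)
Lemma mean_reception_time :
  ('E_P[fun w => reception_time k1 a (xpath X w)] = (p^-1 * s)%:E)%E.
Proof.
have p0 : 0 < p by exact: reception_prob_gt0.
have p1 : p < 1 by exact: reception_prob_lt1.
have S0 : {ae P, forall w, forall m, 0 < S m w}.
  apply: filterS (ae_hop1_gt mX lam0 lawX) => w h m.
  by rewrite /S; have [i ->] := ostat_mem (xpath X w m) k1n'; exact: lt_trans (h m i).
(* [S m] is positive only almost surely; the absolute value makes the terms nonnegative everywhere,
   so that sum and integral commute. *)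
pose f m w := (`|(fresh m w)%:R * S m w|)%:E.
have mf m : measurable_fun setT (f m).
  apply/measurable_EFinP; apply: measurableT_comp => //.
  exact: has_mean_measurable (has_mean_fresh_ostat m).
have intf m : (\int[P]_w f m w = ((1 - p) ^+ m * s)%:E)%E.
  have [_ <-] := has_mean_fresh_ostat m; apply: ae_eq_integral => //.
    exact/measurable_EFinP/has_mean_measurable/has_mean_fresh_ostat.
  apply: filterS S0 => w h _; congr EFin; rewrite ger0_norm// mulr_ge0//.
  exact/ltW/h.
rewrite unlock /expectation.
rewrite (ae_eq_integral (fun w => \sum_(m <oo) f m w)%E)//.
- rewrite integral_nneseries//; last by move=> m w _; rewrite lee_fin.
  under eq_eseriesr do rewrite intf.
  apply/cvg_lim => //.
  rewrite (_ : (fun N => _) = EFin \o series (geometric s (1 - p))).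
    have := @cvg_geometric_series R s (1 - p).
    rewrite ger0_norm ?subr_ge0 ?ltW// => /(_ _).
    rewrite (_ : s / (1 - (1 - p)) = p^-1 * s); last by rewrite subKr mulrC.
    by move=> h; apply: cvg_EFin; [exact: nearW|apply: h; lra].
  apply/funext => N; rewrite /= sumEFin /series /=; congr EFin.
  by apply: eq_bigr => i _; rewrite mulrC.
- apply/measurable_EFinP.
  apply: (@measurable_random_index _ _ _ _ (fun N w => \sum_(m < N) S m w)
    (fun w => (occurrence (rec w) 0).+1)).
    by move=> N; apply: measurable_sum => m.
  apply: (measurableT_comp measurable_succ).
  by apply: measurable_occurrence => m; exact: measurable_received.
- apply: ge0_emeasurable_sum => [m w _ _|m _]//; first by rewrite lee_fin.
have io := ae_received a mX mY mZ k1n indF lawX.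
apply: filterS2 io S0 => w io h _.
have [ro co] := occurrence_spec 0 io; set o := occurrence _ _ in ro co.
rewrite (@nneseries_split _ _ 0 o.+1); last by move=> m _; rewrite lee_fin.
rewrite eseries0 ?adde0; last first.
  move=> m om _; rewrite /f (_ : fresh m w = false) ?mul0r ?normr0//.
  by apply/negP => /freshE /(_ o om); rewrite ro.
rewrite add0n big_mkord sumEFin; congr EFin; rewrite /reception_time /cycles_to_reception -/o.
apply: eq_bigr => i _; rewrite (_ : fresh i w) ?mul1r ?gtr0_norm//.
rewrite /fresh -leqn0 -co leq_count_before//.
by rewrite -ltnS.
Qed.

End Reception_time.

(** * Age along a sample path *)

Section Age_path.
Context {R : realType} {n : nat}.
Variables (k1 k2 : nat) (a b : 'I_n).
Variables (x y : nat -> 'I_n -> R) (r : nat -> R).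
Hypothesis divr : divergent_path r.
Hypothesis k2n : (0 < k2 <= n)%N.
Hypothesis y_gt0 : forall v i, 0 < y v i.
Local Notation acc := (accepted k2 y r).
Hypothesis relayed_ge0 : forall v, 0 <= hop1_delay k1 a x (acc v).

Definition cycle_start v : R := arrival_time r (acc v).
Definition cycle_length v : R := ostat k2 (y v) + idle_time k2 y r v.+1.

Local Notation A := cycle_start.
Local Notation W := cycle_length.
Local Notation hh v := (hop1_delay k1 a x (acc v)).
Local Notation dl v := (delivered k2 b y v).
Local Notation dt v := (delivery_time k2 b y r v).
Local Notation stamp v := (timestamp k1 a x r (acc v)).

Lemma cycle_startS v : A v.+1 = A v + W v.
Proof. by rewrite /A /W /idle_time addrA addrC subrK. Qed.

Lemma cycle_length_gt0 v : 0 < W v.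
Proof.
have [_ h _] := accepted_spec k2 y v divr; rewrite /W /idle_time.
have [i E] := ostat_mem (y v) k2n; have := y_gt0 v i; rewrite -E; move: h; rewrite /=.
by lra.
Qed.

Lemma cycle_start0 : A 0 = r 0%N.
Proof. by rewrite /A /arrival_time /= big_ord1. Qed.

Lemma cycle_start_ge0 v : 0 <= A v.
Proof.
have [r0 _] := divr; elim: v => [|v IH]; first by rewrite cycle_start0.
by rewrite cycle_startS addr_ge0// ltW// cycle_length_gt0.
Qed.

Lemma cycle_start_le u v : (u <= v)%N -> A u <= A v.
Proof. by move=> uv; apply: le_arrival_time => //; exact: leq_accepted. Qed.

Lemma delivery_gt v : A v < dt v.
Proof. by rewrite ltrDl. Qed.

Lemma delivery_le v : dl v -> dt v <= A v.+1.
Proof.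
move=> dv; have [_ h _] := accepted_spec k2 y v divr.
by apply: le_trans h; rewrite lerD2l.
Qed.

Lemma current_stamp_latest t v : latest_delivery k2 b y r t v ->
  current_stamp k1 k2 a b x y r t = stamp v.
Proof.
move=> hv; rewrite /current_stamp; apply: xget_unique; first by exists v.
move=> _ [u hu <-].
have [uv|vu|->//] := ltngtP u v; exfalso.
  by case: hu hv => _ _ h [dv tv _]; have := h v uv dv; rewrite ltNge tv.
by case: hu hv => [du tu _] [_ _ h]; have := h u vu du; rewrite ltNge tu.
Qed.

Lemma current_stamp_none t : (forall v, ~ latest_delivery k2 b y r t v) ->
  current_stamp k1 k2 a b x y r t = 0.
Proof. by move=> h; apply: xgetPN => u [v hv]; have := h v hv. Qed.

(** The value of [current_stamp] at the start of cycle [v], in recursive form. *)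
Fixpoint start_stamp v : R :=
  if v is u.+1 then if dl u then stamp u else start_stamp u else 0.

Lemma start_stamp_cases v :
  (exists u, [/\ (u < v)%N, dl u, forall w, (u < w < v)%N -> ~~ dl w & start_stamp v = stamp u]) \/
  ((forall u, (u < v)%N -> ~~ dl u) /\ start_stamp v = 0).
Proof.
elim: v => [|v IH]; first by right.
rewrite /=; case: ifPn => [dv|dv].
  left; exists v; split => // w /andP[vw]; rewrite ltnS => wv.
  by have := leq_trans vw wv; rewrite ltnn.
case: IH => [[u [uv du h ->]]|[h ->]]; [left|right].
  exists u; split => //; first exact: leqW.
  move=> w /andP[uw]; rewrite ltnS leq_eqVlt => /orP[/eqP ->//|wv].
  by apply: h; rewrite uw.
by split => // u; rewrite ltnS leq_eqVlt => /orP[/eqP ->//|]; exact: h.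
Qed.

(** Deliveries of earlier transmissions are over when cycle [v] starts and those of later ones come
    after its end, so only transmission [v] can change the stamp. *)
Lemma current_stamp_cycle v t : A v <= t < A v.+1 ->
  current_stamp k1 k2 a b x y r t = if dl v && (dt v <= t) then stamp v else start_stamp v.
Proof.
move=> /andP[vt tv].
have later w : (v < w)%N -> t < dt w.
  move=> vw; apply: lt_trans (delivery_gt w); apply: lt_le_trans tv _.
  exact: cycle_start_le.
case: ifPn => [/andP[dv dvt]|ndv]; first by apply: current_stamp_latest; split => // w /later.
have vlate : dl v -> t < dt v by move=> dv; rewrite dv /= -ltNge in ndv.
case: (start_stamp_cases v) => [[u [uv du h ->]]|[h ->]].
  apply: current_stamp_latest; split => // [|w uw dw].
    by apply: le_trans (delivery_le du) _; apply: le_trans vt; exact: cycle_start_le.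
  have [wv|/later//|E] := ltngtP w v; last by rewrite E in dw *; exact: vlate.
  by have := h w; rewrite uw wv dw => /(_ isT).
apply: current_stamp_none => u [du ut _].
have [uv|/later|E] := ltngtP u v; last 1 first.
- by rewrite E in du ut; have := vlate du; rewrite ltNge ut.
- by have := h u uv; rewrite du.
- by rewrite ltNge ut.
Qed.

Lemma current_stamp_start t : t < A 0 -> current_stamp k1 k2 a b x y r t = 0.
Proof.
move=> t0; apply: current_stamp_none => u [_ ut _].
have := le_lt_trans ut t0; rewrite ltNge => /negP; apply.
by apply: ltW; apply: le_lt_trans (delivery_gt u); exact: cycle_start_le.
Qed.

Definition start_age v : R := A v - start_stamp v.

Lemma start_age0 : start_age 0 = A 0.
Proof. by rewrite /start_age subr0. Qed.

Lemma start_ageS v :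
  start_age v.+1 = W v + (if dl v then hh v else start_age v).
Proof.
rewrite /start_age cycle_startS /=; case: ifP => _; last by rewrite addrAC addrC.
by rewrite /timestamp -/(A v); ring.
Qed.

Lemma start_age_ge0 v : 0 <= start_age v.
Proof.
elim: v => [|v IH]; first by rewrite start_age0 cycle_start_ge0.
by rewrite start_ageS addr_ge0 ?(ltW (cycle_length_gt0 v))//; case: ifP.
Qed.

Local Notation age := (age k1 k2 a b x y r).

(** The slope 1 of the age contributes the triangle [W v ^+ 2 / 2]. Below it lies the starting age
    until the delivery and the hop-1 delay afterwards. *)
Definition cycle_area v : R := W v ^+ 2 / 2 +
  (if dl v then start_age v * y v b + (W v - y v b) * hh v else start_age v * W v).

Definition has_area (D : set R) (v : R) : Prop :=
  [/\ measurable D, measurable_fun D age, forall t, D t -> 0 <= age t &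
      (\int[lebesgue_measure]_(t in D) (age t)%:E = v%:E)%E].

Lemma has_areaU D E u v : [disjoint D & E] -> has_area D u -> has_area E v ->
  has_area (D `|` E) (u + v).
Proof.
move=> DE [mD mfD D0 iD] [mE mfE E0 iE]; split.
- exact: measurableU.
- exact/measurable_funU.
- by move=> t [/D0|/E0].
rewrite ge0_integral_setU//.
- by rewrite iD iE EFinD.
- by apply/measurable_EFinP; apply/measurable_funU.
- by move=> t [/D0|/E0]; rewrite lee_fin.
Qed.

Lemma integral_affine (s e f : R) : e <= f -> s <= e ->
  (\int[lebesgue_measure]_(t in `[e, f[) (t - s)%:E =
   (((f - s) ^+ 2 - (e - s) ^+ 2) / 2)%:E)%E.
Proof.
rewrite le_eqVlt => /orP[/eqP <- _|ef se].
  by rewrite set_itvco0 integral_set0 subrr mul0r.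
pose F (t : R) := (t - s) ^+ 2 / 2.
have dF (t : R) : is_derive t (1 : R) F (t - s).
  by apply: is_derive_eq; rewrite ?scaler0 ?addr0 ?add0r ?subr0 /GRing.scale /=; field.
have cf : continuous (fun t : R => t - s).
  by move=> t; apply: cvgB; [exact: cvg_id|exact: cvg_cst].
have cF : continuous F.
  by move=> t; apply/differentiable_continuous/derivable1_diffP; have [] := dF t.
rewrite integral_itv_bndo_bndc; last first.
  apply/measurable_EFinP/measurable_funB => //; exact: measurable_cst.
rewrite (@continuous_FTC2 _ _ F)//.
- by rewrite -EFinB; congr EFin; rewrite /F; field.
- exact: continuous_subspaceT.
- split => [t _||]; first by have [] := dF t.
    by apply: cvg_at_right_filter; exact: cF.
  by apply: cvg_at_left_filter; exact: cF.
- by move=> t _; rewrite derive1E; exact: derive_val.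
Qed.

Lemma has_area_affine s e f : e <= f -> s <= e ->
  (forall t, e <= t < f -> current_stamp k1 k2 a b x y r t = s) ->
  has_area `[e, f[%classic (((f - s) ^+ 2 - (e - s) ^+ 2) / 2).
Proof.
move=> ef se h.
have ageE t : `[e, f[%classic t -> age t = t - s.
  by rewrite /= in_itv /= => /h E; rewrite /Defs.age E.
split => //.
- apply: (@eq_measurable_fun _ _ _ _ _ (fun t : R => t - s)); first by move=> t /set_mem/ageE.
  by apply: measurable_funB => //; exact: measurable_cst.
- by move=> t Dt; rewrite ageE// subr_ge0; move: Dt; rewrite /= in_itv /= => /andP[et _]; exact: le_trans et.
rewrite -(integral_affine ef se); apply: eq_integral => t /set_mem Dt.
by rewrite ageE.
Qed.

Lemma disjoint_itv (e f g : R) : [disjoint `[e, f[%classic & `[f, g[%classic].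
Proof.
apply/disj_setPLR => t /=; rewrite !in_itv /= => /andP[_ tf] /andP[ft _].
by have := lt_le_trans tf ft; rewrite ltxx.
Qed.

Lemma has_area_cycle v : has_area `[A v, A v.+1[%classic (cycle_area v).
Proof.
have W0 := cycle_length_gt0 v; have AS := cycle_startS v.
have sA : start_stamp v <= A v by have := start_age_ge0 v; rewrite subr_ge0.
have AA : A v <= A v.+1 by rewrite AS; lra.
rewrite /cycle_area; case: ifPn => dv; last first.
  rewrite (_ : _ + _ = ((A v.+1 - start_stamp v) ^+ 2 - (A v - start_stamp v) ^+ 2) / 2).
    by apply: has_area_affine => // t tv; rewrite (current_stamp_cycle tv) (negPf dv).
  by rewrite /start_age AS; field.
have dle := delivery_le dv; have dgt := delivery_gt v.
rewrite (_ : `[A v, A v.+1[%classic = `[A v, dt v[ `|` `[dt v, A v.+1[); last first.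
  by rewrite -itv_bndbnd_setU// bnd_simp ?ltW.
rewrite (_ : _ + _ = ((dt v - start_stamp v) ^+ 2 - (A v - start_stamp v) ^+ 2) / 2 +
   ((A v.+1 - stamp v) ^+ 2 - (dt v - stamp v) ^+ 2) / 2); last first.
  by rewrite /start_age AS /timestamp /delivery_time -/(A v); field.
apply: has_areaU; first exact: disjoint_itv.
  apply: has_area_affine => //; first exact: ltW.
  move=> t /andP[At td]; rewrite (@current_stamp_cycle v) ?At ?(lt_le_trans td)//.
  by rewrite leNgt td andbF.
apply: has_area_affine => //.
  rewrite /timestamp -/(A v); apply: le_trans (ltW dgt).
  by rewrite lerBlDr lerDl.
move=> t /andP[At td]; rewrite (@current_stamp_cycle v) ?At ?dv//.
by rewrite td (le_trans (ltW dgt)).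
Qed.

(** The first term is the triangle before the first accepted arrival, when the stamp is [0]. *)
Definition total_area N : R := A 0 ^+ 2 / 2 + \sum_(v < N) cycle_area v.

Lemma has_area_start N : has_area `[0, A N[%classic (total_area N).
Proof.
elim: N => [|N IH].
  rewrite /total_area big_ord0 addr0 (_ : _ / _ = ((A 0 - 0) ^+ 2 - (0 - 0) ^+ 2) / 2).
    apply: has_area_affine => //; first exact: cycle_start_ge0.
    by move=> t /andP[_]; exact: current_stamp_start.
  by field.
rewrite /total_area big_ord_recr /= addrA.
rewrite (_ : `[0, A N.+1[%classic = `[0, A N[ `|` `[A N, A N.+1[); last first.
  rewrite -itv_bndbnd_setU// bnd_simp ?cycle_start_ge0//.
  exact: cycle_start_le.
apply: has_areaU; first exact: disjoint_itv.
- exact: IH.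
- exact: has_area_cycle.
Qed.

Lemma time_average_age_bounds N tau : 0 < tau -> A N <= tau < A N.+1 ->
  tau^-1 * total_area N <= time_average_age k1 k2 a b x y r tau <= tau^-1 * total_area N.+1.
Proof.
move=> tau0 /andP[At tA].
have [_ mN0 gN0 iN0] := has_area_start N; have [mD mN1 gN1 iN1] := has_area_start N.+1.
have sub1 : `[0, tau] `<=` `[0, A N.+1[%classic.
  by move=> t /=; rewrite !in_itv /= => /andP[-> /le_lt_trans]; exact.
have sub0 : `[0, A N[ `<=` `[0, tau]%classic.
  by move=> t /=; rewrite !in_itv /= => /andP[-> tN]; exact/ltW/(lt_le_trans tN).
have mtau : measurable_fun `[0, tau]%classic (EFin \o age).
  by apply/measurable_EFinP; exact: measurable_funS mN1.
have le0 : ((total_area N)%:E <= \int[lebesgue_measure]_(t in `[0%R, tau]) (age t)%:E)%E.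
  by rewrite -iN0; apply: ge0_subset_integral => // t /sub1/gN1; rewrite lee_fin.
have le1 : (\int[lebesgue_measure]_(t in `[0%R, tau]) (age t)%:E <= (total_area N.+1)%:E)%E.
  rewrite -iN1; apply: ge0_subset_integral => //; exact/measurable_EFinP.
rewrite /time_average_age !ler_pM2l ?invr_gt0// /Rintegral.
move: le0 le1; case: (integral _ _ _) => //= z; rewrite !lee_fin => -> ->//.
Qed.

(** As the age is nonnegative, its integral up to [tau] lies between the total areas at the two
    cycle starts around [tau]; divided by the opposite cycle starts, these areas have the same
    limit. *)
Lemma time_average_age_cvg (I w : R) : 0 < w ->
  N%:R^-1 * A N @[N --> \oo] --> w ->
  N%:R^-1 * total_area N @[N --> \oo] --> I ->
  time_average_age k1 k2 a b x y r tau @[tau --> +oo] --> I / w.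
Proof.
move=> w0 cA cI.
have A_gt0 N : 0 < A N.+1.
  by rewrite cycle_startS ltr_pwDr ?cycle_length_gt0// cycle_start_ge0.
have area_ge0 N : 0 <= total_area N.
  have [_ _ g0 i0] := has_area_start N.
  by rewrite -lee_fin -i0; apply: integral_ge0 => t /g0; rewrite lee_fin.
have ch : (fun N : nat => 1 - N.+1%:R^-1 : R) @ \oo --> (1 : R).
  by rewrite -[X in _ --> X]subr0; apply: cvgB; [exact: cvg_cst|exact: cvg_harmonic].
have cAS : N.+1%:R^-1 * A N.+1 @[N --> \oo] --> w.
  by rewrite (cvg_shiftS (fun N => N%:R^-1 * A N)).
have cIS : N.+1%:R^-1 * total_area N.+1 @[N --> \oo] --> I.
  by rewrite (cvg_shiftS (fun N => N%:R^-1 * total_area N)).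
have w_neq0 : w != 0 by rewrite gt_eqF.
(* The last factor is [N / (N + 1)]; it reconciles the two normalisations and leaves
   [total_area N / A N.+1]. The ratio [c2] is treated in the same way. *)
have c1 : (N%:R^-1 * total_area N) / (N.+1%:R^-1 * A N.+1) * (1 - N.+1%:R^-1)
    @[N --> \oo] --> I / w.
  rewrite -[I / w]mulr1; apply: cvgM => //.
  by apply: cvgM => //; exact: cvgV.
have c2 : (N.+1%:R^-1 * total_area N.+1) / (N%:R^-1 * A N) / (1 - N.+1%:R^-1)
    @[N --> \oo] --> I / w.
  have chV : (1 - N.+1%:R^-1)^-1 @[N --> \oo] --> (1 : R).
    by rewrite -[X in _ --> X]invr1; apply: cvgV => //; exact: oner_neq0.
  rewrite -[I / w]mulr1; apply: cvgM => //.
  by apply: cvgM => //; exact: cvgV.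
apply/cvgrPdist_lt => e e0.
move/cvgrPdist_lt : c1 => /(_ e e0) [N1 _ h1].
move/cvgrPdist_lt : c2 => /(_ e e0) [N2 _ h2].
have unbounded t : exists N, t < A N.
  move/cvgrPdist_lt : cAS => /(_ (w / 2)); rewrite divr_gt0// => /(_ isT) [N3 _ h3].
  pose N := (N3 + Num.truncn (`|t| / (w / 2)))%N; exists N.+1.
  have := h3 N; rewrite /= leq_addr => /(_ isT) h.
  have {}h : w / 2 < N.+1%:R^-1 * A N.+1.
    by move: h; rewrite ltr_norml => /andP[_]; move: (_ * A _) => g h; lra.
  rewrite ltr_pdivlMl// in h; apply: lt_trans h.
  rewrite -ltr_pdivrMr ?divr_gt0//; apply: le_lt_trans (_ : `|t| / (w / 2) < _).
    by rewrite ler_wpM2r ?ler_norm// invr_ge0 ltW ?divr_gt0.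
  by apply: lt_le_trans (truncnS_gt _) _; rewrite ler_nat ltnS leq_addl.
exists (A (N1 + N2).+1); split; first exact: num_real.
move=> tau /= tauA.
have tau0 : 0 < tau by exact: lt_trans tauA.
have [N [NN At tA]] : exists N, [/\ ((N1 + N2).+1 <= N)%N, A N <= tau & tau < A N.+1].
  (* The least cycle start beyond [tau] ends the cycle that contains [tau]. *)
  have [m mt hm] := ex_minnP (unbounded tau).
  have mN : ((N1 + N2).+1 < m)%N.
    by rewrite ltnNge; apply/negP => /cycle_start_le; rewrite leNgt (lt_trans tauA).
  case: m => // m in mt hm mN *; exists m; split => //.
  by rewrite leNgt; apply/negP => /hm; rewrite ltnn.
have AN0 : 0 < A N by case: N NN {At tA} => // N _; exact: A_gt0.
have N0 : N%:R != 0 :> R by rewrite pnatr_eq0; case: N NN {At tA AN0}.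
have hh1 := h1 N (leq_trans (leq_addr _ _) (ltnW NN)).
have hh2 := h2 N (leq_trans (leq_addl _ _) (ltnW NN)).
have /andP[b1 b2] := time_average_age_bounds tau0 (introT andP (conj At tA)).
have NS0 : N%:R + 1 != 0 :> R by rewrite natr1.
have A_neq0 : A N != 0 by rewrite gt_eqF.
have AS_neq0 : A N.+1 != 0 by rewrite gt_eqF.
have e1 : (N%:R^-1 * total_area N) / (N.+1%:R^-1 * A N.+1) * (1 - N.+1%:R^-1) =
    (A N.+1)^-1 * total_area N.
  rewrite -(natr1 N); move: N%:R N0 NS0 => m m0 m1; field.
  by do ?[apply/andP; split].
have e2 : (N.+1%:R^-1 * total_area N.+1) / (N%:R^-1 * A N) / (1 - N.+1%:R^-1) =
    (A N)^-1 * total_area N.+1.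
  rewrite -(natr1 N); move: N%:R N0 NS0 => m m0 m1; field.
  by rewrite addrK; do ?[apply/andP; split].
rewrite e1 e2 in hh1 hh2.
have l1 : (A N.+1)^-1 * total_area N <= tau^-1 * total_area N.
  by rewrite ler_wpM2r// lef_pV2 ?posrE// ltW.
have l2 : tau^-1 * total_area N.+1 <= (A N)^-1 * total_area N.+1.
  by rewrite ler_wpM2r// lef_pV2 ?posrE.
move: hh1 hh2; rewrite !ltr_norml => /andP[? ?] /andP[? ?].
by apply/andP; split; lra.
Qed.

End Age_path.

(** * Long-run averages over relay cycles *)

Section Blocks.
Context {R : realType} {d : measure_display} {T : measurableType d}.
Variables (P : probability T R) (J : eqType) (B : nat -> J -> T -> R) (E0 : T -> R).

(** [None] indexes the initial variable, which belongs to no block and to every past. *)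
Definition block_family (q : option (nat * J)) : T -> R :=
  if q is Some (v, j) then B v j else E0.

Definition block_past (v : nat) : set (option (nat * J)) :=
  [set q | if q is Some (u, _) then (u < v)%N else True].

Definition block_index (v : nat) : set (option (nat * J)) :=
  [set q | if q is Some (u, _) then u = v else False].

Hypothesis mE0 : measurable_fun setT E0.
Hypothesis mB : forall v j, measurable_fun setT (B v j).
Hypothesis indB : mutually_independent P block_family.
Hypothesis lawB : forall v j D, measurable D -> P (B v j @^-1` D) = P (B 0%N j @^-1` D).

Definition block v : T -> @coord_space R J := sample_map (B v).

Local Notation past v := (subalg block_family (block_past v)).

Lemma measurable_block_family q : measurable_fun setT (block_family q).
Proof. by case: q => [[v j]|] /=. Qed.

Lemma measurable_block v : measurable_fun setT (block v).
Proof. exact: measurable_sample_map. Qed.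

Lemma block_mean v (phi : @coord_space R J -> R) m : measurable_fun setT phi ->
  has_mean P (phi \o block 0) m -> has_mean P (phi \o block v) m.
Proof.
have ind u : mutually_independent P (B u).
  have inj : injective (fun j => Some (u, j) : option (nat * J)) by move=> i j [].
  exact: (mutually_independent_inj inj indB).
move=> mphi; apply: (sample_has_mean (mB 0) (mB v) (ind 0%N) (ind v)) => //.
by move=> j D mD; rewrite lawB.
Qed.

Lemma block_square_integrable v (phi : @coord_space R J -> R) : measurable_fun setT phi ->
  square_integrable P (phi \o block 0) -> square_integrable P (phi \o block v).
Proof.
move=> mphi [_ [m hm]]; split; first by apply: measurableT_comp => //; exact: measurable_block.
exists m; apply: (@block_mean v (fun x => phi x ^+ 2)) => //.
exact: measurable_funX.
Qed.

Lemma block_past_indep v (F : T -> R) (phi : @coord_space R J -> R) :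
  measurable_fun setT (F : past v -> R) -> measurable_fun setT phi ->
  forall A D, measurable A -> measurable D ->
  P (F @^-1` A `&` (phi \o block v) @^-1` D) = (P (F @^-1` A) * P ((phi \o block v) @^-1` D))%E.
Proof.
move=> mF mphi A D mA mD.
apply: (indep_subalg measurable_block_family indB (J := block_past v) (J' := block_index v)).
- by case=> [[u j] /= uv E|_ []]; rewrite E ltnn in uv.
- by have := mF measurableT A mA; rewrite setTI.
- have mb : measurable_fun setT (block v : subalg block_family (block_index v) -> @coord_space R J).
    apply: (@measurable_sample_map _ _ (subalg block_family (block_index v))) => j.
    by apply: (measurable_coord (F := block_family) (i := Some (v, j))).
  have := @measurableT_comp _ _ _ (subalg block_family (block_index v)) _ _ _ _ _ mphi mb.
  by move=> /(_ measurableT D mD); rewrite setTI.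
Qed.

Lemma measurable_past v (F : T -> R) : measurable_fun setT (F : past v -> R) ->
  measurable_fun setT F.
Proof. exact: (measurable_fun_subalg measurable_block_family). Qed.

Lemma measurable_pastS v w (F : T -> R) : (v <= w)%N ->
  measurable_fun setT (F : past v -> R) -> measurable_fun setT (F : past w -> R).
Proof.
move=> vw; apply: measurable_fun_subset_subalg => -[[u j]|] //= uv.
exact: leq_trans vw.
Qed.

Lemma measurable_block_past v (phi : @coord_space R J -> R) : measurable_fun setT phi ->
  measurable_fun setT (phi \o block v : past v.+1 -> R).
Proof.
move=> mphi; apply: (@measurableT_comp _ _ _ (past v.+1) _ _ _ _ _ mphi).
apply: (@measurable_sample_map _ _ (past v.+1)) => j.
by apply: (measurable_coord (F := block_family) (i := Some (v, j))) => /=.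
Qed.

Section Strong_law.
Variables (phi : @coord_space R J -> R) (m : R) (F : nat -> T -> R) (V : nat -> R) (C : R).
Hypothesis mphi : measurable_fun setT phi.
Hypothesis sphi : square_integrable P (phi \o block 0).
Hypothesis hphi : has_mean P (phi \o block 0) m.
Hypothesis mF : forall v, measurable_fun setT (F v : past v -> R).
Hypothesis hF : forall v, has_mean P (fun w => F v w ^+ 2) (V v).
Hypothesis VC : forall v, V v <= C.

Let psi x := phi x - m.
Let mpsi : measurable_fun setT psi.
Proof. by apply: measurable_funB => //; exact: measurable_cst. Qed.

Let sF v : square_integrable P (F v).
Proof. by split; [exact: measurable_past|exists (V v)]. Qed.

Let spsi v : square_integrable P (psi \o block v).
Proof.
by apply: square_integrableB; [exact: block_square_integrable|exact: square_integrable_cst].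
Qed.

Let hpsi v : has_mean P (psi \o block v) 0.
Proof.
by rewrite -(subrr m); apply: has_meanB; [exact: block_mean|exact: has_mean_cst].
Qed.

(** [phi (block v) - m] is centred and independent of the past of block [v], so the terms are
    orthogonal and their second moments factor into bounded quantities. *)
Theorem block_past_strong_law : {ae P, forall w,
  N%:R^-1 * \sum_(v < N) F v w * (phi (block v w) - m) @[N --> \oo] --> 0}.
Proof.
have [_ [K hK]] := spsi 0.
have hK' v : has_mean P (fun w => psi (block v w) ^+ 2) K.
  by apply: (@block_mean v (fun x => psi x ^+ 2)) => //; exact: measurable_funX.
have K0 : 0 <= K by apply: le_has_mean (has_mean_cst P 0) hK _ => w; exact: sqr_ge0.
apply: (@uncorrelated_strong_law _ _ _ P (fun v w => F v w * psi (block v w))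
  (fun v => V v * K) (C * K)).
- move=> v; apply: (@eq_has_mean _ _ _ _ (fun w => F v w ^+ 2 * psi (block v w) ^+ 2)).
    by move=> w; rewrite exprMn.
  apply: has_mean_indep => //.
  apply: (block_past_indep (phi := fun x => psi x ^+ 2)).
    by apply: measurable_funX; exact: mF.
  exact: measurable_funX.
- by move=> v; rewrite ler_wpM2r.
move=> u v uv.
apply: (@eq_has_mean _ _ _ _ (fun w => (F u w * psi (block u w) * F v w) * psi (block v w))).
  by move=> w; rewrite mulrA.
have sFu : square_integrable P (fun w => F u w * psi (block u w)).
  by apply: (square_integrable_indep (sF u) (spsi u)); exact: block_past_indep.
have [z hz] := square_integrable_has_mean_mul sFu (sF v).
rewrite -(mulr0 z); apply: (has_mean_indep hz (hpsi v)).
apply: block_past_indep => //.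
apply: (@measurable_funM _ (past v)) => //; apply: (@measurable_funM _ (past v)).
  exact: measurable_pastS (ltnW uv) (@mF u).
apply: (measurable_pastS uv); exact: measurable_block_past.
Qed.

End Strong_law.

Theorem block_strong_law (phi : @coord_space R J -> R) m : measurable_fun setT phi ->
  square_integrable P (phi \o block 0) -> has_mean P (phi \o block 0) m ->
  {ae P, forall w, N%:R^-1 * \sum_(v < N) phi (block v w) @[N --> \oo] --> m}.
Proof.
move=> mphi sphi hphi.
have := @block_past_strong_law phi m (fun _ _ => 1) (fun=> 1) 1 mphi sphi hphi.
have h1 (v : nat) : has_mean P (fun w : T => 1 ^+ 2 : R) 1.
  by rewrite -[X in has_mean _ _ X](expr1n _ 2); exact: has_mean_cst.
move=> /(_ (fun v => measurable_cst _) h1 (fun v => lexx _)); apply: filterS => w h.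
have {}h : N%:R^-1 * (\sum_(v < N) phi (block v w)) - m @[N --> \oo] --> 0.
  apply: cvg_trans h; apply: near_eq_cvg; exists 1%N => // N /= N0.
  under [in LHS]eq_bigr do rewrite mul1r.
  rewrite sumrB sumr_const card_ord -[m *+ N]mulr_natl mulrBr mulKf//.
  by rewrite pnatr_eq0 -lt0n.
rewrite -[m in X in _ --> X]add0r.
rewrite (_ : (fun N => _) = (fun N => N%:R^-1 * (\sum_(v < N) phi (block v w)) - m + m)).
  by apply: cvgD => //; exact: cvg_cst.
by apply/funext => N; rewrite subrK.
Qed.

End Blocks.

(** * Ages at the starts of cycles and their long-run averages *)

Section Start_ages.
Context {R : realType} {d : measure_display} {T : measurableType d}.
Variables (P : probability T R) (J : eqType) (B : nat -> J -> T -> R) (E0 : T -> R).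
Hypothesis mE0 : measurable_fun setT E0.
Hypothesis mB : forall v j, measurable_fun setT (B v j).
Hypothesis indB : mutually_independent P (block_family B E0).
Hypothesis lawB : forall v j D, measurable D -> P (B v j @^-1` D) = P (B 0%N j @^-1` D).

Local Notation bl := (block B).
Local Notation CS := (@coord_space R J).
Local Notation past v := (subalg (block_family B E0) (@block_past J v)).

Variables (W h y : CS -> R) (dl : CS -> bool).
Hypotheses (mW : measurable_fun setT W) (mh : measurable_fun setT h)
  (my : measurable_fun setT y) (mdl : measurable_fun setT dl).
Let dr x : R := (dl x)%:R.
(** The time in a cycle during which the age still grows from its value at the start: up to the
    delivery, or the whole cycle if there is none. *)
Definition mixed_length x := (dl x)%:R * y x + (1 - (dl x)%:R) * W x.
(** The contribution of the hop-1 delay after a delivery; it does not involve the starting age. *)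
Definition split_area x := (dl x)%:R * (W x - y x) * h x.
Local Notation U := mixed_length.
Let dh x := dr x * h x.

Fixpoint block_age v w : R :=
  if v is u.+1 then W (bl u w) + dh (bl u w) + (1 - dr (bl u w)) * block_age u w else E0 w.
Local Notation al := block_age.

Definition block_area v w : R :=
  W (bl v w) ^+ 2 / 2 + al v w * U (bl v w) + split_area (bl v w).

Variables (eW eW2 p edh eU es : R).
Hypotheses (sE0 : square_integrable P E0) (sW : square_integrable P (W \o bl 0))
  (sW2 : square_integrable P (fun w => W (bl 0 w) ^+ 2))
  (sdh : square_integrable P (dh \o bl 0)) (sU : square_integrable P (U \o bl 0))
  (ss : square_integrable P (split_area \o bl 0)).
Hypotheses (hW : has_mean P (W \o bl 0) eW) (hW2 : has_mean P (fun w => W (bl 0 w) ^+ 2) eW2)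
  (hd : has_mean P (dr \o bl 0) p) (hdh : has_mean P (dh \o bl 0) edh)
  (hU : has_mean P (U \o bl 0) eU) (hs : has_mean P (split_area \o bl 0) es).
Hypothesis p_gt0 : 0 < p.

Let mdr : measurable_fun setT dr.
Proof. exact: measurable_natr_bool. Qed.

Let mdh : measurable_fun setT dh.
Proof. exact: measurable_funM. Qed.

Let mU : measurable_fun setT U.
Proof.
apply: measurable_funD; apply: measurable_funM => //.
by apply: measurable_funB => //; exact: measurable_cst.
Qed.

Let ms : measurable_fun setT split_area.
Proof. by apply: measurable_funM => //; apply: measurable_funM => //; exact: measurable_funB. Qed.

Let L x := W x + dh x.

Let mL : measurable_fun setT L.
Proof. exact: measurable_funD. Qed.

Let sL v : square_integrable P (L \o bl v).
Proof. exact: (block_square_integrable mB indB lawB v mL (square_integrableD sW sdh)). Qed.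

Lemma block_age_past v : measurable_fun setT (al v : past v -> R).
Proof.
elim: v => [|v IH].
  by apply: (measurable_coord (F := block_family B E0) (i := None)).
apply: (@measurable_funD _ (past v.+1)).
  exact: (@measurable_block_past _ _ _ _ B E0 v _ mL).
apply: (@measurable_funM _ (past v.+1)); last exact: measurable_pastS (leqnSn v) IH.
apply: (@measurable_block_past _ _ _ _ _ _ _ (fun x => 1 - dr x)).
by apply: measurable_funB => //; exact: measurable_cst.
Qed.

Lemma measurable_block_age v : measurable_fun setT (al v).
Proof. exact: (measurable_past mE0 mB (@block_age_past v)). Qed.

Lemma block_age_square_integrable v : square_integrable P (al v).
Proof.
elim: v => [//|v IH]; apply: square_integrableD; first exact: sL.
apply: (square_integrable_le _ _ IH).
  apply: measurable_funM; last exact: measurable_block_age.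
  apply: measurable_funB; first exact: measurable_cst.
  exact: measurableT_comp (measurable_block mB v).
move=> w; rewrite normrM /dr; case: (dl _); rewrite ?subrr ?subr0 ?normr1 ?normr0 ?mul1r//.
by rewrite mul0r.
Qed.

(* With [D] the delivery indicator and [L] the part of the next age that does not
   come from the present age [A],
   [((1 - D) A + L)^2 <= (1 - D + p / 2) A^2 + (1 + 2 / p) L^2], and the factor of
   [A^2] is independent of [A] with mean [1 - p / 2 < 1]. *)
Lemma block_age_bounded : exists C, forall v, exists2 V, has_mean P (fun w => al v w ^+ 2) V & V <= C.
Proof.
have [_ [V0 hV0]] := sE0; have [_ [l hl]] := sL 0.
have V0_ge0 : 0 <= V0 by apply: le_has_mean (has_mean_cst P 0) hV0 _ => w; exact: sqr_ge0.
have l0 : 0 <= l by apply: le_has_mean (has_mean_cst P 0) hl _ => w; exact: sqr_ge0.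
pose q := 2 / p; have q0 : 0 < q by rewrite divr_gt0.
have pq : p / 2 * q = 1 by rewrite /q; field; rewrite gt_eqF.
pose K := (1 + q) * l; have K0 : 0 <= K by rewrite mulr_ge0// addr_ge0// ltW.
(* [q * K] is the fixed point of the map from [V] to [V * (1 - p / 2) + K], because [p / 2 * q = 1];
   adding [V0] covers the initial age. *)
exists (V0 + q * K); elim=> [|v [V hV VC]].
  by exists V0 => //; rewrite lerDl mulr_ge0// ltW.
have [_ [V' hV']] := block_age_square_integrable v.+1; exists V' => //.
have hl' : has_mean P (fun w => L (bl v w) ^+ 2) l.
  by apply: (@block_mean _ _ _ _ _ _ _ mB indB lawB v (fun x => L x ^+ 2)) => //; exact: measurable_funX.
pose phi x := 1 - dr x + p / 2.
have mphi : measurable_fun setT phi.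
  by apply: measurable_funD => //; apply: measurable_funB => //; exact: measurable_cst.
have hphi : has_mean P (phi \o bl v) (1 - p + p / 2).
  apply: has_meanD; last exact: has_mean_cst.
  apply: has_meanB; first exact: has_mean_cst.
  exact: (@block_mean _ _ _ _ _ _ _ mB indB lawB v dr).
have hprod : has_mean P (fun w => al v w ^+ 2 * phi (bl v w)) (V * (1 - p + p / 2)).
  apply: has_mean_indep => //.
  apply: (block_past_indep mE0 mB indB (v := v) (F := fun w => al v w ^+ 2)) => //.
  by apply: (@measurable_funX _ (past v)); exact: block_age_past.
have le_V : V' <= V * (1 - p + p / 2) + (1 + q) * l.
  apply: le_has_mean hV' (has_meanD hprod (has_meanZ (1 + q) hl')) _ => w /=.
  rewrite -/(L (bl v w)) /phi /dr; move: (L _) (al v w) => u a; case: (dl _).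
    rewrite subrr mul0r addr0 add0r; have := sqr_ge0 u; have := sqr_ge0 a; nra.
  rewrite subr0 mul1r; have : 0 <= p / 2 * (a - q * u) ^+ 2.
    by rewrite mulr_ge0 ?sqr_ge0// ltW// divr_gt0.
  have -> : p / 2 * (a - q * u) ^+ 2 =
      p / 2 * a ^+ 2 - 2 * (p / 2 * q) * a * u + (p / 2 * q) * q * u ^+ 2 by ring.
  rewrite pq; lra.
have V_ge0 : 0 <= V by apply: le_has_mean (has_mean_cst P 0) hV _ => w; exact: sqr_ge0.
have d1 : p <= 1.
  apply: le_has_mean hd (has_mean_cst P 1) _ => w /=; rewrite /dr.
  by case: (dl _); rewrite ?ler01.
apply: le_trans le_V _; have : V * (1 - p / 2) <= (V0 + q * K) * (1 - p / 2).
  by rewrite ler_wpM2r//; lra.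
have : (V0 + q * K) * (p / 2) = V0 * (p / 2) + (p / 2 * q) * K by ring.
have := mulr_ge0 V0_ge0 (ltW p_gt0); rewrite pq /K; lra.
Qed.

(** Bounded second moments make the means of [(al N w / N) ^ 2] summable. *)
Lemma block_age_sublinear : {ae P, forall w, N%:R^-1 * al N w @[N --> \oo] --> 0}.
Proof.
have [C hC] := block_age_bounded.
pose V v := s2val (cid2 (hC v)).
have hV v : has_mean P (fun w => al v w ^+ 2) (V v) := s2valP (cid2 (hC v)).
have VC v : V v <= C := s2valP' (cid2 (hC v)).
have C0 : 0 <= C.
  apply: le_trans (VC 0%N).
  by apply: le_has_mean (has_mean_cst P 0) (hV 0%N) _ => w; exact: sqr_ge0.
have := @cvg0_of_summable_means _ _ _ P (fun m w => (m.+1%:R^-1 * al m.+1 w) ^+ 2)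
  (fun m => m.+1%:R ^- 2 * V m.+1) (2 * C).
have h0 m w : 0 <= (m.+1%:R^-1 * al m.+1 w) ^+ 2 :> R by exact: sqr_ge0.
have h1 m : has_mean P (fun w => (m.+1%:R^-1 * al m.+1 w) ^+ 2) (m.+1%:R ^- 2 * V m.+1).
  have := has_meanZ (m.+1%:R ^- 2) (hV m.+1); apply: eq_has_mean => w.
  by rewrite exprMn exprVn.
have h2 N : \sum_(m < N) (m.+1%:R ^- 2 * V m.+1) <= 2 * C.
  apply: (@le_trans _ _ (\sum_(m < N) m.+1%:R ^- 2 * C)).
    by apply: ler_sum => m _; rewrite ler_wpM2l ?VC// invr_ge0 exprn_ge0.
  rewrite -mulr_suml ler_wpM2r//; case: N => [|N]; first by rewrite big_ord0.
  by apply: le_trans (sum_inv_square_le N) _; rewrite lerBlDr lerDl invr_ge0.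
move=> /(_ h0 h1 h2); apply: filterS => w hw.
rewrite -(cvg_shiftS (fun N => N%:R^-1 * al N w)).
apply/cvgr0Pnorm_lt => e e0.
move/cvgr0Pnorm_lt : hw => /(_ (e ^+ 2)); rewrite exprn_gt0// => /(_ isT).
apply: filterS => N; rewrite normrX => hN.
by move: hN; rewrite /= ltr_pXn2r ?nnegrE ?normr_ge0 ?(ltW e0).
Qed.

(** Summing the recursion of [block_age] gives the total starting age over the cycles with a
    delivery, in terms of averages that obey a strong law. *)
Lemma block_age_telescope N w :
  \sum_(v < N) dr (bl v w) * al v w =
  E0 w + \sum_(v < N) W (bl v w) + \sum_(v < N) dh (bl v w) - al N w.
Proof.
elim: N => [|N IH]; first by rewrite !big_ord0 /= !addr0 subrr.
by rewrite !big_ord_recr /= IH; ring.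
Qed.

(** Starting ages times centred block quantities average to [0]. With the delivery indicator and
    [block_age_telescope] this identifies the average age as [(eW + edh) / p]; with [U] it reduces
    the mixed term to [eU] times that average. *)
Theorem block_area_strong_law : {ae P, forall w,
  N%:R^-1 * \sum_(v < N) block_area v w @[N --> \oo] --> eW2 / 2 + eU * ((eW + edh) / p) + es}.
Proof.
have [C hC] := block_age_bounded.
pose V v := s2val (cid2 (hC v)).
have hV v : has_mean P (fun w => al v w ^+ 2) (V v) := s2valP (cid2 (hC v)).
have VC v : V v <= C := s2valP' (cid2 (hC v)).
have sd : square_integrable P (dr \o bl 0).
  apply: (square_integrable_le _ _ (square_integrable_cst P 1)).
    exact: measurableT_comp (measurable_block mB 0).
  by move=> w; rewrite /= /dr; case: (dl _); rewrite ?normr1 ?normr0 ?ler01.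
have law1 phi m := @block_strong_law _ _ _ P J B E0 mE0 mB indB lawB phi m.
have law2 phi m mphi sphi hphi := @block_past_strong_law _ _ _ P J B E0 mE0 mB indB lawB
  phi m al V C mphi sphi hphi block_age_past hV VC.
have a1 := law1 _ _ mW sW hW.
have a2 := law1 (fun x => W x ^+ 2) _ (measurable_funX 2 mW) sW2 hW2.
have a3 := law1 _ _ ms ss hs.
have a4 := law1 _ _ mdh sdh hdh.
have a5 := law2 _ _ mU sU hU.
have a6 := law2 _ _ mdr sd hd.
have a7 := block_age_sublinear.
apply: filterS2 (filterI (filterI a1 a2) (filterI a3 a4)) (filterI (filterI a5 a6) a7).
move=> w [[c1 c2] [c3 c4]] [[c5 c6] c7].
have c0 : N%:R^-1 * E0 w @[N --> \oo] --> (0 : R).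
  rewrite -[X in _ --> X](mul0r (E0 w)); apply: cvgM; last exact: cvg_cst.
  by rewrite -(cvg_shiftS (fun N : nat => N%:R^-1 : R)); exact: cvg_harmonic.
have c8 : N%:R^-1 * \sum_(v < N) al v w @[N --> \oo] --> (eW + edh) / p.
  have -> : (eW + edh) / p = p^-1 * ((0 + eW + edh - 0) - 0) by rewrite !subr0 add0r mulrC.
  rewrite (_ : (fun N => _) = (fun N : nat => p^-1 * ((N%:R^-1 * E0 w +
      N%:R^-1 * (\sum_(v < N) W (bl v w)) + N%:R^-1 * (\sum_(v < N) dh (bl v w)) -
      N%:R^-1 * al N w) - N%:R^-1 * (\sum_(v < N) al v w * (dr (bl v w) - p))))).
    apply: cvgM; first exact: cvg_cst.
    apply: cvgB => //; apply: cvgB => //; apply: cvgD => //; exact: cvgD.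
  apply/funext => N; rewrite -mulrDr -mulrDr -mulrBr -block_age_telescope -mulrBr -sumrB.
  rewrite mulrCA; congr (_ * _); rewrite mulr_sumr; apply: eq_bigr => v _.
  by field; rewrite gt_eqF.
rewrite (_ : (fun N => _) = (fun N : nat => N%:R^-1 * (\sum_(v < N) W (bl v w) ^+ 2) / 2 +
   (N%:R^-1 * (\sum_(v < N) al v w * (U (bl v w) - eU)) +
    eU * (N%:R^-1 * \sum_(v < N) al v w)) + N%:R^-1 * (\sum_(v < N) split_area (bl v w)))).
  rewrite -[eU * _ in X in _ --> X]add0r.
  apply: cvgD => //; apply: cvgD; first by apply: cvgM => //; exact: cvg_cst.
  by apply: cvgD => //; apply: cvgM => //; exact: cvg_cst.
apply/funext => N.
rewrite (_ : \sum_(v < N) block_area v w = (\sum_(v < N) W (bl v w) ^+ 2) / 2 +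
    (\sum_(v < N) al v w * (U (bl v w) - eU) + eU * \sum_(v < N) al v w) +
    \sum_(v < N) split_area (bl v w)); first by ring.
rewrite mulr_suml mulr_sumr -!big_split /=; apply: eq_bigr => v _.
by rewrite /block_area; ring.
Qed.

Theorem block_length_strong_law : {ae P, forall w,
  N%:R^-1 * (E0 w + \sum_(v < N) W (bl v w)) @[N --> \oo] --> eW}.
Proof.
have := @block_strong_law _ _ _ P J B E0 mE0 mB indB lawB _ _ mW sW hW.
apply: filterS => w c1.
have c0 : N%:R^-1 * E0 w @[N --> \oo] --> (0 : R).
  rewrite -[X in _ --> X](mul0r (E0 w)); apply: cvgM; last exact: cvg_cst.
  by rewrite -(cvg_shiftS (fun N : nat => N%:R^-1 : R)); exact: cvg_harmonic.
rewrite -[eW]add0r (_ : (fun N => _) =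
  (fun N : nat => N%:R^-1 * E0 w + N%:R^-1 * \sum_(v < N) W (bl v w))); first exact: cvgD.
by apply/funext => N; rewrite mulrDr.
Qed.

End Start_ages.

Section Exponential_moments.
Context {R : realType} {d : measure_display} {T : measurableType d}.
Variables (P : probability T R) (rate : R) (E : T -> R).
Hypotheses (mE : measurable_fun setT E) (rate0 : 0 < rate) (lawE : exponential_rv P rate E).

(** An exponential variable is a sample of size one with shift [0] and is its own order statistic,
    so the moment formulas for order statistics apply. *)
Let X (i : 'I_1) := E.

Let iX : mutually_independent P X.
Proof.
move=> [|i [|j s]] B; first by move=> _ _; rewrite big_nil -(probability_setT P);
  congr (P _); apply/seteqP; split.
- move=> _ _; rewrite big_seq1; congr (P _); apply/seteqP; split => w h.
    by apply: (h i); rewrite /= mem_seq1.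
  by move=> j /=; rewrite mem_seq1 => /eqP ->.
- by move=> /= /andP[]; rewrite (ord1 i) (ord1 j) mem_head.
Qed.

Let lawX i : shifted_exponential P rate 0 (X i).
Proof.
move=> B mB; rewrite lawE//; congr (exponential_prob _ _).
by apply/seteqP; split => t /=; rewrite add0r.
Qed.

Let ostatE w : ostat 1 (X ^~ w) = E w.
Proof. by have [i ->] := @ostat_mem R 1 1 (X ^~ w) isT. Qed.

Lemma has_mean_exponential : has_mean P E rate^-1.
Proof.
have := has_mean_ostat (fun=> mE) iX lawX rate0 (isT : (0 < 1 <= 1)%N).
rewrite add0r /harmonic_tail big_ord1 subn0 invr1 mul1r.
by apply: eq_has_mean => w; rewrite ostatE.
Qed.

Lemma has_mean_exponential2 : has_mean P (fun w => E w ^+ 2) (2 * rate^-1 ^+ 2).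
Proof.
have := has_mean_ostat2 (fun=> mE) iX lawX rate0 (isT : (0 < 1 <= 1)%N).
rewrite add0r /harmonic_tail /harmonic_tail2 !big_ord1 subn0 expr1n !invr1 !mul1r exprVn.
rewrite (_ : rate ^- 2 + rate ^- 2 = 2 * rate ^- 2); last by ring.
by apply: eq_has_mean => w; rewrite ostatE.
Qed.

Lemma square_integrable_exponential : square_integrable P E.
Proof.
have := square_integrable_ostat (fun=> mE) iX lawX rate0 (isT : (0 < 1 <= 1)%N).
apply: square_integrable_le => // w; by rewrite ostatE.
Qed.

Lemma square_integrable_exponential2 : square_integrable P (fun w => E w ^+ 2).
Proof.
have := square_integrable_ostat2 (fun=> mE) iX lawX rate0 (isT : (0 < 1 <= 1)%N).
apply: square_integrable_le => [|w]; first exact: measurable_funX.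
by rewrite ostatE.
Qed.

End Exponential_moments.

(** * The average age of the relay *)

Section Relay_age.
Context {R : realType} {d : measure_display} {T : measurableType d}.
Variables (P : probability T R) (n k1 k2 : nat) (a b : 'I_n).
Variables (X Y : nat -> 'I_n -> T -> R) (Z : nat -> T -> R).
Hypotheses (mX : forall m i, measurable_fun setT (X m i))
  (mY : forall v i, measurable_fun setT (Y v i))
  (mZ : forall j, measurable_fun setT (Z j)).
Hypotheses (k1n : (0 < k1 < n)%N) (k2n : (0 < k2 < n)%N).
Hypothesis indF : mutually_independent P (family X Y Z).
Variables (lam c lam' c' rate : R).
Hypotheses (lam0 : 0 < lam) (c0 : 0 < c) (lam'0 : 0 < lam') (c'0 : 0 < c') (rate0 : 0 < rate).
Hypotheses (lawX : forall m i, shifted_exponential P lam c (X m i))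
  (lawY : forall v i, shifted_exponential P lam' c' (Y v i))
  (lawZ : forall j, exponential_rv P rate (Z j)).

Let k1n' : (0 < k1 <= n)%N. Proof. by case/andP: k1n => -> /ltnW. Qed.
Let k2n' : (0 < k2 <= n)%N. Proof. by case/andP: k2n => -> /ltnW. Qed.

Local Notation idle := (relay_idle k2 Y Z).
Local Notation relayed := (relayed_delay k1 k2 a X Y Z).
Let p1 : R := k1%:R / n%:R.

(** The conditional law is computed in cycle [0]; equality of the laws of the cycles transports it
    to the others. *)
Let eta (D : set R) : \bar R :=
  (p1^-1%:E * P [set w | received k1 a (xpath X w) 0%N /\ D (X 0%N a w)])%E.

Let p1_gt0 : 0 < p1. Proof. exact: reception_prob_gt0. Qed.

Let eta_rec m D : measurable D ->
  P [set w | received k1 a (xpath X w) m /\ D (X m a w)] = (p1%:E * eta D)%E.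
Proof.
move=> mD; rewrite /eta muleA -EFinM divff ?gt_eqF// mul1e.
have lawXX i C : measurable C -> P (X m i @^-1` C) = P (X 0 i @^-1` C).
  by move=> mC; rewrite !lawX.
pose C : set (@coord_space R 'I_n) := [set x | among_earliest k1 x a /\ D (x a)].
apply: (sample_law_unique (mX m) (mX 0) (hop1_sample_independent indF m)
  (hop1_sample_independent indF 0) lawXX (A := C)).
apply: measurableI.
  apply: (measurable_setb (T := @coord_space R 'I_n)).
  exact: (@measurable_among_earliest R n _ (@coord_space R 'I_n) k1 (fun x => x) a k1n'
    (@measurable_coord_space R 'I_n)).
by have := @measurable_coord_space R 'I_n a measurableT D mD; rewrite setTI.
Qed.

Let p1_rec m := received_prob a mX k1n indF lawX m.

Let aeD := ae_divergent mX mY mZ indF rate0 lawZ.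
Let aeS := ae_service_gt0 mY k2n' lam'0 c'0 lawY.
Let aeR := ae_received a mX mY mZ k1n indF lawX.

Let indG := relay_independent mX mY mZ k1n' k2n' indF aeD aeS aeR rate0 lawZ p1_rec eta_rec p1_gt0.
Let mG := measurable_relay_family a mX mY mZ k1n' k2n'.

(* Block [v] consists of the hop-2 delays of transmission [v], the idle time after
   it, and the first link delay of the update that it relays. *)
Let B v (j : 'I_n + bool) : T -> R :=
  match j with inl i => Y v i | inr false => idle v.+1 | inr true => relayed v end.

(** Embeds the block coordinates injectively into the relay family, whence their independence. The
    shift of the idle times leaves [idle 0] as the initial variable. *)
Let g (q : option (nat * ('I_n + bool))) : (nat * 'I_n) + nat + nat :=
  match q with
  | None => inl (inr 0%N)
  | Some (v, inl i) => inl (inl (v, i))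
  | Some (v, inr false) => inl (inr v.+1)
  | Some (v, inr true) => inr v
  end.

Let indB : mutually_independent P (block_family B (idle 0)).
Proof.
have ginj : injective g.
  by move=> [[u [i|[]]]|] [[v [j|[]]]|] //= => [[-> ->]|[->]|[->]].
rewrite (_ : block_family _ _ = fun q => relay_family k1 k2 a X Y Z (g q)).
  exact: mutually_independent_inj ginj indG.
by apply/funext => -[[v [i|[]]]|].
Qed.

Let mB v j : measurable_fun setT (B v j).
Proof.
case: j => [i|[]] //=; first exact: measurable_relayed_delay.
exact: measurable_relay_idle.
Qed.

Let midle v : measurable_fun setT (idle v).
Proof. exact: measurable_relay_idle. Qed.

Let lawI v : exponential_rv P rate (idle v).
Proof. exact: (relay_idle_law mX mY mZ k2n' indF aeD aeS rate0 lawZ). Qed.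

Let lawH v D : measurable D -> P (relayed v @^-1` D) = eta D.
Proof.
exact: (relayed_delay_law mX mY mZ k1n' k2n' indF aeD aeR p1_rec eta_rec p1_gt0).
Qed.

Let lawB v j D : measurable D -> P (B v j @^-1` D) = P (B 0 j @^-1` D).
Proof.
move=> mD; case: j => [i|[]] /=.
- by rewrite !lawY.
- by rewrite !lawH.
- by rewrite !lawI.
Qed.

Local Notation CS := (@coord_space R ('I_n + bool)%type).
Local Notation bl := (block B).

Let S (x : CS) := ostat k2 (fun i => x (inl i)).
Let W (x : CS) := S x + x (inr false).
Let h (x : CS) := x (inr true).
Let y (x : CS) := x (inl b).
Let dl (x : CS) := among_earliest k2 (fun i => x (inl i)) b.

Let mS : measurable_fun setT S.
Proof. by apply: measurable_ostat => // i; exact: measurable_coord_space. Qed.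

Let mW : measurable_fun setT W.
Proof. by apply: measurable_funD => //; exact: measurable_coord_space. Qed.

Let mh : measurable_fun setT h.
Proof. exact: measurable_coord_space. Qed.

Let my : measurable_fun setT y.
Proof. exact: measurable_coord_space. Qed.

Let mdl : measurable_fun setT dl.
Proof. by apply: measurable_among_earliest => // i; exact: measurable_coord_space. Qed.

Let Sw w := ostat k2 (Y 0 ^~ w).
Let dw w : R := (among_earliest k2 (Y 0 ^~ w) b)%:R.
Let Iw := idle 1.
Let Hw := relayed 0.

(** Means of the service time ([m2]), the idle time ([rho]), the delivery indicator ([p2]), this
    indicator times the hop-2 delay ([edy]) and the first link delay given reception ([eh]). *)
Let m2 := c' + harmonic_tail n k2 / lam'.
Let rho := rate^-1.
Let p2 : R := k2%:R / n%:R.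
Let edy := p2 * c' + (k2%:R - (n - k2)%:R * harmonic_tail n k2) / n%:R / lam'.
Let eh := p1^-1 * (p1 * c + (k1%:R - (n - k1)%:R * harmonic_tail n k1) / n%:R / lam).

Let iY0 := hop2_sample_independent indF 0.
Let hS : has_mean P Sw m2 := has_mean_ostat (mY 0) iY0 (lawY 0) lam'0 k2n'.
Let hI : has_mean P Iw rho := has_mean_exponential (midle 1) rate0 (lawI 1).
Let sS : square_integrable P Sw := square_integrable_ostat (mY 0) iY0 (lawY 0) lam'0 k2n'.
Let sI : square_integrable P Iw := square_integrable_exponential (midle 1) rate0 (lawI 1).
Let hd : has_mean P dw p2 := among_earliest_prob (mY 0) iY0 (lawY 0) k2n' b.

Let mdw : measurable_fun setT dw.
Proof. exact: has_mean_measurable hd. Qed.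

Let relayed_cond D : measurable D ->
  P [set w | received k1 a (xpath X w) 0 /\ D (X 0 a w)] = (p1%:E * P (Hw @^-1` D))%E.
Proof. by move=> mD; rewrite lawH// eta_rec. Qed.

Let mrec0 : measurable_fun setT (fun w => received k1 a (xpath X w) 0).
Proof. exact: measurable_received. Qed.

Let ae_relayed_gt0 : {ae P, forall w, forall v, 0 < relayed v w}.
Proof. by apply: filterS (ae_hop1_gt mX lam0 lawX) => w hw v; exact: lt_trans (hw _ _). Qed.

Let iX0 := hop1_sample_independent indF 0.

Let hH : has_mean P Hw eh.
Proof.
have h1 := has_mean_among_delay (mX 0) iX0 (lawX 0) lam0 c0 k1n' a.
have h2 : has_mean P (fun w => `|(received k1 a (xpath X w) 0)%:R * X 0 a w|)
    (p1 * c + (k1%:R - (n - k1)%:R * harmonic_tail n k1) / n%:R / lam).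
  apply: has_mean_ae h1.
    apply: measurableT_comp => //; apply: measurable_funM => //.
    exact: measurable_natr_bool.
  apply: filterS (ae_hop1_gt mX lam0 lawX) => w hw; rewrite ger0_norm//.
  by rewrite mulr_ge0// ltW// (lt_trans c0 (hw _ _)).
have := has_mean_conditional mrec0 (mX 0 a) _ p1_gt0 relayed_cond _ _ _ h2.
move=> /(_ (measurable_relayed_delay a mX mY mZ k1n' k2n' 0)).
move=> /(_ (measurableT_comp (@normr_measurable _ _) (@measurable_id _ _ _))).
move=> /(_ (fun t => normr_ge0 t) (normr0 _)); apply: has_mean_ae.
  exact: measurable_relayed_delay.
by apply: filterS ae_relayed_gt0 => w hw; rewrite ger0_norm// ltW// /Hw.
Qed.

Let sH : square_integrable P Hw.
Proof.
split; first exact: measurable_relayed_delay.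
have [_ [v hv]] := square_integrable_among_delay (mX 0) iX0 (lawX 0) lam0 c0 k1n' a.
exists (p1^-1 * v).
apply: (@has_mean_conditional _ _ _ P _ _ _ _ mrec0 (mX 0 a) _ p1_gt0 relayed_cond
  (fun t => t ^+ 2)) => //.
- exact: measurable_relayed_delay.
- by move=> t; exact: sqr_ge0.
- by rewrite expr0n.
Qed.

Let relay_indep (J J' : set ((nat * 'I_n) + nat + nat)) (f f' : T -> R) :
  (forall q, J q -> ~ J' q) ->
  measurable_fun setT (f : subalg (relay_family k1 k2 a X Y Z) J -> R) ->
  measurable_fun setT (f' : subalg (relay_family k1 k2 a X Y Z) J' -> R) ->
  forall A D, measurable A -> measurable D ->
    P (f @^-1` A `&` f' @^-1` D) = (P (f @^-1` A) * P (f' @^-1` D))%E.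
Proof.
move=> JJ' mf mf' A D mA mD; apply: (indep_subalg mG indG JJ').
  by have := mf measurableT A mA; rewrite setTI.
by have := mf' measurableT D mD; rewrite setTI.
Qed.

Let JY : set ((nat * 'I_n) + nat + nat) := [set q | if q is inl (inl _) then True else False].
Let JI : set ((nat * 'I_n) + nat + nat) := [set q | if q is inl (inr _) then True else False].
Let JYI : set ((nat * 'I_n) + nat + nat) := [set q | if q is inl _ then True else False].
Let JH : set ((nat * 'I_n) + nat + nat) := [set q | if q is inr _ then True else False].

Local Notation sub J := (subalg (relay_family k1 k2 a X Y Z) J).

Let Y_sub J i : J (inl (inl (0%N, i))) -> measurable_fun setT (Y 0 i : sub J -> R).
Proof. exact: (measurable_coord (F := relay_family k1 k2 a X Y Z)). Qed.

Let S_sub J : JY `<=` J -> measurable_fun setT (Sw : sub J -> R).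
Proof. by move=> JJ; apply: (@measurable_ostat _ _ _ (sub J)) => // i; apply: Y_sub; exact: JJ. Qed.

Let d_sub J : JY `<=` J -> measurable_fun setT (dw : sub J -> R).
Proof.
move=> JJ; apply: (@measurable_natr_bool _ _ (sub J)).
by apply: (@measurable_among_earliest _ _ _ (sub J)) => // i; apply: Y_sub; exact: JJ.
Qed.

Let I_sub J : JI `<=` J -> measurable_fun setT (Iw : sub J -> R).
Proof. by move=> JJ; apply: (measurable_coord (F := relay_family k1 k2 a X Y Z) (i := inl (inr 1%N))); exact: JJ. Qed.

Let H_sub : measurable_fun setT (Hw : sub JH -> R).
Proof. exact: (measurable_coord (F := relay_family k1 k2 a X Y Z) (i := inr 0%N)). Qed.

Let Y_I q : JY q -> ~ JI q. Proof. by case: q => [[?|?]|?]; rewrite /JY /JI /=; tauto. Qed.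
Let YI_H q : JYI q -> ~ JH q. Proof. by case: q => [?|?]; rewrite /JYI /JH /=; tauto. Qed.
Let YYI : JY `<=` JYI. Proof. by case=> [[?|?]|?]. Qed.
Let IYI : JI `<=` JYI. Proof. by case=> [[?|?]|?]. Qed.

Let eW := m2 + rho.
Let eW2 := m2 ^+ 2 + harmonic_tail2 n k2 / lam' ^+ 2 + 2 * (m2 * rho) + 2 * rho ^+ 2.

Let hW : has_mean P (W \o bl 0) eW. Proof. exact: (has_meanD hS hI). Qed.

Let sW : square_integrable P (W \o bl 0). Proof. exact: (square_integrableD sS sI). Qed.

Let hW2 : has_mean P (fun w => W (bl 0 w) ^+ 2) eW2.
Proof.
have h1 := has_mean_ostat2 (mY 0) iY0 (lawY 0) lam'0 k2n'.
have h2 := has_mean_exponential2 (midle 1) rate0 (lawI 1).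
have h3 : has_mean P (fun w => Sw w * Iw w) (m2 * rho).
  apply: has_mean_indep => //; apply: (relay_indep Y_I); first exact: S_sub.
  exact: I_sub.
have := has_meanD (has_meanD h1 (has_meanZ 2 h3)) h2; apply: eq_has_mean => w.
by change (Sw w ^+ 2 + 2 * (Sw w * Iw w) + Iw w ^+ 2 = (Sw w + Iw w) ^+ 2); ring.
Qed.

Let sW2 : square_integrable P (fun w => W (bl 0 w) ^+ 2).
Proof.
have s1 := square_integrable_ostat2 (mY 0) iY0 (lawY 0) lam'0 k2n'.
have s2 := square_integrable_exponential2 (midle 1) rate0 (lawI 1).
apply: square_integrable_le (square_integrableD (square_integrableZ 2 s1) (square_integrableZ 2 s2)).
  exact: has_mean_measurable hW2.
move=> w; change (`|(Sw w + Iw w) ^+ 2| <= `|2 * Sw w ^+ 2 + 2 * Iw w ^+ 2|).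
rewrite ger0_norm ?sqr_ge0// ger0_norm; last by rewrite addr_ge0// mulr_ge0// sqr_ge0.
by move: (Sw w) (Iw w) => u v; have := sqr_ge0 (u - v); nra.
Qed.

Let sdS : square_integrable P (fun w => dw w * W (bl 0 w)).
Proof.
apply: square_integrable_le sW; first by apply: measurable_funM => //; exact: has_mean_measurable hW.
by move=> w; rewrite /dw normrM; case: (among_earliest _ _ _); rewrite ?normr0 ?normr1 ?mul1r ?mul0r.
Qed.

Let hdW : has_mean P (fun w => dw w * W (bl 0 w)) (p2 * eW).
Proof.
have h1 := has_mean_among_ostat (mY 0) iY0 (lawY 0) lam'0 k2n' b.
have h2 : has_mean P (fun w => dw w * Iw w) (p2 * rho).
  apply: has_mean_indep => //; apply: (relay_indep Y_I); first exact: d_sub.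
  exact: I_sub.
rewrite mulrDr; have := has_meanD h1 h2; apply: eq_has_mean => w.
by rewrite -mulrDr.
Qed.

Let hdy : has_mean P (fun w => dw w * Y 0 b w) edy :=
  has_mean_among_delay (mY 0) iY0 (lawY 0) lam'0 c'0 k2n' b.
Let sdy : square_integrable P (fun w => dw w * Y 0 b w) :=
  square_integrable_among_delay (mY 0) iY0 (lawY 0) lam'0 c'0 k2n' b.

Let hU : has_mean P (mixed_length W y dl \o bl 0) (edy + (eW - p2 * eW)).
Proof.
have := has_meanD hdy (has_meanB hW hdW); apply: eq_has_mean => w.
by rewrite /mixed_length /= mulrBl mul1r.
Qed.

Let sU : square_integrable P (mixed_length W y dl \o bl 0).
Proof.
have [mf [v hv]] := square_integrableD sdy (square_integrableB sW sdS).
by apply: square_integrable_ae (conj mf (ex_intro _ v hv)); [exact: has_mean_measurable hU|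
  apply: nearW => w; rewrite /mixed_length /= mulrBl mul1r].
Qed.

Let dWy_sub : measurable_fun setT ((fun w => dw w * (W (bl 0 w) - Y 0 b w)) : sub JYI -> R).
Proof.
apply: (@measurable_funM _ (sub JYI)); first exact: d_sub.
apply: (@measurable_funB _ (sub JYI)); last exact: Y_sub.
by apply: (@measurable_funD _ (sub JYI)); [exact: S_sub|exact: I_sub].
Qed.

Let hdWy : has_mean P (fun w => dw w * (W (bl 0 w) - Y 0 b w)) (p2 * eW - edy).
Proof. by have := has_meanB hdW hdy; apply: eq_has_mean => w; rewrite mulrBr. Qed.

Let hs : has_mean P (split_area W h y dl \o bl 0) ((p2 * eW - edy) * eh).
Proof.
by apply: has_mean_indep hdWy hH _; exact: relay_indep YI_H dWy_sub H_sub.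
Qed.

Let ss : square_integrable P (split_area W h y dl \o bl 0).
Proof.
have s1 : square_integrable P (fun w => dw w * (W (bl 0 w) - Y 0 b w)).
  apply: square_integrable_ae (square_integrableB sdS sdy).
    exact: has_mean_measurable hdWy.
  by apply: nearW => w; rewrite mulrBr.
by apply: square_integrable_indep s1 sH _; exact: relay_indep YI_H dWy_sub H_sub.
Qed.

Let d_H := relay_indep YI_H (d_sub YYI) H_sub.

Let hdh : has_mean P (fun w => dw w * Hw w) (p2 * eh).
Proof. exact: has_mean_indep hd hH d_H. Qed.

Let sdh : square_integrable P (fun w => dw w * Hw w).
Proof.
apply: square_integrable_le sH; first exact: has_mean_measurable hdh.
by move=> w; rewrite /dw normrM; case: (among_earliest _ _ _); rewrite ?normr0 ?normr1 ?mul1r ?mul0r.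
Qed.

Let p2_gt0 : 0 < p2. Proof. exact: reception_prob_gt0. Qed.

Let sE0 : square_integrable P (idle 0) := square_integrable_exponential (midle 0) rate0 (lawI 0).

Let ae_area := block_area_strong_law (midle 0) mB indB lawB mW mh my mdl sE0 sW sW2 sdh sU ss
  hW hW2 hd hdh hU hs p2_gt0.
Let ae_length := block_length_strong_law (midle 0) mB indB lawB mW sW hW.

Let harmonic_tail_ge0 k : 0 <= harmonic_tail n k :> R.
Proof. by apply: sumr_ge0 => j _; rewrite invr_ge0. Qed.

Let eW_gt0 : 0 < eW.
Proof.
have hm := divr_ge0 (harmonic_tail_ge0 k2) (ltW lam'0).
have r0 : 0 < rate^-1 by rewrite invr_gt0.
rewrite /eW /m2; apply: addr_gt0 r0; apply: lt_le_trans c'0 _.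
by rewrite lerDl.
Qed.

(** Cycle lengths, starting ages and areas of a sample path satisfy the recursions of the block
    quantities, so the strong laws provide the limits that [time_average_age_cvg] needs. *)
Lemma relay_age_cvg : {ae P, forall w,
  time_average_age k1 k2 a b (xpath X w) (ypath Y w) (zpath Z w) tau @[tau --> +oo] -->
  (eW2 / 2 + (edy + (eW - p2 * eW)) * ((eW + p2 * eh) / p2) + (p2 * eW - edy) * eh) / eW}.
Proof.
apply: filterS2 (filterI ae_area ae_length)
  (filterI aeD (filterI (ae_hop2_gt mY lam'0 lawY) ae_relayed_gt0)) => w [cA cL] [gz [y0 r0]].
have y_gt0 v i : 0 < ypath Y w v i by exact: lt_trans (y0 v i).
have relayed_ge0 v : 0 <= hop1_delay k1 a (xpath X w) (accepted k2 (ypath Y w) (zpath Z w) v).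
  exact/ltW/r0.
have lenE v : cycle_length k2 (ypath Y w) (zpath Z w) v = W (bl v w) by [].
have startE N : cycle_start k2 (ypath Y w) (zpath Z w) N =
    idle 0 w + \sum_(v < N) W (bl v w).
  elim: N => [|N IH]; first by rewrite big_ord0 addr0 cycle_start0.
  by rewrite cycle_startS IH [in RHS]big_ord_recr -[LHS]addrA.
have ageE v : start_age k1 k2 a b (xpath X w) (ypath Y w) (zpath Z w) v =
    block_age B (idle 0) W h dl v w.
  elim: v => [|v IH]; first by rewrite start_age0 cycle_start0.
  rewrite start_ageS lenE IH.
  have -> : block_age B (idle 0) W h dl v.+1 w = W (bl v w) +
      (dl (bl v w))%:R * h (bl v w) + (1 - (dl (bl v w))%:R) * block_age B (idle 0) W h dl v w by [].
  rewrite -[RHS]addrA; congr (_ + _).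
  have -> : dl (bl v w) = delivered k2 b (ypath Y w) v by [].
  by case: (delivered _ _ _ _); rewrite ?mul1r ?mul0r ?subrr ?subr0 ?mul0r ?addr0 ?add0r ?mul1r.
have areaE v : cycle_area k1 k2 a b (xpath X w) (ypath Y w) (zpath Z w) v =
    block_area B (idle 0) W h y dl v w.
  rewrite /cycle_area ageE lenE /block_area /mixed_length /split_area.
  have -> : ypath Y w v b = y (bl v w) by [].
  have -> : hop1_delay k1 a (xpath X w) (accepted k2 (ypath Y w) (zpath Z w) v) =
    h (bl v w) by [].
  have -> : dl (bl v w) = delivered k2 b (ypath Y w) v by [].
  move: (W _) (y _) (h _) (block_age _ _ _ _ _ _ _) => l s z u.
  by case: (delivered _ _ _ _) => /=; ring.
apply: time_average_age_cvg => //.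
  by apply: cvg_trans cL; apply: near_eq_cvg; apply: nearW => N; rewrite startE.
rewrite -[X in _ --> X]add0r.
rewrite (_ : (fun N => _) = (fun N : nat => N%:R^-1 * (idle 0 w ^+ 2 / 2) +
    N%:R^-1 * \sum_(v < N) block_area B (idle 0) W h y dl v w)).
  apply: cvgD => //; rewrite -[X in _ --> X](mul0r (idle 0 w ^+ 2 / 2)).
  apply: cvgM; last exact: cvg_cst.
  by rewrite -(cvg_shiftS (fun N : nat => N%:R^-1 : R)); exact: cvg_harmonic.
apply/funext => N; rewrite /total_area startE big_ord0 addr0 -mulrDr; congr (_ * (_ + _)).
by apply: eq_bigr => v _; rewrite areaE.
Qed.

End Relay_age.

(** * Large networks *)

Section Mean_age.
Context {R : realType}.

Definition mean_age (lam c lam' c' : R) (n k1 k2 : nat) : R :=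
  let p1 := k1%:R / n%:R in
  let p2 := k2%:R / n%:R in
  let m2 := c' + harmonic_tail n k2 / lam' in
  let rho := p1^-1 * (c + harmonic_tail n k1 / lam) in
  let edy := p2 * c' + (k2%:R - (n - k2)%:R * harmonic_tail n k2) / n%:R / lam' in
  let eh := p1^-1 * (p1 * c + (k1%:R - (n - k1)%:R * harmonic_tail n k1) / n%:R / lam) in
  let eW := m2 + rho in
  let eW2 := m2 ^+ 2 + harmonic_tail2 n k2 / lam' ^+ 2 + 2 * (m2 * rho) + 2 * rho ^+ 2 in
  (eW2 / 2 + (edy + (eW - p2 * eW)) * ((eW + p2 * eh) / p2) + (p2 * eW - edy) * eh) / eW.

Lemma average_age_mean_age (lam c lam' c' : R) (n k1 k2 : nat) :
  0 < lam -> 0 < c -> 0 < lam' -> 0 < c' -> (0 < k1 < n)%N -> (0 < k2 < n)%N ->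
  average_age_exp lam c lam' c' n k1 k2 (mean_age lam c lam' c' n k1 k2).
Proof.
move=> lam0 c0 lam'0 c'0 k1n k2n d T P a b X Y Z [lawX lawY lawZ indF].
have mX m i : measurable_fun setT (X m i) by [].
have mY v i : measurable_fun setT (Y v i) by [].
have mZ j : measurable_fun setT (Z j) by [].
have mu := mean_reception_time a mX mY mZ k1n indF lam0 c0 lawX.
rewrite /xpath in mu; rewrite mu /= in lawZ.
have rate0 : 0 < ((k1%:R / n%:R)^-1 * (c + harmonic_tail n k1 / lam))^-1.
  rewrite invr_gt0 mulr_gt0 ?invr_gt0 ?reception_prob_gt0//.
  by rewrite ltr_wpDr// divr_ge0 ?(ltW lam0)// sumr_ge0// => j _; rewrite invr_ge0.
have := relay_age_cvg a b mX mY mZ k1n k2n indF lam0 c0 lam'0 c'0 rate0 lawX lawY lawZ.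
by rewrite invrK.
Qed.

(** The first two terms are the mean square of the cycle length over twice its mean, split into
    variance and squared mean. The third accounts for cycles without delivery, and the last two are
    the mean link delays given delivery and given reception. The harmonic sums are free arguments so
    that limits can be substituted for them. *)
Definition limit_age (lam lam' c c' : R) (p1 p2 H1 H2 G : R) : R :=
  let rho := p1^-1 * (c + H1 / lam) in
  let eW := c' + H2 / lam' + rho in
  (G / lam' ^+ 2 + rho ^+ 2) / (2 * eW) + eW / 2 + eW * (1 - p2) / p2 +
  (c' + (1 - (1 - p2) / p2 * H2) / lam') + (c + (1 - (1 - p1) / p1 * H1) / lam).

Lemma mean_age_limit_age (lam c lam' c' : R) (n k1 k2 : nat) :
  0 < lam -> 0 < c -> 0 < lam' -> 0 < c' -> (0 < k1 < n)%N -> (0 < k2 < n)%N ->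
  mean_age lam c lam' c' n k1 k2 =
  limit_age lam lam' c c' (k1%:R / n%:R) (k2%:R / n%:R)
    (harmonic_tail n k1) (harmonic_tail n k2) (harmonic_tail2 n k2).
Proof.
move=> lam0 c0 lam'0 c'0 k1n k2n.
have p1_gt0 : 0 < k1%:R / n%:R :> R by exact: reception_prob_gt0.
have p2_gt0 : 0 < k2%:R / n%:R :> R by exact: reception_prob_gt0.
have H_ge0 k : 0 <= harmonic_tail n k :> R by apply: sumr_ge0 => j _; rewrite invr_ge0.
have n0 : n%:R != 0 :> R.
  by rewrite pnatr_eq0 -lt0n; case/andP: k1n => k10; exact: ltn_trans.
have tailE k : (k <= n)%N -> (k%:R - (n - k)%:R * harmonic_tail n k) / n%:R =
    k%:R / n%:R - (1 - k%:R / n%:R) * harmonic_tail n k :> R.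
  by move=> kn; rewrite natrB//; field.
rewrite /mean_age /limit_age !tailE; last 2 first.
- by case/andP: k1n => _ /ltnW.
- by case/andP: k2n => _ /ltnW.
have rho0 : 0 < (k1%:R / n%:R)^-1 * (c + harmonic_tail n k1 / lam).
  by rewrite mulr_gt0 ?invr_gt0// ltr_wpDr// divr_ge0// ltW.
have m0 : 0 < c' + harmonic_tail n k2 / lam' by rewrite ltr_wpDr// divr_ge0// ltW.
move: (k1%:R / n%:R) (k2%:R / n%:R) (harmonic_tail n k1) (harmonic_tail n k2)
  (harmonic_tail2 n k2) p1_gt0 p2_gt0 rho0 m0 => p1 p2 H1 H2 G p1_gt0 p2_gt0 rho0 m0.
set rho := _^-1 * _ in rho0 *; set m := c' + _ in m0 *.
have e1 : p2 * c' + (p2 - (1 - p2) * H2) / lam' =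
    p2 * (c' + (1 - (1 - p2) / p2 * H2) / lam').
  by field; rewrite ?gt_eqF.
have e2 : p1^-1 * (p1 * c + (p1 - (1 - p1) * H1) / lam) =
    c + (1 - (1 - p1) / p1 * H1) / lam.
  by field; rewrite ?gt_eqF.
rewrite e1 e2; move: (c' + (1 - _) / lam') (c + (1 - _) / lam) => s t.
have lam'_neq0 : lam' != 0 by rewrite gt_eqF.
have eW_neq0 : m + rho != 0 by rewrite gt_eqF// addr_gt0.
have p2_neq0 : p2 != 0 by rewrite gt_eqF.
move: (G / lam' ^+ 2) => v; field.
by rewrite p2_neq0 eW_neq0.
Qed.

(** Telescoping of [ln (m + 2) - ln (m + 1) <= 1 / (m + 1) <= ln (m + 1) - ln m], both of which are
    instances of [ln (1 + x) <= x]. *)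
Lemma harmonic_tail_bounds n k : (k < n)%N ->
  - ln ((n - k).+1%:R / n.+1%:R) <= (harmonic_tail n k : R) <= - ln ((n - k)%:R / n%:R).
Proof.
elim: k => [|k IH] kn.
  rewrite subn0 !divff ?pnatr_eq0 -?lt0n// ln1 oppr0 /harmonic_tail big_ord0 lexx//.
have /IH/andP[h1 h2] := ltnW kn; rewrite harmonic_tailS.
have -> : (n - k = (n - k.+1).+1)%N by rewrite subnSK// ltnW.
set m := (n - k.+1)%N in h1 h2 *.
have nk : (n - k = m.+1)%N by rewrite subnSK// ltnW.
rewrite nk in h1 h2; have m0 : (0 < m)%N by rewrite subn_gt0.
have n0 : (0 < n)%N by exact: leq_ltn_trans kn.
have lnB (u v : nat) : (0 < u)%N -> (0 < v)%N -> ln (u%:R / v%:R) = ln u%:R - ln v%:R :> R.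
  by move=> u0 v0; rewrite ln_div// posrE ltr0n.
rewrite !lnB// in h1 h2 *.
have l1 : ln m.+2%:R - ln m.+1%:R <= m.+1%:R^-1 :> R.
  rewrite -lnB// (_ : m.+2%:R / m.+1%:R = 1 + m.+1%:R^-1 :> R).
    by rewrite le_ln1Dx// (lt_trans _ (_ : 0 < _))// ?ltrN10// invr_gt0.
  by rewrite -[m.+2%:R]natr1 mulrDl divff ?pnatr_eq0// mul1r.
have l2 : m.+1%:R^-1 <= ln m.+1%:R - ln m%:R :> R.
  rewrite -[leRHS]opprB lerNr -lnB// (_ : m%:R / m.+1%:R = 1 - m.+1%:R^-1 :> R).
    apply: le_ln1Dx; rewrite ltrN2 invf_lt1// ?ltr1n ?ltr0n//.
  by rewrite -[m.+1%:R in RHS]natr1 -natr1; field; rewrite natr1 pnatr_eq0.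
move: (ln m.+2%:R) (ln m.+1%:R) (ln m%:R) (ln n.+1%:R) (ln n%:R) m.+1%:R^-1
  (harmonic_tail n k) h1 h2 l1 l2 => A B C D E I H h1 h2 l1 l2.
by apply/andP; split; lra.
Qed.

Lemma harmonic_tail2_le n k : (k < n)%N ->
  0 <= (harmonic_tail2 n k : R) <= k%:R / (n - k)%:R ^+ 2.
Proof.
move=> kn; apply/andP; split; first by apply: sumr_ge0 => j _; rewrite invr_ge0 exprn_ge0.
apply: (@le_trans _ _ (\sum_(j < k) ((n - k)%:R ^+ 2)^-1)).
  apply: ler_sum => j _; rewrite lef_pV2 ?posrE ?exprn_gt0 ?ltr0n ?subn_gt0//.
    by rewrite ler_pXn2r ?nnegrE// ler_nat leq_sub2l// ltnW.
  exact: ltn_trans kn.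
by rewrite sumr_const card_ord -[leLHS]mulr_natl.
Qed.

End Mean_age.

(** * The limit of the mean age *)

Section Large_networks.
Context {R : realType}.
Variables (lam c lam' c' a1 a2 : R).
Hypotheses (lam0 : 0 < lam) (c0 : 0 < c) (lam'0 : 0 < lam') (c'0 : 0 < c')
  (a1_01 : 0 < a1 < 1) (a2_01 : 0 < a2 < 1).

(** [a1 * n] need not be an integer; a distance below 1 admits both of its roundings. *)
Definition proportional (n k1 k2 : nat) : Prop :=
  [/\ (0 < k1 < n)%N, (0 < k2 < n)%N, `|k1%:R - a1 * n%:R| < 1 & `|k2%:R - a2 * n%:R| < 1].

(* Convergence along this filter is convergence as [n] grows, uniformly in the
   admissible [k1] and [k2]. *)
Definition large_network : set_system (nat * nat * nat) :=
  [set Q | \forall n \near \oo, forall k1 k2, proportional n k1 k2 -> Q (n, k1, k2)].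

Global Instance large_network_filter : Filter large_network.
Proof.
split; rewrite /large_network /mkset.
- exact: nearW.
- by move=> A B; apply: filterS2 => n hA hB k1 k2 h; split; [exact: hA|exact: hB].
- by move=> A B AB; apply: filterS => n hA k1 k2 /hA/AB.
Qed.

Local Notation F := large_network.

Lemma large_network_near (Q : nat -> nat -> nat -> Prop) :
  (forall n k1 k2, proportional n k1 k2 -> Q n k1 k2) ->
  \forall q \near F, Q q.1.1 q.1.2 q.2.
Proof.
move=> h; suff : \forall n \near \oo, forall k1 k2, proportional n k1 k2 -> Q n k1 k2 by [].
exact: nearW.
Qed.

Lemma cvg_size (u : nat -> R) (l : R) : u @ \oo --> l -> u q.1.1 @[q --> F] --> l.
Proof.
move=> ul A /ul uA.
have {}uA : \forall n \near \oo, A (u n) := uA.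
suff : \forall n \near \oo, forall k1 k2, proportional n k1 k2 -> A (u n) by [].
by apply: filterS uA.
Qed.

Lemma cvg_inv_size : q.1.1%:R^-1 @[q --> F] --> (0 : R).
Proof.
apply: (cvg_size (u := fun N => N%:R^-1)).
by rewrite -(cvg_shiftS (fun N : nat => N%:R^-1 : R)); exact: cvg_harmonic.
Qed.

Lemma cvg_inv_sizeS : q.1.1.+1%:R^-1 @[q --> F] --> (0 : R).
Proof. exact: (cvg_size (u := fun N => N.+1%:R^-1) (@cvg_harmonic R)). Qed.

Section One_hop.
(** [k] selects [k1] or [k2] from the triple, so both hops are treated at once. *)
Variables (a : R) (k : nat * nat * nat -> nat).
Hypothesis a01 : 0 < a < 1.
Hypothesis kP : \forall q \near F, (0 < k q < q.1.1)%N /\ `|(k q)%:R - a * q.1.1%:R| < 1.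

Lemma cvg_fraction : (k q)%:R / q.1.1%:R @[q --> F] --> a.
Proof.
apply/cvgrPdist_lt => e e0.
move/cvgr0Pnorm_lt: cvg_inv_size => /(_ e e0) he.
apply: filterS2 kP he => q [/andP[k0 kn] ka]; apply: le_lt_trans.
have n0 : 0 < q.1.1%:R :> R by rewrite ltr0n (ltn_trans k0).
rewrite distrC (_ : _ - a = ((k q)%:R - a * q.1.1%:R) / q.1.1%:R); last first.
  by field; rewrite gt_eqF.
by rewrite normrM; apply: ler_piMl => //; exact: ltW.
Qed.

Lemma cvg_harmonic_tail : harmonic_tail q.1.1 (k q) @[q --> F] --> - ln (1 - a).
Proof.
have a_lt1 : 0 < 1 - a by case/andP: a01 => _; rewrite subr_gt0.
have cln : {for 1 - a, continuous (@ln R)} by exact: continuous_ln.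
(* The argument of the logarithm is [(n - k + 1) / (n + 1)] rewritten through [k / n]. *)
have low : - ln (1 - (k q)%:R / q.1.1%:R * (1 - q.1.1.+1%:R^-1)) @[q --> F] --> - ln (1 - a).
  apply: cvgN.
  have h : 1 - (k q)%:R / q.1.1%:R * (1 - q.1.1.+1%:R^-1) @[q --> F] --> 1 - a.
    rewrite -[a]mulr1 -[X in _ * X]subr0; apply: cvgB; first exact: cvg_cst.
    apply: (cvgM cvg_fraction); apply: cvgB cvg_inv_sizeS; exact: cvg_cst.
  exact: (cvg_comp _ _ h cln).
have up : - ln (1 - (k q)%:R / q.1.1%:R) @[q --> F] --> - ln (1 - a).
  apply: cvgN.
  have h : 1 - (k q)%:R / q.1.1%:R @[q --> F] --> 1 - a.
    by apply: cvgB cvg_fraction; exact: cvg_cst.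
  exact: (cvg_comp _ _ h cln).
apply: squeeze_cvgr low up; apply: filterS kP => q [/andP[k0 kn] _].
have n0 : q.1.1%:R != 0 :> R by rewrite pnatr_eq0 -lt0n (ltn_trans k0).
have n1 : q.1.1%:R + 1 != 0 :> R by rewrite natr1 pnatr_eq0.
have := @harmonic_tail_bounds R _ _ kn.
rewrite -!natr1 natrB ?(ltnW kn)//.
rewrite (_ : (q.1.1%:R - (k q)%:R) / q.1.1%:R = 1 - (k q)%:R / q.1.1%:R); last by field.
rewrite (_ : (_ - _ + 1) / (_ + 1) = 1 - (k q)%:R / q.1.1%:R * (1 - (q.1.1%:R + 1)^-1))//.
by field; rewrite n0 n1.
Qed.

Lemma cvg_harmonic_tail2 : harmonic_tail2 q.1.1 (k q) @[q --> F] --> (0 : R).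
Proof.
have h0 : (fun=> 0 : R) @ F --> (0 : R) by exact: cvg_cst.
have a_neq1 : 1 - a != 0 by case/andP: a01 => _ a_lt1; rewrite subr_eq0 gt_eqF.
have h1 : (k q)%:R / q.1.1%:R / (1 - (k q)%:R / q.1.1%:R) ^+ 2 * q.1.1%:R^-1 @[q --> F] --> (0 : R).
  rewrite -[X in _ --> X](mulr0 (a / (1 - a) ^+ 2)); apply: cvgM cvg_inv_size.
  apply: cvgM; first exact: cvg_fraction.
  apply: cvgV; first by rewrite expf_neq0.
  have h : 1 - (k q)%:R / q.1.1%:R @[q --> F] --> 1 - a.
    by apply: cvgB cvg_fraction; exact: cvg_cst.
  exact: (cvgM h h).
apply: squeeze_cvgr h0 h1; apply: filterS kP => q [/andP[k0 kn] _].
have /andP[-> h] := @harmonic_tail2_le R _ _ kn; apply: le_trans h _; rewrite le_eqVlt.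
have n0 : q.1.1%:R != 0 :> R by rewrite pnatr_eq0 -lt0n (ltn_trans k0).
have nk : q.1.1%:R - (k q)%:R != 0 :> R by rewrite subr_eq0 eqr_nat gtn_eqF.
apply/orP; left; apply/eqP; rewrite natrB ?(ltnW kn)//; field.
by rewrite n0 nk.
Qed.

End One_hop.

Let k1P : \forall q \near F, (0 < q.1.2 < q.1.1)%N /\ `|(q.1.2)%:R - a1 * q.1.1%:R| < 1.
Proof.
by apply: (large_network_near (Q := fun n k1 _ => (0 < k1 < n)%N /\ `|k1%:R - a1 * n%:R| < 1)) => n k1 k2 [].
Qed.

Let k2P : \forall q \near F, (0 < q.2 < q.1.1)%N /\ `|(q.2)%:R - a2 * q.1.1%:R| < 1.
Proof.
by apply: (large_network_near (Q := fun n _ k2 => (0 < k2 < n)%N /\ `|k2%:R - a2 * n%:R| < 1)) => n k1 k2 [].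
Qed.

Lemma cvg_mean_age : mean_age lam c lam' c' q.1.1 q.1.2 q.2 @[q --> F] -->
  limit_age lam lam' c c' a1 a2 (- ln (1 - a1)) (- ln (1 - a2)) 0.
Proof.
have /andP[a1_gt0 a1_lt1] := a1_01; have /andP[a2_gt0 a2_lt1] := a2_01.
have l1 : ln (1 - a1) < 0 by rewrite ln_lt0//; lra.
have l2 : ln (1 - a2) < 0 by rewrite ln_lt0//; lra.
have cp1 := cvg_fraction k1P; have cp2 := cvg_fraction k2P.
have cH1 := cvg_harmonic_tail a1_01 k1P; have cH2 := cvg_harmonic_tail a2_01 k2P.
have cG := cvg_harmonic_tail2 a2_01 k2P.
pose f q := limit_age lam lam' c c' (q.1.2%:R / q.1.1%:R) (q.2%:R / q.1.1%:R)
  (harmonic_tail q.1.1 q.1.2) (harmonic_tail q.1.1 q.2) (harmonic_tail2 q.1.1 q.2) : R.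
have fE : \forall q \near F, f q = mean_age lam c lam' c' q.1.1 q.1.2 q.2.
  apply: (large_network_near (Q := fun n k1 k2 => f (n, k1, k2) = mean_age lam c lam' c' n k1 k2)).
  by move=> n k1 k2 [k1n k2n _ _]; rewrite mean_age_limit_age.
apply: cvg_trans (near_eq_cvg fE) _; rewrite /f /limit_age.
have cc (t : R) : (fun _ : nat * nat * nat => t) @ F --> t by exact: cvg_cst.
have crho : (q.1.2%:R / q.1.1%:R)^-1 * (c + harmonic_tail q.1.1 q.1.2 / lam) @[q --> F] -->
    a1^-1 * (c + - ln (1 - a1) / lam).
  by apply: cvgM; [apply: cvgV => //; rewrite gt_eqF|apply: cvgD => //; apply: cvgM].
have rho0 : 0 < a1^-1 * (c + - ln (1 - a1) / lam).
  by rewrite mulr_gt0 ?invr_gt0// addr_gt0// divr_gt0// oppr_gt0.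
have m0 : 0 < c' + - ln (1 - a2) / lam' by rewrite addr_gt0// divr_gt0// oppr_gt0.
have ceW : c' + harmonic_tail q.1.1 q.2 / lam' +
    (q.1.2%:R / q.1.1%:R)^-1 * (c + harmonic_tail q.1.1 q.1.2 / lam) @[q --> F] -->
    c' + - ln (1 - a2) / lam' + a1^-1 * (c + - ln (1 - a1) / lam).
  by apply: cvgD => //; apply: cvgD => //; apply: cvgM.
have tail (p H : nat * nat * nat -> R) (u v e l : R) : u != 0 ->
    p @ F --> u -> H @ F --> v ->
    e + (1 - (1 - p q) / p q * H q) / l @[q --> F] --> e + (1 - (1 - u) / u * v) / l.
  move=> u0 cp cH; apply: cvgD => //; apply: cvgM => //; apply: cvgB => //.
  by apply: cvgM => //; apply: cvgM; [exact: cvgB|exact: cvgV].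
apply: cvgD; last by apply: tail => //; rewrite gt_eqF.
apply: cvgD; last by apply: tail => //; rewrite gt_eqF.
apply: cvgD; last first.
  by apply: cvgM; [apply: cvgM => //; exact: cvgB|apply: cvgV => //; rewrite gt_eqF].
apply: cvgD; last exact: cvgM.
apply: cvgM.
  by apply: cvgD; [exact: cvgM|exact: (cvgM crho crho)].
by apply: cvgV; [rewrite mulf_neq0// gt_eqF// addr_gt0|exact: cvgM].
Qed.

End Large_networks.

Theorem corollary4 (R : realType) (lam c lam' c' : R)
    (lam_gt0 : 0 < lam) (c_gt0 : 0 < c) (lam'_gt0 : 0 < lam') (c'_gt0 : 0 < c') :
  exists Delta : nat -> nat -> nat -> R,
    (forall n k1 k2 : nat, (0 < k1 < n)%N -> (0 < k2 < n)%N ->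
      average_age_exp lam c lam' c' n k1 k2 (Delta n k1 k2)) /\
    (forall a1 a2 : R, 0 < a1 < 1 -> 0 < a2 < 1 ->
      let K1 := lam * c - ln (1 - a1) in
      let K2 := lam' * c' - ln (1 - a2) in
      forall eps : R, 0 < eps ->
      \forall n \near \oo, forall k1 k2 : nat,
        (0 < k1 < n)%N -> (0 < k2 < n)%N ->
        `|k1%:R - a1 * n%:R| < 1 -> `|k2%:R - a2 * n%:R| < 1 ->
        `|Delta n k1 k2 -
          (lam^-1 + lam'^-1 + c' / a2 + c' / 2
           - (2 * lam')^-1 * ln (1 - a2)
           + (2 - a2 + 2 * a1 * a2) / (2 * a1 * a2) * c
           + lam' * K1 ^+ 2 / (2 * a1 * lam * (lam * a1 * K2 + lam' * K1))
           + (3 * a2 - 2 * a1 * a2 - 2) / (2 * a1 * a2 * lam) * ln (1 - a1))|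
        < eps).
Proof.
(* The witness is the exact average age for all admissible [n], [k1], [k2]; only the second claim is
   asymptotic. *)
exists (mean_age lam c lam' c'); split=> [n k1 k2 k1n k2n|a1 a2 a1_01 a2_01 K1 K2 eps eps0].
  exact: average_age_mean_age.
have /andP[a1_gt0 a1_lt1] := a1_01; have /andP[a2_gt0 a2_lt1] := a2_01.
have /cvgrPdist_lt/(_ eps eps0) := cvg_mean_age lam_gt0 c_gt0 lam'_gt0 c'_gt0 a1_01 a2_01.
move=> near_limit.
have {}near_limit : \forall n \near \oo, forall k1 k2, proportional a1 a2 n k1 k2 ->
  `|limit_age lam lam' c c' a1 a2 (- ln (1 - a1)) (- ln (1 - a2)) 0 -
    mean_age lam c lam' c' n k1 k2| < eps := near_limit.
apply: filterS near_limit => n h k1 k2 k1n k2n k1a k2a.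
have {h} := h k1 k2 (And4 k1n k2n k1a k2a); rewrite distrC.
set u := limit_age _ _ _ _ _ _ _ _ _.
suff -> : u = lam^-1 + lam'^-1 + c' / a2 + c' / 2 - (2 * lam')^-1 * ln (1 - a2)
   + (2 - a2 + 2 * a1 * a2) / (2 * a1 * a2) * c
   + lam' * K1 ^+ 2 / (2 * a1 * lam * (lam * a1 * K2 + lam' * K1))
   + (3 * a2 - 2 * a1 * a2 - 2) / (2 * a1 * a2 * lam) * ln (1 - a1) by [].
have l1 : ln (1 - a1) < 0 by rewrite ln_lt0//; lra.
have l2 : ln (1 - a2) < 0 by rewrite ln_lt0//; lra.
have K1_gt0 : 0 < K1 by rewrite subr_gt0 (lt_trans l1)// mulr_gt0.
have K2_gt0 : 0 < K2 by rewrite subr_gt0 (lt_trans l2)// mulr_gt0.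
(* This denominator is [a1 * lam * lam'] times the limiting mean cycle length; the fraction with
   [K1 ^+ 2] comes from the squared mean idle time over twice that length. *)
have den : lam * a1 * K2 + lam' * K1 != 0 by rewrite gt_eqF// addr_gt0 ?mulr_gt0.
rewrite /u /limit_age; rewrite /K1 /K2 in den *.
move: (ln (1 - a1)) (ln (1 - a2)) den => x y den; field.
by rewrite ?den ?gt_eqF.
Qed.
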